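(* Let $\lambda\in\Lambda[a,b]$, $1\le p<2$, and let $f$ be a $(\lambda,p)$-decomposable function on $[a,b]$. If $D^-_{\lambda,p}(f)\ne\emptyset$, then in the class $\mathrm{dual}(\mathcal W_p)[a,b]\cap Q_\lambda[a,b]$ the Doléans exponential $\mathcal E_b(f)$ is the unique solution $G$, with $G(b)=1$, of the augmented backward linear Right $\lambda$-integral equation $d^{\leftarrow}_\lambda G=G\,d^{\leftarrow}_\lambda f$ on $[a,b]$.
   Context: Fix real $a<b$. A function $f:[a,b]\to\mathbb R$ is regulated if the finite limits $f(t-)$, $t\in(a,b]$, and $f(s+)$, $s\in[a,b)$, exist; $\Delta^-f(t)=f(t)-f(t-)$ and $\Delta^+f(s)=f(s+)-f(s)$. $\Lambda[a,b]$ is the set of sequences $\lambda=\{\lambda_m:m\ge1\}$ of partitions (finite sets $a=t_0<\dots<t_n=b$) of $[a,b]$ with $\lambda_m\subset\lambda_{m+1}$ and $\cup\lambda:=\bigcup_m\lambda_m$ dense in $[a,b]$. For $a\le s<t\le b$ let $\lambda_m|_{[s,t]}=\{s,t\}\cup(\lambda_m\cap(s,t))=\{s=x_0<\dots<x_n=t\}$. Sums over the points of an interval are unconditional (equivalently, absolutely convergent). Quadratic $\lambda$-covariation: for regulated $f_1,f_2$, the pair $(f_1,f_2)$ has the quadratic $\lambda$-covariation on $[a,b]$ if there is a regulated $B$ with $B(a)=0$ and, for all $a\le s<t\le b$, $B(t)-B(s)=\lim_m\sum_i[f_1(x_i)-f_1(x_{i-1})][f_2(x_i)-f_2(x_{i-1})]$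 (sum over $\lambda_m|_{[s,t]}$), $\Delta^-B(t)=\Delta^-f_1(t)\Delta^-f_2(t)$, $\Delta^+B(s)=\Delta^+f_1(s)\Delta^+f_2(s)$; then $[f_1,f_2]_\lambda:=B$. $f$ has the quadratic $\lambda$-variation ($f\in Q_\lambda[a,b]$) if $(f,f)$ has the quadratic $\lambda$-covariation; $[f]_\lambda:=[f,f]_\lambda$ and $[f]^c_\lambda(t)=[f]_\lambda(t)-\sum_{(a,t]}(\Delta^-f)^2-\sum_{[a,t)}(\Delta^+f)^2$. The $2$-vector function $(f_1,f_2)$ has the quadratic $\lambda$-variation if $f_1,f_2\in Q_\lambda[a,b]$ and $(f_1,f_2)$ has the quadratic $\lambda$-covariation. For $0<p<\infty$, $v_p(f;[a,b])=\sup\sum_i|f(t_i)-f(t_{i-1})|^p$ over all partitions of $[a,b]$, and $\mathcal W_p[a,b]=\{f:v_p(f;[a,b])<\infty\}$. $\mathrm{dual}(\mathcal W_1)[a,b]$ is the set of all regulated functions; for $1<p<\infty$, $\mathrm{dual}(\mathcal W_p)[a,b]=\bigcup\{\mathcal W_q[a,b]:\tfrac1p+\tfrac1q>1\}$. A regulated $f$ is $(\lambda,p)$-decomposable if there is a pair $(g,h)$ of regulated functions with $g\in Q_\lambda[a,b]\cap\mathrm{dual}(\mathcal W_p)[a,b]$, $h\in\mathcal W_p[a,b]$, $g(a)=h(a)=0$ and $f\equiv C+g+h$ for some constant $C$; $D_{\lambda,p}(f)$ is the set of all such pairs, and $D^-_{\lambda,p}(f)$ is the set of $(g,h)\in D_{\lambda,p}(f)$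 with $\{t\in(a,b):\Delta^-g(t)\ne0\}\cup\{t\in(a,b):\Delta^-h(t)\ne0\}\subset\cup\lambda$. If $D^-_{\lambda,p}(f)\neq\emptyset$ then $f\in Q_\lambda[a,b]$. Vector Right Cauchy $\lambda$-integral: for regulated $F_1,F_2,f_1,f_2$, $(RC)\int\langle(F_1,F_2),d_\lambda(f_1,f_2)\rangle$ is defined on $[a,b]$ if there is a regulated $\Psi$ with $\Psi(a)=0$ and, for all $a\le s<t\le b$, $\Psi(t)-\Psi(s)=\lim_m\sum_i\sum_{k=1}^2F_k(x_i)[f_k(x_i)-f_k(x_{i-1})]$ (sum over $\lambda_m|_{[s,t]}$), $\Delta^-\Psi(t)=\sum_kF_k(t)\Delta^-f_k(t)$, $\Delta^+\Psi(s)=\sum_kF_k(s+)\Delta^+f_k(s)$; its value over $[s,t]$ is $\Psi(t)-\Psi(s)$. Right Young integral: for regulated $G,h$ and $u<v$, $(RY)\int_u^vG\,dh=(RRS)\int_u^vG_+^{(v)}\,dh_-^{(u)}-\sum_{(u,v)}\Delta^+G\Delta^-h+G(v)\Delta^-h(v)$ provided the integral exists and the sum converges unconditionally, where $(RRS)$ is the refinement Riemann–Stieltjes integral (limit of Riemann–Stieltjes sums directed by refinement of partitions), $G_+^{(v)}(x)=G(x+)$ on $[u,v)$, $G_+^{(v)}(v)=G(v)$, $h_-^{(u)}(x)=h(x-)$ on $(u,v]$, $h_-^{(u)}(u)=h(u)$; it is $0$ if $u=v$. Augmented equation: $G\in\mathrm{dual}(\mathcal W_p)[a,b]\cap Q_\lambda[a,b]$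 is a solution of $d^{\leftarrow}_\lambda G=G\,d^{\leftarrow}_\lambda f$ on $[a,b]$ if: (i) for every $(g,h)\in D^-_{\lambda,p}(f)$ and every $\psi\in\mathrm{dual}(\mathcal W_p)[a,b]$, $(RC)\int\langle(\psi,\psi G),d_\lambda(G,g)\rangle$ is defined on $[a,b]$ and $(RC)\int_y^b\langle(\psi,\psi G),d_\lambda(G,g)\rangle=-(RY)\int_y^b\psi G\,dh$ for $a\le y\le b$; and (ii) the $2$-vector function $(G,f)$ has the quadratic $\lambda$-variation and, for $a\le y\le b$, $[G]_\lambda(y)=(RY)\int_a^yG^2\,d[f]_\lambda$ and $[G,f]_\lambda(y)=-(RY)\int_a^yG\,d[f]_\lambda$. (Together with $G(b)=1$ this contains the equation $G(y)=1+(R)\int_y^bG\,d_\lambda f$, where $(R)\int G\,d_\lambda f=(RC)\int G\,d_\lambda g+(RY)\int G\,dh$.) Backward Doléans exponential: $\mathcal E_b(f;b)=1$ and, for $x\in[a,b)$, $$\mathcal E_b(f;x)=\exp\{f(b)-f(x)-\tfrac12[f]^c_\lambda(b)+\tfrac12[f]^c_\lambda(x)\}\prod_{t\in(x,b]}(1+\Delta^-f(t))e^{-\Delta^-f(t)}\prod_{t\in[x,b)}(1+\Delta^+f(t))e^{-\Delta^+f(t)},$$ with absolutely convergent products. *)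

(* Defs.v *)
From HB Require Import structures.
From mathcomp Require Import all_boot all_order all_algebra finmap.
From mathcomp Require Import all_classical all_reals all_analysis.
From mathcomp Require summability.

Set Implicit Arguments.
Unset Strict Implicit.
Unset Printing Implicit Defensive.
Import Order.TTheory GRing.Theory Num.Theory.
Import numFieldNormedType.Exports.
Local Open Scope classical_set_scope.
Local Open Scope ring_scope.

(* Functions on [a, b] are functions R -> R
   whose values outside [a, b] never matter: for t in ]a, b] the limit f(t-),
   and for s in [a, b[ the limit f(s+), only see values taken in [a, b]. *)

Section defs.
Context {R : realType}.
Implicit Types (a b s t u v p x y : R) (f g h F G B psi : R -> R).
Implicit Types (xs : seq R) (D : set R) (lam : nat -> seq R).

Definition lft f t : R := lim (f x @[x --> t^'-]).
Definition rgt f s : R := lim (f x @[x --> s^'+]).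
Definition djump f t : R := f t - lft f t.
Definition ujump f s : R := rgt f s - f s.

Definition regulated a b f : Prop :=
  (forall t, a < t <= b -> cvg (f x @[x --> t^'-])) /\
  (forall s, a <= s < b -> cvg (f x @[x --> s^'+])).

Definition usum_cvg D F (S : R) : Prop :=
  (fun A : {fset R} => \sum_(t <- A | t \in D) F t) @ summability.totally --> S.
Definition usum D F : R :=
  lim ((fun A : {fset R} => \sum_(t <- A | t \in D) F t)
         @ summability.totally).
Definition uprod D F : R :=
  lim ((fun A : {fset R} => \prod_(t <- A | t \in D) F t)
         @ summability.totally).
Definition abs_cvg_prod D F : Prop := summable D (fun t => (F t - 1)%:E).

(* As in [itv_partition], a partition s = x_0 < ... < x_n = t is given by its
   first point s together with the list xs = [x_1; ...; x_n]. *)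
Definition ppt s xs (i : nat) : R := nth s (s :: xs) i.
Definition psum (phi : R -> R -> R) s xs : R :=
  \sum_(0 <= i < size xs) phi (ppt s xs i) (ppt s xs i.+1).

Definition cup a lam : set R := [set x | exists m, x \in a :: lam m].

(* Lambda[a,b], indexed from 0 instead of 1. *)
Definition Lambda a b lam : Prop :=
  [/\ forall m, itv_partition a b (lam m),
      forall m, {subset lam m <= lam m.+1} &
      `[a, b] `<=` closure (cup a lam)].

(* The partition induced by lam_m on [s, t], without its first point s. *)
Definition restr lam s t (m : nat) : seq R :=
  rcons [seq x <- lam m | s < x < t] t.

Definition is_qcov a b lam f1 f2 B : Prop :=
  [/\ regulated a b f1, regulated a b f2, regulated a b B, B a = 0 &
   forall s t, a <= s -> s < t -> t <= b ->
    [/\ psum (fun x y => (f1 y - f1 x) * (f2 y - f2 x)) s (restr lam s t m)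
          @[m --> \oo] --> B t - B s,
        djump B t = djump f1 t * djump f2 t &
        ujump B s = ujump f1 s * ujump f2 s]].

Definition has_qcov a b lam f1 f2 : Prop := exists B, is_qcov a b lam f1 f2 B.

(* [f1,f2]_lambda; on [a, b] it is determined by [is_qcov]. *)
Definition qcov a b lam f1 f2 : R -> R :=
  xget (cst 0) [set B | is_qcov a b lam f1 f2 B].

Definition has_qvar a b lam f : Prop := has_qcov a b lam f f.
Definition qvar a b lam f : R -> R := qcov a b lam f f.

Definition cqvar a b lam f t : R :=
  qvar a b lam f t - usum `]a, t] (fun x => djump f x ^+ 2)
                   - usum `[a, t[ (fun x => ujump f x ^+ 2).

Definition has_vec2_qvar a b lam f1 f2 : Prop :=
  [/\ has_qvar a b lam f1, has_qvar a b lam f2 & has_qcov a b lam f1 f2].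

Definition pvar p f a b : \bar R :=
  ereal_sup [set (psum (fun x y => `|f y - f x| `^ p) a xs)%:E |
             xs in [set xs | itv_partition a b xs]].

Definition W p a b f : Prop := (pvar p f a b < +oo)%E.

Definition dualW p a b f : Prop :=
  (p = 1 /\ regulated a b f) \/
  (1 < p /\ exists q : R, [/\ 0 < q, 1 < p^-1 + q^-1 & W q a b f]).

Definition decomp a b lam p f : set ((R -> R) * (R -> R)) :=
  [set gh | let: (g, h) := gh in
    [/\ regulated a b g /\ regulated a b h,
        has_qvar a b lam g /\ dualW p a b g,
        W p a b h,
        g a = 0 /\ h a = 0 &
        exists C : R, forall x, a <= x <= b -> f x = C + g x + h x]].

Definition decomposable a b lam p f : Prop :=
  regulated a b f /\ decomp a b lam p f !=set0.

Definition decomp_left a b lam p f : set ((R -> R) * (R -> R)) :=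
  [set gh | decomp a b lam p f gh /\
    [set t | a < t < b /\ djump gh.1 t != 0] `|`
    [set t | a < t < b /\ djump gh.2 t != 0] `<=` cup a lam].

Definition is_RC a b lam (F1 F2 f1 f2 Psi : R -> R) : Prop :=
  [/\ [/\ regulated a b F1, regulated a b F2, regulated a b f1 &
          regulated a b f2],
      regulated a b Psi, Psi a = 0 &
   forall s t, a <= s -> s < t -> t <= b ->
    [/\ psum (fun x y => F1 y * (f1 y - f1 x) + F2 y * (f2 y - f2 x)) s
          (restr lam s t m) @[m --> \oo] --> Psi t - Psi s,
        djump Psi t = F1 t * djump f1 t + F2 t * djump f2 t &
        ujump Psi s = rgt F1 s * ujump f1 s + rgt F2 s * ujump f2 s]].

Definition is_RRS G h u v (I : R) : Prop :=
  forall eps : R, 0 < eps -> exists2 ks : seq R, itv_partition u v ks &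
    forall (xs : seq R) (tag : nat -> R),
      itv_partition u v xs -> {subset ks <= xs} ->
      (forall i, (i < size xs)%N -> ppt u xs i <= tag i <= ppt u xs i.+1) ->
      `|\sum_(0 <= i < size xs) G (tag i) * (h (ppt u xs i.+1) - h (ppt u xs i))
        - I| < eps.

Definition Gplus G v x : R := if x < v then rgt G x else G x.
Definition hminus h u x : R := if u < x then lft h x else h x.

Definition is_RY G h u v (I : R) : Prop :=
  (u = v /\ I = 0) \/
  [/\ u < v, regulated u v G, regulated u v h &
   exists J S : R,
    [/\ is_RRS (Gplus G v) (hminus h u) u v J,
        usum_cvg `]u, v[ (fun x => ujump G x * djump h x) S &
        I = J - S + G v * djump h v]].

Definition aug_solution a b lam p f G : Prop :=
  [/\ dualW p a b G /\ has_qvar a b lam G,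
      (forall g h psi, decomp_left a b lam p f (g, h) -> dualW p a b psi ->
        exists2 Psi, is_RC a b lam psi (fun x => psi x * G x) G g Psi &
          forall y, a <= y <= b ->
            is_RY (fun x => psi x * G x) h y b (- (Psi b - Psi y))),
      has_vec2_qvar a b lam G f &
      forall y, a <= y <= b ->
        is_RY (fun x => G x ^+ 2) (qvar a b lam f) a y (qvar a b lam G y) /\
        is_RY G (qvar a b lam f) a y (- qcov a b lam G f y)].

Definition dfactor f t : R := (1 + djump f t) * expR (- djump f t).
Definition ufactor f t : R := (1 + ujump f t) * expR (- ujump f t).

Definition doleans a b lam f x : R :=
  if x == b then 1 else
  expR (f b - f x - 2^-1 * cqvar a b lam f b + 2^-1 * cqvar a b lam f x)
  * uprod `]x, b] (dfactor f) * uprod `[x, b[ (ufactor f).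

(* The limits chosen in [doleans] (and in [cqvar]) all exist, the products
   converging absolutely. *)
Definition doleans_defined a b lam f : Prop :=
  [/\ has_qvar a b lam f,
      forall t, a <= t <= b ->
        (exists S, usum_cvg `]a, t] (fun x => djump f x ^+ 2) S) /\
        (exists S, usum_cvg `[a, t[ (fun x => ujump f x ^+ 2) S) &
      forall x, a <= x < b ->
        abs_cvg_prod `]x, b] (dfactor f) /\ abs_cvg_prod `[x, b[ (ufactor f)].

End defs.

(* Main.v *)
Require Import Defs.
From mathcomp Require Import all_boot all_order all_algebra finmap.
From mathcomp Require Import all_classical all_reals all_analysis.
From mathcomp Require Import ring lra.
From mathcomp Require summability.

(** For x <= y in [a, b] let E(x, y) be the Doleans exponential of the interval
    from x to y ([propagator]), so that the exponential of the theorem is E(x, b).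
    It is multiplicative, E(x, z) = E(x, y) E(y, z), and an Ito expansion of one
    step ([propagator_expand]) gives, with B the quadratic variation of f and
    df, dB the increments from x to y,

      E(x, y) = 1 + df + ((df)^2 - dB) / 2 + third-order terms.

    Summed along the partitions, (df)^2 - dB vanishes against every regulated
    weight ([negligible_sq_qvar], [negligible_weight]) and so do the third-order
    terms.  Hence E(x, y) is 1 + df up to an error that is negligible, and whose
    squares have vanishing sums ([negligible_error], [error_sq_sum]).

    Existence.  Over one step the function G = E(., b) has the increment
    -G(y) df minus a negligible error.  Inserted into the sums that define the
    right Cauchy integral and the brackets of G, this leaves right sums of psi G
    against h, and of G and G^2 against B.  These converge to the corresponding
    Right Young integrals: step functions are integrated by hand, a regulated
    integrand is approximated by its composition with a monotone step map, and
    the Love-Young estimate bounds the error of the approximation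
    ([RY_integral_exists]).  The quadratic variation of f = C + g + h itself
    exists because the two brackets that involve h are sums over common jumps
    ([jump_covariation], [has_qvar_sum]).

    Uniqueness.  For a solution G let delta = G(x) - G(y) (1 + df).  The integral
    equation makes the right sums of delta vanish against all weights of the dual
    class ([defect_sum]); the two bracket equations say exactly that the sums of
    delta^2 vanish ([defect_sq_sum]).  With N(x) = E(s, x) the increments of N G
    are then sums of a weighted delta, a negligible error and a product of two
    quantities that are small in the sense of Cauchy-Schwarz, so N G has the same
    value at s and at b: G(s) = E(s, b) G(b) ([solution_propagator]).  No division
    by E takes place, so vanishing factors 1 + jump are harmless.

    Regulated functions are only controlled on one-sided punctured neighbourhoods.
    All estimates are therefore proved near each point and glued by
    [local_to_global], the terms that touch the point being handled by their
    limits there ([jump_limit]). *)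

Set Implicit Arguments.
Unset Strict Implicit.
Unset Printing Implicit Defensive.
Import Order.TTheory GRing.Theory Num.Theory.
Import numFieldNormedType.Exports.
Local Open Scope classical_set_scope.
Local Open Scope ring_scope.
Local Existing Instance summability.totally_filter.

(** * Induction on intervals and sums along partitions *)

Section one_sided.
Context {R : realType}.
Implicit Types (r s t x y : R) (P : R -> Prop).

Lemma near_leftP r P :
  (\forall x \near r^'-, P x) <-> exists2 s, s < r & forall x, s < x < r -> P x.
Proof.
split=> [|[s sr H]].
  rewrite /at_left /= near_withinE => -[e /= e0 He].
  exists (r - e) => [|x /andP[h1 h2]]; first by rewrite ltrBlDr ltrDl.
  apply: He => //=; rewrite /ball /= gtr0_norm ?subr_gt0 //.
  by rewrite ltrBlDl -ltrBlDr.
near=> x; apply: H; apply/andP; split; first by near: x; exact: nbhs_left_gt.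
by near: x; exact: nbhs_left_lt.
Unshelve. all: by end_near. Qed.

Lemma near_rightP r P :
  (\forall x \near r^'+, P x) <-> exists2 s, r < s & forall x, r < x < s -> P x.
Proof.
split=> [|[s sr H]].
  rewrite /at_right /= near_withinE => -[e /= e0 He].
  exists (r + e) => [|x /andP[h1 h2]]; first by rewrite ltrDl.
  apply: He => //=; rewrite /ball /= distrC gtr0_norm ?subr_gt0 //.
  by rewrite ltrBlDl.
near=> x; apply: H; apply/andP; split; first by near: x; exact: nbhs_right_gt.
by near: x; exact: nbhs_right_lt.
Unshelve. all: by end_near. Qed.

Lemma near_ooP (P : nat -> Prop) :
  (\forall m \near \oo, P m) <-> exists N, forall m, (N <= m)%N -> P m.
Proof.
by split=> [[N _ H]|[N H]]; exists N => // m /= Nm; apply: H.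
Qed.

(** The supremum of the points up to [t] that satisfy [Q] satisfies [Q] by the left
    step, and cannot lie below [t] by the right step. *)
Lemma real_induction (a b : R) (Q : R -> Prop) : a <= b -> Q a ->
  (forall t, a <= t < b -> Q t ->
     exists2 u, t < u & forall v, t < v < u -> v <= b -> Q v) ->
  (forall t, a < t <= b ->
     exists2 u, u < t & forall v, u < v < t -> a <= v -> Q v -> Q t) ->
  forall t, a <= t <= b -> Q t.
Proof.
move=> ab Qa QR QL t /andP[at_ tb].
pose A := [set x | a <= x <= t /\ Q x].
have Aa : A a by split=> //; rewrite lexx.
have ubA : ubound A t by move=> x [/andP[]].
have hsA : has_sup A by split; [exists a | exists t].
set c := sup A.
have ac : a <= c by apply: sup_upper_bound.
have ct : c <= t by apply: sup_le_ub => //; exists a.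
(* the supremum is approached strictly from the left unless it is attained *)
have Qc : Q c.
  have [<-//|nac] := eqVneq a c.
  have ac' : a < c by rewrite lt_neqAle nac.
  have [|u uc Hu] := QL c; first by rewrite ac' (le_trans ct).
  pose e := c - Num.max a u.
  have e0 : 0 < e by rewrite subr_gt0 gt_max ac' uc.
  have [x [/andP[ax xt] Qx] ex] := sup_adherent e0 hsA.
  have xc : x <= c by apply: sup_upper_bound => //; rewrite /A /= ax xt.
  have [<-//|nxc] := eqVneq x c.
  have xc' : x < c by rewrite lt_neqAle nxc.
  apply: (Hu x) => //; rewrite xc' andbT.
  by apply: le_lt_trans ex; rewrite /e subKr le_max lexx orbT.
have [<-//|nct] := eqVneq c t.
have ct' : c < t by rewrite lt_neqAle nct.
have [|u cu Hu] := QR c _ Qc; first by rewrite ac (lt_le_trans ct').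
pose v := (c + Num.min t u) / 2.
have m1 : c < Num.min t u by rewrite lt_min ct' cu.
have [mt mu] : Num.min t u <= t /\ Num.min t u <= u.
  by rewrite !ge_min !lexx orbT.
have : v <= c.
  apply: sup_upper_bound => //; split; first by rewrite /v; apply/andP; split; lra.
  apply: Hu; rewrite /v; last by lra.
  by apply/andP; split; lra.
by rewrite /v => ?; exfalso; lra.
Qed.

(** Real induction on the right end point.  It stands in for compactness: information
    about a regulated function is available only on each side of a point, and no
    more is asked for here. *)
Lemma local_to_global (a b : R) (P : R -> R -> Prop) :
  (forall s r t, a <= s -> s < r -> r < t -> t <= b -> P s r -> P r t -> P s t) ->
  (forall r, a < r <= b -> exists2 u, u < r & forall s, u < s < r -> a <= s -> P s r) ->
  (forall r, a <= r < b -> exists2 u, r < u & forall t, r < t < u -> t <= b -> P r t) ->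
  forall s t, a <= s -> s < t -> t <= b -> P s t.
Proof.
move=> glue locL locR s t as_ st tb.
pose Q x := x = s \/ (s < x /\ P s x).
suff [ts|[]//] : Q t by move: st; rewrite ts ltxx.
have slet : s <= t by exact: ltW.
apply: (@real_induction s t Q slet) => [|x /andP[sx xt] Qx|x /andP[sx xt]|].
- by left.
- have [|u xu Hu] := locR x; first by rewrite (le_trans as_) //= (lt_le_trans xt).
  exists u => // v /andP[xv vu] vt; right; split; first exact: le_lt_trans xv.
  have Pxv : P x v by apply: Hu; rewrite ?xv // (le_trans vt).
  by case: Qx => [<-//|[sx' Psx]]; apply: (glue s x v) => //; exact: le_trans tb.
- have [|u ux Hu] := locL x; first by rewrite (le_lt_trans as_) //= (le_trans xt).
  exists u => // v /andP[uv vx] sv Qv; right; split => //.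
  have Pvx : P v x by apply: Hu; rewrite ?uv // (le_trans as_).
  by case: Qv => [<-//|[sv' Psv]]; apply: (glue s v x) => //; exact: le_trans tb.
- by rewrite (ltW st) lexx.
Qed.

End one_sided.

Section psum.
Context {R : realType}.
Implicit Types (phi : R -> R -> R) (xs ys : seq R) (s t x y c : R).

Lemma psum_nil phi s : psum phi s [::] = 0.
Proof. by rewrite /psum big_geq. Qed.

Lemma psum_cons phi s x xs : psum phi s (x :: xs) = phi s x + psum phi x xs.
Proof.
rewrite /psum /ppt /= big_nat_recl //=; congr (_ + _).
apply: eq_big_nat => i /andP[_ ix].
by rewrite (set_nth_default x) ?(set_nth_default x s) //= ltnS ltnW.
Qed.

Lemma psum_cat phi s xs ys :
  psum phi s (xs ++ ys) = psum phi s xs + psum phi (last s xs) ys.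
Proof.
elim: xs s => [|x xs IH] s /=; first by rewrite psum_nil add0r.
by rewrite !psum_cons IH addrA.
Qed.

Lemma psum_rcons phi s xs t :
  psum phi s (rcons xs t) = psum phi s xs + phi (last s xs) t.
Proof. by rewrite -cats1 psum_cat psum_cons psum_nil addr0. Qed.

Lemma psum_tele (h : R -> R) s xs :
  psum (fun x y => h y - h x) s xs = h (last s xs) - h s.
Proof.
elim: xs s => [|x xs IH] s /=; first by rewrite psum_nil subrr.
by rewrite psum_cons IH; ring.
Qed.

Lemma psumD phi1 phi2 s xs :
  psum (fun x y => phi1 x y + phi2 x y) s xs = psum phi1 s xs + psum phi2 s xs.
Proof. by rewrite /psum big_split. Qed.

Lemma psumZ c phi s xs : psum (fun x y => c * phi x y) s xs = c * psum phi s xs.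
Proof. by rewrite /psum mulr_sumr. Qed.

Lemma psumN phi s xs : psum (fun x y => - phi x y) s xs = - psum phi s xs.
Proof. by rewrite /psum sumrN. Qed.

Lemma psumB phi1 phi2 s xs :
  psum (fun x y => phi1 x y - phi2 x y) s xs = psum phi1 s xs - psum phi2 s xs.
Proof. by rewrite psumD psumN. Qed.

Lemma path_le_last s xs : path <%R s xs -> s <= last s xs.
Proof.
elim: xs s => [|x xs IH] s //= /andP[sx /IH]; exact: le_trans (ltW sx).
Qed.

Lemma ler_psum phi1 phi2 s xs : path <%R s xs ->
  (forall x y, s <= x -> x < y -> y <= last s xs -> phi1 x y <= phi2 x y) ->
  psum phi1 s xs <= psum phi2 s xs.
Proof.
elim: xs s => [|x xs IH] s; first by rewrite !psum_nil.
move=> /= /andP[sx xxs] H; rewrite !psum_cons lerD ?H ?path_le_last //.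
by apply: IH => // u v xu; apply: H; rewrite (le_trans (ltW sx)).
Qed.

Lemma eq_psum phi1 phi2 s xs : path <%R s xs ->
  (forall x y, s <= x -> x < y -> y <= last s xs -> phi1 x y = phi2 x y) ->
  psum phi1 s xs = psum phi2 s xs.
Proof.
move=> sxs H; apply/eqP; rewrite eq_le.
by rewrite !ler_psum // => x y ? ? ?; rewrite H.
Qed.

Lemma psum_ge0 phi s xs : path <%R s xs ->
  (forall x y, s <= x -> x < y -> y <= last s xs -> 0 <= phi x y) ->
  0 <= psum phi s xs.
Proof.
move=> sxs H; have -> : 0 = psum (fun _ _ => 0) s xs by rewrite /psum big1.
exact: ler_psum.
Qed.

Lemma ler_norm_psum phi s xs :
  `|psum phi s xs| <= psum (fun x y => `|phi x y|) s xs.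
Proof. exact: ler_norm_sum. Qed.

Lemma path_filter_lt s xs (p : pred R) : path <%R s xs ->
  path <%R s [seq x <- xs | p x].
Proof. by apply: path_filter; exact: lt_trans. Qed.

Lemma last_in s xs : last s xs = s \/ last s xs \in xs.
Proof.
case: xs => [|x xs]; first by left.
by right; rewrite /= mem_last.
Qed.

Lemma last_ge s xs x : path <%R s xs -> x \in xs -> x <= last s xs.
Proof.
elim: xs s => [|y xs IH] s //= /andP[sy yxs]; rewrite inE => /orP[/eqP->|xxs].
  exact: path_le_last.
exact: IH yxs xxs.
Qed.

Lemma head_le s xs x d : path <%R s xs -> x \in xs -> head d xs <= x.
Proof.
case: xs => [|y xs] //= /andP[sy yxs]; rewrite inE => /orP[/eqP->//|xxs].
by move: yxs; rewrite lt_path_sortedE => /andP[/allP /(_ _ xxs) /ltW].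
Qed.

Lemma path_cut s xs t r : sorted <%R xs -> s < r -> r < t ->
  [seq x <- xs | s < x < t] =
  [seq x <- xs | s < x < r] ++
    (if r \in xs then r :: [seq x <- xs | r < x < t] else [seq x <- xs | r < x < t]).
Proof.
move=> sxs sr rt; elim: xs sxs => [|x xs IH] //= xxs.
have pxs' := xxs; move: xxs; rewrite lt_path_sortedE => /andP[/allP xall _].
rewrite inE (IH (path_sorted pxs')) eq_sym.
case: (ltgtP x r) => [xr|rx|xr] /=.
- have -> : (s < x < t) = (s < x) by rewrite (lt_trans xr rt) andbT.
  by rewrite andbT; case: ifP => _ //=.
- have rnx : (r \in xs) = false.
    by apply/negP => /xall; rewrite ltNge (ltW rx).
  have f0 : [seq x0 <- xs | s < x0 < r] = [::].
    apply/eqP; rewrite -(negbK (_ == _)) -has_filter; apply/hasPn => z /xall xz.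
    by rewrite negb_and -!leNgt (ltW (lt_trans rx xz)) orbT.
  rewrite rnx f0 andbF /= (lt_trans sr rx) /=.
  by case: ifP.
- subst x.
  have f0 : [seq x0 <- xs | s < x0 < r] = [::].
    apply/eqP; rewrite -(negbK (_ == _)) -has_filter; apply/hasPn => z /xall xz.
    by rewrite negb_and -!leNgt (ltW xz) orbT.
  have rnx : (r \in xs) = false by apply/negP => /xall; rewrite ltxx.
  by rewrite f0 rnx sr rt.
Qed.

End psum.

Section lam.
Context {R : realType} (a b : R) (lam : nat -> seq R).
Hypothesis lamP : Lambda a b lam.
Implicit Types (phi : R -> R -> R) (s r t x y : R).

Let path_lam m : path <%R a (lam m).
Proof. by case: lamP => /(_ m)[]. Qed.

Lemma lam_mono x m n : (m <= n)%N -> x \in lam m -> x \in lam n.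
Proof.
case: lamP => _ H _; elim: n => [|n IH]; first by rewrite leqn0 => /eqP->.
by rewrite leq_eqVlt => /orP[/eqP<-//|/IH{}IH /IH /H].
Qed.

Lemma cup_near x : a < x -> cup a lam x -> \forall m \near \oo, x \in lam m.
Proof.
move=> ax [m]; rewrite inE => /orP[/eqP xa|xm]; first by rewrite xa ltxx in ax.
by apply/near_ooP; exists m => n mn; exact: lam_mono mn xm.
Qed.

Lemma cup_dense u v : a <= u -> u < v -> v <= b ->
  exists2 x, u < x < v & \forall m \near \oo, x \in lam m.
Proof.
move=> au uv vb; case: lamP => _ _ /(_ ((u + v) / 2)) H.
have /H : `[a, b]%classic ((u + v) / 2) by rewrite /= in_itv /=; apply/andP; split; lra.
move=> /(_ (ball ((u + v) / 2) ((v - u) / 2))) []; first by apply: nbhsx_ballx; lra.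
move=> x [cx]; rewrite /ball /= ltr_norml => /andP[h1 h2].
exists x; first by apply/andP; split; lra.
by apply: cup_near => //; lra.
Qed.

(** The partition points next to [r].  The defaults make them points of the restricted
    partitions even when no point of [lam m] lies in between. *)
Definition before s r m := last s [seq x <- lam m | s < x < r].
Definition after r t m := head t [seq x <- lam m | r < x < t].

Lemma path_mid s t m : path <%R s [seq x <- lam m | s < x < t].
Proof.
rewrite lt_path_sortedE; apply/andP; split.
  by apply/allP => x; rewrite mem_filter => /andP[/andP[]].
by apply: (sorted_filter (@lt_trans _ R)); exact: path_sorted (path_lam m).
Qed.

Lemma restr_path s t m : s < t -> path <%R s (restr lam s t m).
Proof.
move=> st; rewrite /restr rcons_path path_mid /=.
have [->//|] := last_in s [seq x <- lam m | s < x < t].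
by rewrite mem_filter => /andP[/andP[]].
Qed.

Lemma restr_last s t m : last s (restr lam s t m) = t.
Proof. by rewrite /restr last_rcons. Qed.

Lemma restr_partition s t m : s < t -> itv_partition s t (restr lam s t m).
Proof. by move=> st; split; [exact: restr_path | rewrite restr_last]. Qed.

Lemma before_bounds s r m : s < r -> s <= before s r m < r.
Proof.
move=> sr; rewrite /before.
have [->|] := last_in s [seq x <- lam m | s < x < r]; first by rewrite lexx.
by rewrite mem_filter => /andP[/andP[/ltW -> ->]].
Qed.

Lemma after_bounds r t m : r < t -> r < after r t m <= t.
Proof.
move=> rt; rewrite /after; case E : [seq _ <- _ | _] => [|y l] /=.
  by rewrite rt lexx.
have : y \in [seq x <- lam m | r < x < t] by rewrite E mem_head.
by rewrite mem_filter => /andP[/andP[-> /ltW ->]].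
Qed.

(** By density the neighbours of [r] in the partitions tend to [r], so that one-sided
    limits can be taken along them. *)
Lemma before_cvg s r (P : R -> Prop) : a <= s -> s < r -> r <= b ->
  (\forall x \near r^'-, P x) -> \forall m \near \oo, P (before s r m).
Proof.
move=> as_ sr rb /near_leftP[u ur H].
have [|||x /andP[ux xr] /near_ooP[N HN]] := @cup_dense (Num.max s u) r.
- by rewrite le_max as_.
- by rewrite gt_max sr.
- by [].
have [sx ux'] : s < x /\ u < x by split; apply: le_lt_trans ux; rewrite le_max lexx ?orbT.
apply/near_ooP; exists N => m /HN xm; apply: H.
have /andP[_ ->] := before_bounds m sr; rewrite andbT; apply: (lt_le_trans ux').
by apply: last_ge; [exact: path_mid | rewrite mem_filter sx xr].
Qed.

Lemma after_cvg r t (P : R -> Prop) : a <= r -> r < t -> t <= b ->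
  (\forall x \near r^'+, P x) -> \forall m \near \oo, P (after r t m).
Proof.
move=> ar rt tb /near_rightP[u ru H].
have [|||x /andP[ux xr] /near_ooP[N HN]] := @cup_dense r (Num.min t u).
- by [].
- by rewrite lt_min rt.
- by rewrite ge_min tb.
have [sx ux'] : x < t /\ x < u by split; apply: (lt_le_trans xr); rewrite ge_min lexx ?orbT.
apply/near_ooP; exists N => m /HN xm; apply: H.
have /andP[-> _] := after_bounds m rt; apply: (le_lt_trans _ ux').
by apply: (@head_le _ r); [exact: path_mid | rewrite mem_filter sx ux].
Qed.

Lemma cvg_before s r (T : Type) (f : R -> T) (F : set_system T) :
  a <= s -> s < r -> r <= b -> f x @[x --> r^'-] `=>` F ->
  f (before s r m) @[m --> \oo] `=>` F.
Proof.
move=> as_ sr rb fF A /fF FA; exact: (@before_cvg s r (fun x => A (f x))).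
Qed.

Lemma psum_restr_before phi s r m :
  psum phi s (restr lam s r m) =
  psum phi s [seq x <- lam m | s < x < r] + phi (before s r m) r.
Proof. by rewrite /restr psum_rcons. Qed.

Lemma psum_restr_after phi r t m :
  psum phi r (restr lam r t m) =
  phi r (after r t m) + psum phi (after r t m) (behead (restr lam r t m)).
Proof.
rewrite /restr /after; case: [seq _ <- _ | _] => [|y l] /=.
  by rewrite psum_cons psum_nil.
by rewrite psum_cons.
Qed.

(** If [r] is not a partition point, cutting at [r] replaces one term by two; the limits
    of [phi] at [r] decide what becomes of the difference. *)
Lemma psum_split phi s r t m : s < r -> r < t ->
  psum phi s (restr lam s t m) =
  psum phi s (restr lam s r m) + psum phi r (restr lam r t m) +
  (if r \in lam m then 0 else
     phi (before s r m) (after r t m) - phi (before s r m) r - phi r (after r t m)).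
Proof.
move=> sr rt; rewrite {1}/restr (path_cut (path_sorted (path_lam m)) sr rt).
case: ifP => rl; rewrite rcons_cat psum_cat /=.
  rewrite psum_cons psum_restr_before /restr addr0 -!addrA.
  by congr (_ + (_ + _)).
rewrite psum_restr_before psum_restr_after /before /after /restr.
case: [seq x <- lam m | r < x < t] => [|y l] /=; rewrite psum_cons; ring.
Qed.

End lam.

(** * Regulated functions *)

Section regulated.
Context {R : realType}.
Implicit Types (a b r s t x y e : R) (f g k : R -> R).

Lemma reg_lft a b f r : regulated a b f -> a < r <= b ->
  f x @[x --> r^'-] --> lft f r.
Proof. by move=> [H _] /H. Qed.

Lemma reg_rgt a b f r : regulated a b f -> a <= r < b ->
  f x @[x --> r^'+] --> rgt f r.
Proof. by move=> [_ H] /H. Qed.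

Lemma lft_eq f r l : f x @[x --> r^'-] --> l -> lft f r = l.
Proof. exact: cvg_lim. Qed.

Lemma rgt_eq f r l : f x @[x --> r^'+] --> l -> rgt f r = l.
Proof. exact: cvg_lim. Qed.

Lemma left_cvgP f r l : f x @[x --> r^'-] --> l <->
  forall e, 0 < e -> exists2 u, u < r & forall x, u < x < r -> `|f x - l| <= e.
Proof.
split=> [/cvgrPdist_le H e /H /near_leftP[u ur Hu]|H].
  by exists u => // x /Hu; rewrite distrC.
apply/cvgrPdist_le => e /H[u ur Hu]; apply/near_leftP.
by exists u => // x /Hu; rewrite distrC.
Qed.

Lemma right_cvgP f r l : f x @[x --> r^'+] --> l <->
  forall e, 0 < e -> exists2 u, r < u & forall x, r < x < u -> `|f x - l| <= e.
Proof.
split=> [/cvgrPdist_le H e /H /near_rightP[u ur Hu]|H].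
  by exists u => // x /Hu; rewrite distrC.
apply/cvgrPdist_le => e /H[u ur Hu]; apply/near_rightP.
by exists u => // x /Hu; rewrite distrC.
Qed.

Lemma near_oo_cvgP (u : nat -> R) (l : R) : u m @[m --> \oo] --> l <->
  forall e, 0 < e -> \forall m \near \oo, `|u m - l| <= e.
Proof.
split=> [/cvgrPdist_le H e /H|H].
  by apply: filterS => m; rewrite distrC.
by apply/cvgrPdist_le => e /H; apply: filterS => m; rewrite distrC.
Qed.

Lemma left_cauchy f r :
  (forall e, 0 < e -> exists2 u, u < r &
     forall x y, u < x -> x <= y -> y < r -> `|f y - f x| <= e) ->
  cvg (f x @[x --> r^'-]).
Proof.
move=> H; apply: cauchy_cvg; apply: cauchy_exP => e e0.
have [|u ur Hu] := H (e / 2); first by rewrite divr_gt0.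
exists (f ((u + r) / 2)); apply/near_leftP; exists u => // x /andP[ux xr].
rewrite /ball /=; apply: (@le_lt_trans _ _ (e / 2)); last by lra.
have [le|le] := leP x ((u + r) / 2); first by apply: Hu => //; lra.
by rewrite distrC; apply: Hu => //; lra.
Qed.

Lemma right_cauchy f r :
  (forall e, 0 < e -> exists2 u, r < u &
     forall x y, r < x -> x <= y -> y < u -> `|f y - f x| <= e) ->
  cvg (f x @[x --> r^'+]).
Proof.
move=> H; apply: cauchy_cvg; apply: cauchy_exP => e e0.
have [|u ur Hu] := H (e / 2); first by rewrite divr_gt0.
exists (f ((u + r) / 2)); apply/near_rightP; exists u => // x /andP[ux xr].
rewrite /ball /=; apply: (@le_lt_trans _ _ (e / 2)); last by lra.
have [le|le] := leP x ((u + r) / 2); first by apply: Hu => //; lra.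
by rewrite distrC; apply: Hu => //; lra.
Qed.

Lemma regulated_sub a b s t f : a <= s -> t <= b -> regulated a b f ->
  regulated s t f.
Proof.
move=> as_ tb [H1 H2]; split=> r /andP[h1 h2].
  by apply: H1; rewrite (le_lt_trans as_ h1) (le_trans h2).
by apply: H2; rewrite (le_trans as_ h1) (lt_le_trans h2).
Qed.

Lemma regulatedD a b f g : regulated a b f -> regulated a b g ->
  regulated a b (fun x => f x + g x).
Proof.
by move=> [f1 f2] [g1 g2]; split=> r h; apply: is_cvgD; [exact: f1|exact: g1|exact: f2|exact: g2].
Qed.

Lemma regulatedM a b f g : regulated a b f -> regulated a b g ->
  regulated a b (fun x => f x * g x).
Proof.
by move=> [f1 f2] [g1 g2]; split=> r h; apply: is_cvgM; [exact: f1|exact: g1|exact: f2|exact: g2].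
Qed.

Lemma regulated_cst a b c : regulated a b (fun=> c).
Proof. by split=> r _; exact: is_cvg_cst. Qed.

Lemma eq_at_left a b f g r (F : set_system R) : a < r <= b ->
  (forall x, a <= x <= b -> f x = g x) ->
  f x @[x --> r^'-] `=>` F -> g x @[x --> r^'-] `=>` F.
Proof.
move=> /andP[ar rb] fg fF A /fF /near_leftP[u ur H]; apply/near_leftP.
exists (Num.max a u) => [|x /andP[]]; first by rewrite gt_max ar.
rewrite gt_max => /andP[ax ux] xr; rewrite /= -fg; first by apply: H; rewrite ux.
by rewrite (ltW ax) (le_trans (ltW xr)).
Qed.

Lemma eq_at_right a b f g r (F : set_system R) : a <= r < b ->
  (forall x, a <= x <= b -> f x = g x) ->
  f x @[x --> r^'+] `=>` F -> g x @[x --> r^'+] `=>` F.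
Proof.
move=> /andP[ar rb] fg fF A /fF /near_rightP[u ur H]; apply/near_rightP.
exists (Num.min b u) => [|x /andP[rx]]; first by rewrite lt_min rb.
rewrite lt_min => /andP[bx ux]; rewrite /= -fg; first by apply: H; rewrite rx.
by rewrite (ltW bx) (le_trans ar (ltW rx)).
Qed.

Lemma eq_regulated a b f g : (forall x, a <= x <= b -> f x = g x) ->
  regulated a b f -> regulated a b g.
Proof.
move=> fg rf; split=> r h; apply/cvg_ex.
  by exists (lft f r); exact: eq_at_left h fg (reg_lft rf h).
by exists (rgt f r); exact: eq_at_right h fg (reg_rgt rf h).
Qed.

Lemma eq_lft a b f g r : regulated a b f -> a < r <= b ->
  (forall x, a <= x <= b -> f x = g x) -> lft f r = lft g r.
Proof.
by move=> rf h fg; apply/esym/lft_eq; exact: eq_at_left h fg (reg_lft rf h).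
Qed.

Lemma eq_rgt a b f g r : regulated a b f -> a <= r < b ->
  (forall x, a <= x <= b -> f x = g x) -> rgt f r = rgt g r.
Proof.
by move=> rf h fg; apply/esym/rgt_eq; exact: eq_at_right h fg (reg_rgt rf h).
Qed.

Lemma eq_djump a b f g r : regulated a b f -> a < r <= b ->
  (forall x, a <= x <= b -> f x = g x) -> djump f r = djump g r.
Proof.
move=> rf h fg; rewrite /djump (eq_lft rf h fg) fg //.
by case/andP: h => /ltW -> ->.
Qed.

Lemma eq_ujump a b f g r : regulated a b f -> a <= r < b ->
  (forall x, a <= x <= b -> f x = g x) -> ujump f r = ujump g r.
Proof.
move=> rf h fg; rewrite /ujump (eq_rgt rf h fg) fg //.
by case/andP: h => -> /ltW ->.
Qed.

Lemma regulated_bounded a b f : a < b -> regulated a b f ->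
  exists2 M, 0 < M & forall x, a <= x <= b -> `|f x| <= M.
Proof.
move=> ab rf.
pose P s t := exists M, forall x, s <= x <= t -> `|f x| <= M.
have : P a b.
  apply: (@local_to_global R a b P) => //.
  - move=> s r t _ sr rt _ [M1 H1] [M2 H2]; exists (Num.max M1 M2) => x /andP[sx xt].
    rewrite le_max; have [xr|rx] := leP x r; first by rewrite H1 ?sx.
    by rewrite H2 ?orbT // (ltW rx).
  - move=> r h; have /left_cvgP /(_ 1 ltr01)[u ur Hu] := reg_lft rf h.
    exists u => // s /andP[us sr] _.
    exists (Num.max `|f r| (`|lft f r| + 1)) => x /andP[sx]; rewrite le_eqVlt.
    move=> /orP[/eqP->|xr]; first by rewrite le_max lexx.
    rewrite le_max; apply/orP; right.
    have := Hu x; rewrite (lt_le_trans us sx) xr => /(_ isT) h1.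
    by rewrite -lerBlDl (le_trans _ h1) // lerB_dist.
  - move=> r h; have /right_cvgP /(_ 1 ltr01)[u ur Hu] := reg_rgt rf h.
    exists u => // s /andP[us sr] _.
    exists (Num.max `|f r| (`|rgt f r| + 1)) => x /andP[]; rewrite le_eqVlt.
    move=> /orP[/eqP<- _|xr xs]; first by rewrite le_max lexx.
    rewrite le_max; apply/orP; right.
    have := Hu x; rewrite (le_lt_trans xs sr) xr => /(_ isT) h1.
    by rewrite -lerBlDl (le_trans _ h1) // lerB_dist.
move=> [M H]; exists (Num.max M 1); first by rewrite lt_max ltr01 orbT.
by move=> x /H h; rewrite le_max h.
Qed.

End regulated.

(** * Limits of sums along refining partitions *)

Section interval_functions.
Context {R : realType} (a b : R) (lam : nat -> seq R).
Hypothesis lamP : Lambda a b lam.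
Implicit Types (phi w : R -> R -> R) (s r t x y e : R) (k K W cm cp : R -> R).

Local Notation S phi s t m := (psum phi s (restr lam s t m)).

(** The three ways in which consecutive points close in on [r]: from the left, from the
    right, and from both sides at once, which goes on for ever only if [r] is never a
    partition point. *)
Definition jump_limit phi cm cp :=
  [/\ forall r, a < r <= b -> phi x r @[x --> r^'-] --> cm r,
      forall r, a <= r < b -> phi r y @[y --> r^'+] --> cp r &
      forall r, a < r < b -> ~ cup a lam r ->
        phi z.1 z.2 @[z --> filter_prod r^'- r^'+] --> cp r].

(** A term straddling [r] sees the sum of the two jumps of [k], while cutting at [r]
    separates them; products of increments agree only if the left jump is zero. *)
Definition jumps_in_cup k := forall r, a < r < b -> ~ cup a lam r -> djump k r = 0.

Lemma jump_limitD phi1 phi2 cm1 cm2 cp1 cp2 : jump_limit phi1 cm1 cp1 -> jump_limit phi2 cm2 cp2 ->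
  jump_limit (fun x y => phi1 x y + phi2 x y) (fun r => cm1 r + cm2 r) (fun r => cp1 r + cp2 r).
Proof.
move=> [p1 p2 p3] [q1 q2 q3]; split=> r h; first by apply: cvgD; [exact: p1|exact: q1].
  by apply: cvgD; [exact: p2|exact: q2].
by move=> rn; apply: cvgD; [exact: p3|exact: q3].
Qed.

Lemma jump_limitM phi1 phi2 cm1 cm2 cp1 cp2 : jump_limit phi1 cm1 cp1 -> jump_limit phi2 cm2 cp2 ->
  jump_limit (fun x y => phi1 x y * phi2 x y) (fun r => cm1 r * cm2 r) (fun r => cp1 r * cp2 r).
Proof.
move=> [p1 p2 p3] [q1 q2 q3]; split=> r h; first by apply: cvgM; [exact: p1|exact: q1].
  by apply: cvgM; [exact: p2|exact: q2].
by move=> rn; apply: cvgM; [exact: p3|exact: q3].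
Qed.

Lemma jump_limitN phi cm cp : jump_limit phi cm cp ->
  jump_limit (fun x y => - phi x y) (fun r => - cm r) (fun r => - cp r).
Proof.
move=> [p1 p2 p3]; split=> r h; first by apply: cvgN; exact: p1.
  by apply: cvgN; exact: p2.
by move=> rn; apply: cvgN; exact: p3.
Qed.

Lemma jump_limitB phi1 phi2 cm1 cm2 cp1 cp2 : jump_limit phi1 cm1 cp1 -> jump_limit phi2 cm2 cp2 ->
  jump_limit (fun x y => phi1 x y - phi2 x y) (fun r => cm1 r - cm2 r) (fun r => cp1 r - cp2 r).
Proof. by move=> h1 h2; apply: jump_limitD => //; exact: jump_limitN. Qed.

Lemma jump_limit_cst c : jump_limit (fun _ _ => c) (fun=> c) (fun=> c).
Proof. by split=> *; exact: cvg_cst. Qed.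

Lemma jump_limit_norm phi cm cp : jump_limit phi cm cp ->
  jump_limit (fun x y => `|phi x y|) (fun r => `|cm r|) (fun r => `|cp r|).
Proof.
move=> [p1 p2 p3]; split=> r h; first by apply: cvg_norm; exact: p1.
  by apply: cvg_norm; exact: p2.
by move=> rn; apply: cvg_norm; exact: p3.
Qed.

Lemma jump_limit_r k : regulated a b k -> jump_limit (fun _ y => k y) k (rgt k).
Proof.
move=> rk; split=> r h; [exact: cvg_cst|exact: reg_rgt h|].
move=> rn; apply: (@cvg_comp _ _ _ snd k _ r^'+); first exact: cvg_snd.
by apply: (reg_rgt rk); case/andP: h => /ltW -> ->.
Qed.

Lemma jump_limit_l k : regulated a b k -> jumps_in_cup k -> jump_limit (fun x _ => k x) (lft k) k.
Proof.
move=> rk nk; split=> r h; [exact: reg_lft h|exact: cvg_cst|].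
move=> rn; apply: (@cvg_comp _ _ _ fst k _ r^'-); first exact: cvg_fst.
have -> : k r = lft k r by apply/eqP; rewrite -subr_eq0; apply/eqP; exact: nk.
by apply: (reg_lft rk); case/andP: h => -> /ltW ->.
Qed.

Lemma jump_limit_inc k : regulated a b k -> jumps_in_cup k ->
  jump_limit (fun x y => k y - k x) (djump k) (ujump k).
Proof. by move=> rk nk; apply: jump_limitB; [exact: jump_limit_r|exact: jump_limit_l]. Qed.

Lemma eq_jump_limit phi cm cp cm' cp' : jump_limit phi cm cp ->
  (forall r, a < r <= b -> cm r = cm' r) -> (forall r, a <= r < b -> cp r = cp' r) ->
  jump_limit phi cm' cp'.
Proof.
move=> [h1 h2 h3] e1 e2; split=> r h; first by rewrite -e1 //; exact: h1.
  by rewrite -e2 //; exact: h2.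
by move=> rn; rewrite -e2; [exact: h3|case/andP: h => /ltW -> ->].
Qed.

(** With these limits the correction in [psum_split] tends to zero. *)
Definition vanishing phi := jump_limit phi (fun=> 0) (fun=> 0).

Lemma vanishing_before phi s r e : vanishing phi -> a <= s -> s < r -> r <= b -> 0 < e ->
  \forall m \near \oo, `|phi (before lam s r m) r| <= e.
Proof.
move=> [v1 _ _] as_ sr rb e0.
apply: (@before_cvg _ a b lam lamP s r (fun x => `|phi x r| <= e)) => //.
have h : a < r <= b by rewrite (le_lt_trans as_ sr).
have /cvgrPdist_le /(_ _ e0) := v1 r h.
by apply: filterS => x; rewrite sub0r normrN.
Qed.

Lemma vanishing_after phi r t e : vanishing phi -> a <= r -> r < t -> t <= b -> 0 < e ->
  \forall m \near \oo, `|phi r (after lam r t m)| <= e.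
Proof.
move=> [_ v1 _] as_ sr rb e0.
apply: (@after_cvg _ a b lam lamP r t (fun x => `|phi r x| <= e)) => //.
have h : a <= r < b by rewrite as_ (lt_le_trans sr rb).
have /cvgrPdist_le /(_ _ e0) := v1 r h.
by apply: filterS => x; rewrite sub0r normrN.
Qed.

Lemma vanishing_straddle phi s r t e : vanishing phi -> a <= s -> s < r -> r < t -> t <= b ->
  ~ cup a lam r -> 0 < e ->
  \forall m \near \oo, `|phi (before lam s r m) (after lam r t m)| <= e.
Proof.
move=> [_ _ v1] as_ sr rt tb rn e0.
have h : a < r < b by rewrite (le_lt_trans as_ sr) (lt_le_trans rt tb).
have /cvgrPdist_le /(_ _ e0) := v1 r h rn.
move=> [[A B] /= [/near_leftP LA /near_rightP RB] H].
have n1 : \forall m \near \oo, A (before lam s r m).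
  by apply: (before_cvg lamP) => //; [rewrite (le_trans (ltW rt))|apply/near_leftP].
have n2 : \forall m \near \oo, B (after lam r t m).
  by apply: (after_cvg lamP) => //; [rewrite (le_trans as_) // ltW|apply/near_rightP].
near=> m; have := H (before lam s r m, after lam r t m); rewrite /= sub0r normrN.
by apply; split; near: m.
Unshelve. all: by end_near. Qed.

(** Cutting a vanishing [phi] at a point costs nothing in the limit, so that asymptotic
    bounds by increments of [W] can be glued. *)
Lemma lam_local_to_global phi W : vanishing phi ->
  (forall r, a < r <= b -> exists2 u, u < r & forall s, u < s < r -> a <= s ->
     forall e, 0 < e -> \forall m \near \oo, `|S phi s r m| <= W r - W s + e) ->
  (forall r, a <= r < b -> exists2 u, r < u & forall t, r < t < u -> t <= b ->
     forall e, 0 < e -> \forall m \near \oo, `|S phi r t m| <= W t - W r + e) ->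
  forall s t, a <= s -> s < t -> t <= b ->
     forall e, 0 < e -> \forall m \near \oo, `|S phi s t m| <= W t - W s + e.
Proof.
move=> vphi; apply: local_to_global => s r t as_ sr rt tb Psr Prt e e0.
have e5 : 0 < e / 5 by lra.
have n0 : \forall m \near \oo, `|if r \in lam m then 0 else
     phi (before lam s r m) (after lam r t m) - phi (before lam s r m) r
     - phi r (after lam r t m)| <= 3 * (e / 5).
  have [rc|rn] := pselect (cup a lam r).
    have := cup_near lamP (le_lt_trans as_ sr) rc; apply: filterS => m ->.
    by rewrite normr0; lra.
  have n1 := vanishing_before vphi as_ sr (ltW (lt_le_trans rt tb)) e5.
  have n2 := vanishing_after vphi (ltW (le_lt_trans as_ sr)) rt tb e5.
  have n3 := vanishing_straddle vphi as_ sr rt tb rn e5.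
  near=> m; case: ifPn => _; first by rewrite normr0; lra.
  have h1 : `|phi (before lam s r m) r| <= e / 5 by near: m.
  have h2 : `|phi r (after lam r t m)| <= e / 5 by near: m.
  have h3 : `|phi (before lam s r m) (after lam r t m)| <= e / 5 by near: m.
  apply: (le_trans (ler_normB _ _)); have := ler_normB (phi (before lam s r m) (after lam r t m)) (phi (before lam s r m) r).
  lra.
have n1 := Psr _ e5; have n2 := Prt _ e5.
near=> m; rewrite (psum_split lamP phi m sr rt).
have h0 : `|if r \in lam m then 0 else
     phi (before lam s r m) (after lam r t m) - phi (before lam s r m) r
     - phi r (after lam r t m)| <= 3 * (e / 5) by near: m.
have h1 : `|S phi s r m| <= W r - W s + e / 5 by near: m.
have h2 : `|S phi r t m| <= W t - W r + e / 5 by near: m.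
apply: (le_trans (ler_normD _ _)).
have := ler_normD (S phi s r m) (S phi r t m); lra.
Unshelve. all: by end_near. Qed.

Definition eventually_le phi W := forall s t, a <= s -> s < t -> t <= b ->
  forall e, 0 < e -> \forall m \near \oo, S phi s t m <= W t - W s + e.

(** Intervals that touch [r] are left out: there [phi] is only known to have limits. *)
Definition loc_small phi w := forall e, 0 < e ->
  (forall r, a < r <= b -> exists2 u, u < r & forall x y,
     u < x -> a <= x -> x < y -> y < r -> `|phi x y| <= e * w x y) /\
  (forall r, a <= r < b -> exists2 u, r < u & forall x y,
     r < x -> x < y -> y < u -> y <= b -> `|phi x y| <= e * w x y).

Lemma mid_le phi s r m : s < r -> 0 <= phi (before lam s r m) r ->
  psum phi s [seq x <- lam m | s < x < r] <= S phi s r m.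
Proof. by move=> sr h; rewrite psum_restr_before lerDl. Qed.

Lemma after_le phi r t m : r < t -> 0 <= phi r (after lam r t m) ->
  psum phi (after lam r t m) (behead (restr lam r t m)) <= S phi r t m.
Proof. by move=> sr h; rewrite psum_restr_after lerDr. Qed.

Lemma last_behead r t m : last (after lam r t m) (behead (restr lam r t m)) = t.
Proof.
rewrite /after /restr; case: [seq _ <- _ | _] => //= y l.
by rewrite last_rcons.
Qed.

Lemma path_behead r t m : r < t ->
  path <%R (after lam r t m) (behead (restr lam r t m)).
Proof.
move=> rt; have := restr_path lamP m rt; rewrite /after /restr.
by case: [seq _ <- _ | _] => //= y l /andP[].
Qed.

(** Near each point the terms that touch it vanish, and the others are at most a small
    multiple of those of [w], whose sums are bounded by the increments of [W]. *)
Lemma small_sum phi w W : vanishing phi -> eventually_le w W ->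
  (forall x y, a <= x -> x < y -> y <= b -> 0 <= w x y) -> loc_small phi w ->
  forall s t, a <= s -> s < t -> t <= b ->
    S (fun x y => `|phi x y|) s t m @[m --> \oo] --> 0.
Proof.
move=> vphi wW w0 small s t as_ st tb; apply/near_oo_cvgP => e e0.
have vn : vanishing (fun x y => `|phi x y|).
  by apply: (eq_jump_limit (jump_limit_norm vphi)) => r _; rewrite normr0.
have [d d0 Hd] : exists2 d, 0 < d & d * (W t - W s) <= e / 2.
  exists (e / 2 / (`|W t - W s| + 1)); first by rewrite !divr_gt0 // ltr_wpDl.
  rewrite mulrAC ler_pdivrMr ?ltr_wpDl //.
  by apply: ler_wpM2l; [lra | rewrite (le_trans (ler_norm _)) // lerDl].
have [smL smR] := small _ d0.
suff : forall e', 0 < e' -> \forall m \near \oo,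
    `|S (fun x y => `|phi x y|) s t m| <= d * W t - d * W s + e'.
  move=> /(_ (e / 2)) h; have := h ltac:(lra); apply: filterS => m.
  by rewrite subr0 -mulrBr => /le_trans; apply; lra.
apply: (@lam_local_to_global (fun x y => `|phi x y|) (fun x => d * W x)) => //.
- move=> r h; have [u ur Hu] := smL r h; exists u => // s1 /andP[us1 s1r] as1 e1 e10.
  have rb : r <= b by case/andP: h.
  have e12 : 0 < e1 / 2 by lra.
  have e1d : 0 < e1 / 2 / d by rewrite divr_gt0.
  have n1 := vanishing_before vphi as1 s1r rb e12; have n2 := wW _ _ as1 s1r rb _ e1d.
  near=> m; have [bs1 bs2] := andP (before_bounds lam m s1r).
  rewrite ger0_norm; last by apply: psum_ge0 => //; exact: (restr_path lamP).
  rewrite psum_restr_before; apply: (@le_trans _ _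
    (psum (fun x y => d * w x y) s1 [seq x <- lam m | s1 < x < r] + e1 / 2)).
    apply: lerD; last by near: m.
    apply: ler_psum => [|x y sx xy yl]; first exact: (path_mid lamP).
    apply: Hu => //; first exact: lt_le_trans us1 sx.
      exact: le_trans sx.
    by apply: le_lt_trans yl _; exact: bs2.
  have : S w s1 r m <= W r - W s1 + e1 / 2 / d by near: m.
  have h0 : 0 <= w (before lam s1 r m) r by apply: w0 => //; exact: le_trans bs1.
  move=> /(le_trans (mid_le s1r h0)) /(ler_wpM2l (ltW d0)).
  rewrite -psumZ mulrDr mulrCA mulfV ?lt0r_neq0 //; lra.
- move=> r h; have [u ur Hu] := smR r h; exists u => // t1 /andP[rt1 t1u] t1b e1 e10.
  have ar : a <= r by case/andP: h.
  have e12 : 0 < e1 / 2 by lra.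
  have e1d : 0 < e1 / 2 / d by rewrite divr_gt0.
  have n1 := vanishing_after vphi ar rt1 t1b e12; have n2 := wW _ _ ar rt1 t1b _ e1d.
  near=> m; have [bs1 bs2] := andP (after_bounds lam m rt1).
  rewrite ger0_norm; last by apply: psum_ge0 => //; exact: (restr_path lamP).
  rewrite psum_restr_after; apply: (@le_trans _ _
    (e1 / 2 + psum (fun x y => d * w x y) (after lam r t1 m) (behead (restr lam r t1 m)))).
    apply: lerD; first by near: m.
    apply: ler_psum => [|x y sx xy]; first exact: path_behead.
    rewrite last_behead => yt; apply: Hu => //; first exact: lt_le_trans bs1 sx.
      exact: le_lt_trans yt t1u.
    exact: le_trans yt t1b.
  have : S w r t1 m <= W t1 - W r + e1 / 2 / d by near: m.
  have h0 : 0 <= w r (after lam r t1 m) by apply: w0 => //; exact: le_trans t1b.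
  move=> /(le_trans (after_le rt1 h0)) /(ler_wpM2l (ltW d0)).
  rewrite -psumZ mulrDr mulrCA mulfV ?lt0r_neq0 //; lra.
Unshelve. all: by end_near. Qed.

(** The convergence of the signed sums carries over to regulated weights
    ([negligible_weight]) because the sums of absolute values stay bounded. *)
Definition negligible phi := [/\ vanishing phi, exists W, eventually_le (fun x y => `|phi x y|) W &
  forall s t, a <= s -> s < t -> t <= b -> S phi s t m @[m --> \oo] --> 0].

Lemma eventually_leZ phi W c : 0 <= c -> eventually_le phi W ->
  eventually_le (fun x y => c * phi x y) (fun x => c * W x).
Proof.
move=> c0 H s t as_ st tb e e0.
have e1 : 0 < e / (c + 1) by rewrite divr_gt0 // ltr_wpDl.
have := H s t as_ st tb _ e1; apply: filterS => m h; rewrite psumZ -mulrBr.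
apply: (le_trans (ler_wpM2l c0 h)); rewrite mulrDr lerD2l.
by rewrite mulrCA ler_piMr ?(ltW e0) // ler_pdivrMr ?ltr_wpDl // mul1r lerDl.
Qed.

Lemma eventually_leD phi1 phi2 W1 W2 : eventually_le phi1 W1 -> eventually_le phi2 W2 ->
  eventually_le (fun x y => phi1 x y + phi2 x y) (fun x => W1 x + W2 x).
Proof.
move=> H1 H2 s t as_ st tb e e0.
have e2 : 0 < e / 2 by lra.
have n1 := H1 s t as_ st tb _ e2; have n2 := H2 s t as_ st tb _ e2.
near=> m; rewrite psumD.
have : S phi1 s t m <= W1 t - W1 s + e / 2 by near: m.
have : S phi2 s t m <= W2 t - W2 s + e / 2 by near: m.
lra.
Unshelve. all: by end_near. Qed.

Lemma eventually_le_le phi1 phi2 W : eventually_le phi2 W ->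
  (forall x y, a <= x -> x < y -> y <= b -> phi1 x y <= phi2 x y) -> eventually_le phi1 W.
Proof.
move=> H le s t as_ st tb e e0; have := H s t as_ st tb _ e0.
apply: filterS => m; apply: le_trans; apply: ler_psum; first exact: (restr_path lamP).
rewrite restr_last => x y sx xy yt; apply: le => //; first exact: le_trans sx.
exact: le_trans tb.
Qed.

Lemma eventually_le_cvg phi W : (forall s t, a <= s -> s < t -> t <= b ->
    S phi s t m @[m --> \oo] --> W t - W s) -> eventually_le phi W.
Proof.
move=> H s t as_ st tb e e0.
have /near_oo_cvgP /(_ _ e0) := H s t as_ st tb; apply: filterS => m.
by rewrite ler_distl => /andP[].
Qed.

Lemma eventually_le_tele (h : R -> R) : eventually_le (fun x y => h y - h x) h.
Proof.
move=> s t as_ st tb e e0; near=> m.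
by rewrite psum_tele restr_last lerDl ltW.
Unshelve. all: by end_near. Qed.

Lemma negligible_small phi : vanishing phi -> (forall s t, a <= s -> s < t -> t <= b ->
    S (fun x y => `|phi x y|) s t m @[m --> \oo] --> 0) -> negligible phi.
Proof.
move=> v H; split=> //.
  by exists (fun=> 0); apply: eventually_le_cvg => s t *; rewrite subrr; exact: H.
move=> s t as_ st tb; apply/near_oo_cvgP => e e0.
have /near_oo_cvgP /(_ _ e0) := H s t as_ st tb; apply: filterS => m.
rewrite !subr0 ger0_norm; last by apply: psum_ge0 => //; exact: (restr_path lamP).
by apply: le_trans; exact: ler_norm_psum.
Qed.

Lemma negligibleD phi1 phi2 : negligible phi1 -> negligible phi2 -> negligible (fun x y => phi1 x y + phi2 x y).
Proof.
move=> [v1 [W1 h1] c1] [v2 [W2 h2] c2]; split.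
- by apply: (eq_jump_limit (jump_limitD v1 v2)) => r _; rewrite addr0.
- exists (fun x => W1 x + W2 x); apply: eventually_le_le (eventually_leD h1 h2) _ => x y _ _ _.
  exact: ler_normD.
- move=> s t as_ st tb; rewrite -[0]addr0.
  have -> : (fun m => S (fun x y => phi1 x y + phi2 x y) s t m) =
            (fun m => S phi1 s t m + S phi2 s t m) by apply/funext => m; exact: psumD.
  by apply: cvgD; [exact: c1|exact: c2].
Qed.

(** Weak convergence: a regulated weight is nearly constant on small one-sided
    neighbourhoods, the signed sums vanish on them, and the error of replacing the
    weight by a constant is paid for by the bounded sums of absolute values. *)
Lemma negligible_weight phi K : negligible phi -> regulated a b K -> a < b ->
  negligible (fun x y => K y * phi x y).
Proof.
move=> [v [W hW] c] rK ab.
have [M M0 HM] := regulated_bounded ab rK.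
have vK : vanishing (fun x y => K y * phi x y).
  by apply: (eq_jump_limit (jump_limitM (jump_limit_r rK) v)) => r _; rewrite mulr0.
split=> //.
  exists (fun x => M * W x); apply: eventually_le_le (eventually_leZ (ltW M0) hW) _ => x y ax xy yb.
  by rewrite normrM ler_wpM2r // HM // yb (le_trans ax (ltW xy)).
move=> s t as_ st tb; apply/near_oo_cvgP => e e0.
have [d d0 Hd] : exists2 d, 0 < d & d * (W t - W s) <= e / 2.
  exists (e / 2 / (`|W t - W s| + 1)); first by rewrite !divr_gt0 // ltr_wpDl.
  rewrite mulrAC ler_pdivrMr ?ltr_wpDl //.
  by apply: ler_wpM2l; [lra | rewrite (le_trans (ler_norm _)) // lerDl].
suff : forall e', 0 < e' -> \forall m \near \oo,
    `|S (fun x y => K y * phi x y) s t m| <= d * W t - d * W s + e'.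
  move=> /(_ (e / 2)) h; have := h ltac:(lra); apply: filterS => m.
  by rewrite subr0 -mulrBr => /le_trans; apply; lra.
apply: (@lam_local_to_global (fun x y => K y * phi x y) (fun x => d * W x)) => //.
- move=> r h; have [u ur Hu] := (left_cvgP _ _ _).1 (reg_lft rK h) _ d0.
  exists u => // s1 /andP[us1 s1r] as1 e1 e10.
  have rb : r <= b by case/andP: h.
  set k := lft K r in Hu *.
  have e14 : 0 < e1 / 4 by lra.
  have e1d : 0 < e1 / 4 / d by rewrite divr_gt0.
  have e1k : 0 < e1 / 4 / (`|k| + 1) by rewrite divr_gt0 // ltr_wpDl.
  have n1 := vanishing_before vK as1 s1r rb e14.
  have n1' := vanishing_before v as1 s1r rb e1k.
  have n2 := hW _ _ as1 s1r rb _ e1d.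
  have n3 := (near_oo_cvgP _ _).1 (c _ _ as1 s1r rb) _ e1k.
  near=> m; have [bs1 bs2] := andP (before_bounds lam m s1r).
  have h1 : `|K r * phi (before lam s1 r m) r| <= e1 / 4 by near: m.
  have h1' : `|phi (before lam s1 r m) r| <= e1 / 4 / (`|k| + 1) by near: m.
  have h2 : S (fun x y => `|phi x y|) s1 r m <= W r - W s1 + e1 / 4 / d by near: m.
  have h3 : `|S phi s1 r m - 0| <= e1 / 4 / (`|k| + 1) by near: m.
  set mid := [seq x <- lam m | s1 < x < r].
  have E : S (fun x y => K y * phi x y) s1 r m =
     psum (fun x y => (K y - k) * phi x y) s1 mid
     + k * S phi s1 r m - k * phi (before lam s1 r m) r
     + K r * phi (before lam s1 r m) r.
    rewrite !psum_restr_before -/mid mulrDr addrA addrK -psumZ -psumD; congr (_ + _).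
    by congr psum; apply/funext => x; apply/funext => y; ring.
  have h4 : `|psum (fun x y => (K y - k) * phi x y) s1 mid| <= d * (W r - W s1 + e1 / 4 / d).
    apply: (le_trans (ler_norm_psum _ _ _)).
    apply: le_trans (ler_wpM2l (ltW d0) h2).
    apply: le_trans (ler_wpM2l (ltW d0) (mid_le s1r _)); last by [].
    rewrite -psumZ; apply: ler_psum => [|x y sx xy yl]; first exact: (path_mid lamP).
    rewrite normrM ler_wpM2r // Hu //; apply/andP; split.
      exact: lt_trans (lt_le_trans us1 sx) xy.
    by apply: le_lt_trans yl _; exact: bs2.
  have hk z : `|z| <= e1 / 4 / (`|k| + 1) -> `|k * z| <= e1 / 4.
    move=> hz; rewrite normrM.
    apply: (@le_trans _ _ ((`|k| + 1) * (e1 / 4 / (`|k| + 1)))).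
      by apply: ler_pM => //; rewrite lerDl.
    by rewrite mulrCA mulfV ?mulr1 // gt_eqF // ltr_wpDl.
  rewrite subr0 in h3; have := hk _ h3; have := hk _ h1'.
  move: h4; rewrite mulrDr [d * (_ / d)]mulrCA mulfV ?gt_eqF // => h4.
  move: h1 h4; rewrite E !ler_norml => /andP[? ?] /andP[? ?] /andP[? ?] /andP[? ?].
  by apply/andP; split; lra.
- move=> r h; have [u ur Hu] := (right_cvgP _ _ _).1 (reg_rgt rK h) _ d0.
  exists u => // t1 /andP[rt1 t1u] t1b e1 e10.
  have ar : a <= r by case/andP: h.
  set k := rgt K r in Hu *.
  have e14 : 0 < e1 / 4 by lra.
  have e1d : 0 < e1 / 4 / d by rewrite divr_gt0.
  have e1k : 0 < e1 / 4 / (`|k| + 1) by rewrite divr_gt0 // ltr_wpDl.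
  have n2 := hW _ _ ar rt1 t1b _ e1d.
  have n3 := (near_oo_cvgP _ _).1 (c _ _ ar rt1 t1b) _ e1k.
  near=> m.
  have h2 : S (fun x y => `|phi x y|) r t1 m <= W t1 - W r + e1 / 4 / d by near: m.
  have h3 : `|S phi r t1 m - 0| <= e1 / 4 / (`|k| + 1) by near: m.
  have E : S (fun x y => K y * phi x y) r t1 m =
     S (fun x y => (K y - k) * phi x y) r t1 m + k * S phi r t1 m.
    rewrite -psumZ -psumD.
    by congr psum; apply/funext => x; apply/funext => y; ring.
  have h4 : `|S (fun x y => (K y - k) * phi x y) r t1 m| <= d * (W t1 - W r + e1 / 4 / d).
    apply: (le_trans (ler_norm_psum _ _ _)).
    apply: le_trans (ler_wpM2l (ltW d0) h2).
    rewrite -psumZ; apply: ler_psum; first exact: (restr_path lamP).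
    rewrite restr_last => x y sx xy yl.
    rewrite normrM ler_wpM2r // Hu //; apply/andP; split.
      exact: le_lt_trans sx xy.
    exact: le_lt_trans yl t1u.
  have hk z : `|z| <= e1 / 4 / (`|k| + 1) -> `|k * z| <= e1 / 4.
    move=> hz; rewrite normrM.
    apply: (@le_trans _ _ ((`|k| + 1) * (e1 / 4 / (`|k| + 1)))).
      by apply: ler_pM => //; rewrite lerDl.
    by rewrite mulrCA mulfV ?mulr1 // gt_eqF // ltr_wpDl.
  rewrite subr0 in h3; have := hk _ h3.
  move: h4; rewrite mulrDr [d * (_ / d)]mulrCA mulfV ?gt_eqF // => h4.
  move: h4; rewrite E !ler_norml => /andP[? ?] /andP[? ?].
  by apply/andP; split; lra.
Unshelve. all: by end_near. Qed.

(** Cauchy-Schwarz in the form u v <= d u^2 / 2 + v^2 / (2 d), where [d] is chosen after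
    the bound on the sums of u^2. *)
Lemma cross_sum phi1 phi2 W s t : eventually_le (fun x y => phi1 x y ^+ 2) W ->
  a <= s -> s < t -> t <= b ->
  S (fun x y => phi2 x y ^+ 2) s t m @[m --> \oo] --> 0 ->
  S (fun x y => phi1 x y * phi2 x y) s t m @[m --> \oo] --> 0.
Proof.
move=> hW as_ st tb c2; apply/near_oo_cvgP => e e0.
pose A := `|W t - W s| + 1.
have A0 : 0 < A by rewrite ltr_wpDl.
(* with this d both terms of the inequality are at most e / 2 *)
pose d := e / A.
have d0 : 0 < d by rewrite divr_gt0.
have n1 := hW _ _ as_ st tb _ ltr01.
have n2 := (near_oo_cvgP _ _).1 c2 _ (mulr_gt0 d0 e0).
near=> m; rewrite subr0; apply: (le_trans (ler_norm_psum _ _ _)).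
have h1 : S (fun x y => phi1 x y ^+ 2) s t m <= A.
  apply: (@le_trans _ _ (W t - W s + 1)); first by near: m.
  by rewrite lerD2r ler_norm.
have h2 : S (fun x y => phi2 x y ^+ 2) s t m <= d * e.
  have : `|S (fun x y => phi2 x y ^+ 2) s t m - 0| <= d * e by near: m.
  by rewrite subr0; apply: le_trans; exact: ler_norm.
apply: (@le_trans _ _ (S (fun x y => d / 2 * phi1 x y ^+ 2 + d^-1 / 2 * phi2 x y ^+ 2) s t m)).
  apply: ler_psum => [|x y _ _ _]; first exact: (restr_path lamP).
  have di0 : 0 <= d^-1 by rewrite invr_ge0 ltW.
  have := mulr_ge0 di0 (sqr_ge0 (d * `|phi1 x y| - `|phi2 x y|)).
  move=> hsq; rewrite normrM -subr_ge0; move: hsq; rewrite -(real_normK (num_real (phi1 x y))) -(real_normK (num_real (phi2 x y))).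
  have -> : d^-1 * (d * `|phi1 x y| - `|phi2 x y|) ^+ 2 =
    2 * (d / 2 * `|phi1 x y| ^+ 2 + d^-1 / 2 * `|phi2 x y| ^+ 2 - `|phi1 x y| * `|phi2 x y|).
    by field; rewrite gt_eqF.
  by rewrite pmulr_rge0.
rewrite psumD !psumZ.
have h3 : d / 2 * S (fun x y => phi1 x y ^+ 2) s t m <= e / 2.
  apply: (@le_trans _ _ (d / 2 * A)); first by apply: ler_wpM2l => //; rewrite ltW // divr_gt0.
  by rewrite /d; have -> : e / A / 2 * A = e / 2 by field; rewrite gt_eqF.
have h4 : d^-1 / 2 * S (fun x y => phi2 x y ^+ 2) s t m <= e / 2.
  apply: (@le_trans _ _ (d^-1 / 2 * (d * e))).
    by apply: ler_wpM2l => //; rewrite ltW // divr_gt0 // invr_gt0.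
  by have -> : d^-1 / 2 * (d * e) = e / 2 by field; rewrite gt_eqF.
lra.
Unshelve. all: by end_near. Qed.

End interval_functions.

(** * The Love-Young estimate *)

Section power_estimates.
Context {R : realType}.
Implicit Types (p q c d e w x y t : R).

Lemma powR_le_root p d w : 0 < p -> 0 <= d -> 0 <= w -> d `^ p <= w -> d <= w `^ p^-1.
Proof.
move=> p0 d0 w0 h; rewrite -[d]powRr1 // -(mulfV (lt0r_neq0 p0)) powRrM.
by apply: ge0_ler_powR; rewrite ?nnegrE ?powR_ge0 // invr_ge0 ltW.
Qed.

Lemma powR_mono p x y : 0 <= p -> 0 <= x -> x <= y -> x `^ p <= y `^ p.
Proof.
move=> p0 x0 xy; apply: ge0_ler_powR; rewrite ?nnegrE //; exact: le_trans xy.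
Qed.

(** Split d1 into a power below one, which supplies the small constant, and the rest,
    which keeps the exponent of the control above one. *)
Lemma young_product p q : 1 <= p -> 0 < q -> 1 < p^-1 + q^-1 ->
  exists2 t, 1 < t & forall c, 0 < c -> exists2 e, 0 < e & forall d1 d2 w,
    0 <= d1 <= e -> 0 <= d2 -> 0 <= w -> d1 `^ q <= w -> d2 `^ p <= w ->
    d1 * d2 <= c * w `^ t.
Proof.
move=> p1 q0 pq; have p0 : 0 < p by lra.
have pi1 : p^-1 <= 1 by rewrite invf_le1.
have qx : q * (1 - p^-1) < 1.
  by rewrite -ltr_pdivlMl // mulr1; lra.
have qx0 : 0 <= q * (1 - p^-1) by apply: mulr_ge0; [exact: ltW|lra].
(* halfway between the value where the exponent al / q + 1 / p is one
   and the value where no small factor is left *)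
pose al := (1 + q * (1 - p^-1)) / 2.
have al1 : al < 1 by rewrite /al; lra.
have al0 : 0 < al by rewrite /al; lra.
exists (al / q + p^-1).
  have : 1 - p^-1 < al / q by rewrite ltr_pdivlMr // mulrC /al; lra.
  lra.
move=> c c0; exists (c `^ (1 - al)^-1); first by rewrite powR_gt0.
move=> d1 d2 w /andP[d10 d1e] d20 w0 h1 h2.
have -> : d1 = d1 `^ (1 - al) * d1 `^ al.
  rewrite -powRD; first by rewrite subrK powRr1.
  by apply/implyP => /eqP ?; exfalso; lra.
have tpos : 0 < al / q + p^-1 by apply: addr_gt0; [exact: divr_gt0|rewrite invr_gt0].
have -> : w `^ (al / q + p^-1) = w `^ (al / q) * w `^ p^-1.
  by apply: powRD; apply/implyP => /eqP E; move: tpos; rewrite E ltxx.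
rewrite -mulrA; apply: ler_pM; rewrite ?powR_ge0 // ?mulr_ge0 ?powR_ge0 //.
  have := @powR_mono (1 - al) _ _ ltac:(lra) d10 d1e.
  have nz : 1 - al != 0 by apply/eqP => ?; lra.
  by rewrite -powRrM mulVf // powRr1 // ltW.
apply: ler_pM; rewrite ?powR_ge0 //; last exact: powR_le_root.
rewrite [al / q]mulrC [w `^ _]powRrM; apply: powR_mono => //; first exact: ltW.
exact: powR_le_root.
Qed.

(** Discrete Love-Young estimate: halving the control at a well chosen index turns
    the additivity defect into a geometric series. *)
Lemma discrete_sewing t : 1 < t -> exists2 C, 0 <= C &
  forall (k h v : nat -> R) c n, 0 <= c ->
  (forall i j, (i <= j)%N -> (j <= n)%N -> v i <= v j) ->
  (forall i l x y z z' : nat, (i <= x <= l)%N -> (i <= y <= l)%N -> (i <= z <= l)%N ->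
     (i <= z' <= l)%N -> (l <= n)%N ->
     `|k x - k y| * `|h z - h z'| <= c * (v l - v i) `^ t) ->
  forall i l, (i <= l)%N -> (l <= n)%N ->
    `|\sum_(i <= m < l) k m.+1 * (h m.+1 - h m) - k i * (h l - h i)|
    <= C * c * (v l - v i) `^ t.
Proof.
(* two halves with at most half of the control cost r times the bound of the whole *)
move=> t1; pose r := 2 * 2^-1 `^ t : R.
have r0 : 0 <= r by rewrite mulr_ge0 ?powR_ge0.
have r1 : r < 1.
  suff : (2^-1 : R) `^ t < 2^-1 by rewrite /r; lra.
  rewrite -[ltRHS]powRr1; last by lra.
  rewrite /powR ifF; last by apply/negbTE; rewrite gt_eqF.
  rewrite ifF; last by apply/negbTE; rewrite gt_eqF.
  have : ln (2^-1 : R) < 0 by rewrite ln_lt0 // invr_gt0 ltr0n /= invf_lt1 // ltr1n.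
  by move=> ln0; rewrite ltr_expR ltr_nM2r.
pose C := 3 / (1 - r).
have C0 : 0 <= C by rewrite divr_ge0 //; lra.
exists C => // k h v c n c0 vm H.
pose T i l := \sum_(i <= m < l) k m.+1 * (h m.+1 - h m) - k i * (h l - h i).
have Tsplit i j l : (i <= j)%N -> (j <= l)%N ->
    T i l = T i j + T j l + (k j - k i) * (h l - h j).
  by move=> ij jl; rewrite /T (big_cat_nat ij jl) /=; ring.
suff : forall N i l, (l - i <= N)%N -> (i <= l)%N -> (l <= n)%N ->
    `|T i l| <= C * c * (v l - v i) `^ t by move=> Q i l; exact: (Q (l - i)%N).
elim=> [|N IH] i l lN il ln.
  have <- : i = l by apply/eqP; rewrite eqn_leq il -subn_eq0 -leqn0.
  rewrite /T big_geq // !subrr mulr0 subrr normr0.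
  by rewrite mulr_ge0 ?powR_ge0 // mulr_ge0.
have [->|nil] := eqVneq i l.
  rewrite /T big_geq // !subrr mulr0 subrr normr0.
  by rewrite mulr_ge0 ?powR_ge0 // mulr_ge0.
have il' : (i < l)%N by rewrite ltn_neqAle nil.
set w := v l - v i.
have w0 : 0 <= w by rewrite subr_ge0; exact: vm.
(* the last index up to which at most half of the control is used *)
have [j [/andP[ij jl] vj vj']] : exists j, [/\ (i <= j < l)%N,
    v j - v i <= w / 2 & v l - v j.+1 <= w / 2].
  pose Q j := (i <= j < l)%N && (v j - v i <= w / 2).
  have exQ : exists j, Q j by exists i; rewrite /Q leqnn il' subrr /=; lra.
  have ubQ j : Q j -> (j <= l)%N by case/andP => /andP[_ /ltnW].
  case: (ex_maxnP exQ ubQ) => j /andP[/andP[ij jl] vj] jmax.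
  exists j; split; rewrite ?ij //.
  have [jl'|jl'] := leqP l j.+1.
    have -> : j.+1 = l by apply/eqP; rewrite eqn_leq jl jl'.
    by rewrite subrr; lra.
  have : ~~ Q j.+1 by apply/negP => /jmax; rewrite ltnn.
  rewrite /Q (leq_trans ij (leqnSn j)) jl' /= -ltNge /w; lra.
rewrite (Tsplit i j l) ?(ltnW jl) // (Tsplit j j.+1 l) //.
have ij1 : (i <= j.+1)%N by exact: leq_trans ij _.
have B1 : `|T i j| <= C * c * (w / 2) `^ t.
  apply: (le_trans (IH i j _ ij _)).
  - by rewrite -ltnS; apply: leq_trans lN; exact: ltn_sub2r.
  - exact: leq_trans (ltnW jl) ln.
  - apply: ler_wpM2l; first exact: mulr_ge0.
    apply: powR_mono => //; first by lra.
    by rewrite subr_ge0; apply: vm => //; exact: leq_trans (ltnW jl) ln.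
have B2 : `|T j.+1 l| <= C * c * (w / 2) `^ t.
  apply: (le_trans (IH j.+1 l _ jl _)) => //.
  - by rewrite -ltnS; apply: leq_trans lN; rewrite ltn_sub2l.
  - apply: ler_wpM2l; first exact: mulr_ge0.
    apply: powR_mono => //; first by lra.
    by rewrite subr_ge0; exact: vm.
have B3 : `|T j j.+1| <= c * w `^ t.
  rewrite /T big_nat1.
  have -> : k j.+1 * (h j.+1 - h j) - k j * (h j.+1 - h j) =
    (k j.+1 - k j) * (h j.+1 - h j) by ring.
  by rewrite normrM; apply: H; rewrite ?ij ?ij1 ?jl ?(ltnW jl).
have B4 : `|(k j - k i) * (h l - h j)| <= c * w `^ t.
  by rewrite normrM; apply: H; rewrite ?ij ?il ?(ltnW jl) ?leqnn.
have B5 : `|(k j.+1 - k j) * (h l - h j.+1)| <= c * w `^ t.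
  by rewrite normrM; apply: H; rewrite ?ij ?ij1 ?il ?jl ?(ltnW jl) ?leqnn.
have E : C * c * (w / 2) `^ t = C * c * w `^ t * (r / 2).
  by rewrite powRM ?invr_ge0 // /r; field.
have F : C * c * w `^ t = 3 * (c * w `^ t) + r * (C * c * w `^ t).
  by rewrite /C; field; rewrite gt_eqF //; lra.
rewrite {}E in B1 B2; rewrite F.
move: B1 B2 B3 B4 B5; rewrite !ler_norml => /andP[? ?] /andP[? ?] /andP[? ?] /andP[? ?] /andP[? ?].
by apply/andP; split; lra.
Qed.

End power_estimates.

Section young_pairs.
Context {R : realType}.
Implicit Types (p q c d e w x y t : R) (om : option R).

(** [None] asks for nothing: regulated functions are the limiting case of functions of
    bounded [q]-variation. *)
Definition power_le om d w : Prop := if om is Some q then d `^ q <= w else True.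

(** Exponents of an integrand and an integrator for which Young integrals exist; an
    integrator of bounded variation allows every regulated integrand. *)
Definition young_pair om p : Prop := 1 <= p /\
  if om is Some q then 0 < q /\ 1 < p^-1 + q^-1 else p = 1.

(** Products of increments of a Young pair are small against a common control once the
    first increment is small.  Without a condition on the integrand the control bounds
    the increment of the integrator itself. *)
Lemma pair_bound om p Vt c : young_pair om p -> 0 <= Vt -> 0 < c ->
  exists2 e, 0 < e & forall d1 d2 w, 0 <= d1 <= e -> 0 <= d2 -> 0 <= w <= Vt ->
    power_le om d1 w -> d2 `^ p <= w -> d1 * d2 <= c * w.
Proof.
move=> [p1 v] Vt0 c0; case: om v => [q [q0 pq]|->].
  have [t t1 /(_ (c / (Vt `^ (t - 1) + 1)))] := young_product p1 q0 pq.
  have A0 : 0 < Vt `^ (t - 1) + 1 by rewrite ltr_wpDl // powR_ge0.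
  case; first by rewrite divr_gt0.
  move=> e e0 H; exists e => // d1 d2 w h1 h2 /andP[w0 wV] h3 h4.
  apply: (le_trans (H _ _ _ h1 h2 w0 h3 h4)).
  rewrite -mulrA ler_wpM2l ?(ltW c0) // -ler_pdivlMl ?invr_gt0 // invrK.
  have -> : w `^ t = w * w `^ (t - 1).
    rewrite -{2}[w]powRr1 // -powRD; first by congr powR; lra.
    by apply/implyP => /eqP ?; exfalso; lra.
  rewrite mulrC ler_wpM2r //; apply: (@le_trans _ _ (Vt `^ (t - 1))); last by rewrite lerDl.
  by apply: powR_mono => //; lra.
exists c => // d1 d2 w /andP[d10 d1e] d20 /andP[w0 _] _; rewrite powRr1 // => h.
exact: ler_pM.
Qed.

(** For an integrand of bounded [q]-variation the sewing estimate compares the sum with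
    k 0 * (h n - h 0), and both the error and this product are small with the sup norm of [k]. *)
Lemma young_sum om p Vt c : young_pair om p -> 0 <= Vt -> 0 < c ->
  exists2 e, 0 < e & forall (k h v : nat -> R) n,
    (forall i j, (i <= j)%N -> (j <= n)%N -> v i <= v j) -> v n - v 0 <= Vt ->
    (forall i, (i <= n)%N -> `|k i| <= e) ->
    (forall i j, (i <= j)%N -> (j <= n)%N -> power_le om `|k j - k i| (v j - v i)) ->
    (forall i j, (i <= j)%N -> (j <= n)%N -> `|h j - h i| `^ p <= v j - v i) ->
    `|\sum_(0 <= i < n) k i.+1 * (h i.+1 - h i)| <= c.
Proof.
move=> [p1 vd] Vt0 c0; case: om vd => [q [q0 pq]|p1'].
  have p0 : 0 < p by lra.
  have [t t1 Ht] := young_product p1 q0 pq.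
  have [C C0 HC] := discrete_sewing t1.
  have [|e e0 He] := Ht (c / 2 / (C * Vt `^ t + 1)).
    by rewrite !divr_gt0 // ltr_wpDl // mulr_ge0 // powR_ge0.
  set A := C * Vt `^ t + 1 in He.
  have A0 : 0 < A by rewrite ltr_wpDl // mulr_ge0 // powR_ge0.
  have B0 : 0 < Vt `^ p^-1 + 1 by rewrite ltr_wpDl // powR_ge0.
  exists (Num.min (e / 2) (c / 2 / (Vt `^ p^-1 + 1))).
    by rewrite lt_min !divr_gt0.
  move=> k h v n vm vV ke kc hc.
  have v0n (i l : nat) : (i <= l)%N -> (l <= n)%N -> 0 <= v l - v i by move=> *; rewrite subr_ge0 vm.
  have sub (i l x y : nat) : (i <= x)%N -> (x <= y)%N -> (y <= l)%N -> (l <= n)%N -> v y - v x <= v l - v i.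
    move=> ix xy yl ln; apply: lerB; first exact: vm.
    by apply: vm => //; apply: leq_trans xy _; exact: leq_trans yl ln.
  have H (i l x y z z' : nat) : (i <= x <= l)%N -> (i <= y <= l)%N -> (i <= z <= l)%N ->
     (i <= z' <= l)%N -> (l <= n)%N ->
     `|k x - k y| * `|h z - h z'| <= c / 2 / A * (v l - v i) `^ t.
    move=> /andP[ix xl] /andP[iy yl] /andP[iz zl] /andP[iz' zl'] ln; apply: He => //.
    - rewrite normr_ge0 /=; apply: (le_trans (ler_normB _ _)).
      have h1 := ke x (leq_trans xl ln); have h2 := ke y (leq_trans yl ln).
      rewrite !le_min in h1 h2; case/andP: h1 => h1 _; case/andP: h2 => h2 _; lra.
    - by apply: v0n => //; exact: leq_trans ix xl.
    - have [xy|yx] := leqP x y.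
        by rewrite distrC; apply: (le_trans (kc x y xy (leq_trans yl ln))); exact: sub.
      by apply: (le_trans (kc y x (ltnW yx) (leq_trans xl ln))); apply: sub => //; exact: ltnW.
    - have [xy|yx] := leqP z z'.
        by rewrite distrC; apply: (le_trans (hc z z' xy (leq_trans zl' ln))); exact: sub.
      by apply: (le_trans (hc z' z (ltnW yx) (leq_trans zl ln))); apply: sub => //; exact: ltnW.
  have cA : 0 <= c / 2 / A by rewrite ltW // !divr_gt0.
  have S1 := HC k h v _ n cA vm H 0%N n (leq0n n) (leqnn n).
  have S2 : C * (c / 2 / A) * (v n - v 0%N) `^ t <= c / 2.
    apply: (@le_trans _ _ (c / 2 / A * (C * Vt `^ t))).
      have -> : C * (c / 2 / A) * (v n - v 0%N) `^ t = c / 2 / A * (C * (v n - v 0%N) `^ t) by ring.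
      rewrite ler_wpM2l // ler_wpM2l // powR_mono //; first by lra.
      exact: v0n.
    rewrite mulrAC ler_pdivrMr // ler_wpM2l ?lerDl //; lra.
  have S3 : `|k 0%N * (h n - h 0%N)| <= c / 2.
    rewrite normrM; apply: (@le_trans _ _ (c / 2 / (Vt `^ p^-1 + 1) * (Vt `^ p^-1))).
      apply: ler_pM => //.
        by have := ke 0%N (leq0n n); rewrite le_min => /andP[].
      by apply: powR_le_root => //; apply: le_trans (hc _ _ _ _) vV.
    rewrite mulrAC ler_pdivrMr // ler_wpM2l ?lerDl //; lra.
  move: (le_trans S1 S2) S3; rewrite !ler_norml => /andP[? ?] /andP[? ?].
  by apply/andP; split; lra.
exists (c / (Vt + 1)); first by rewrite divr_gt0 // ltr_wpDl.
move=> k h v n vm vV ke _ hc; apply: (le_trans (ler_norm_sum _ _ _)).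
apply: (@le_trans _ _ (\sum_(0 <= i < n) c / (Vt + 1) * (v i.+1 - v i))).
  apply: ler_sum_nat => i /andP[_ i_n]; rewrite normrM; apply: ler_pM => //.
    exact: ke.
  by have := hc i i.+1 (leqnSn i) i_n; rewrite p1' powRr1.
rewrite -mulr_sumr telescope_sumr // mulrAC ler_pdivrMr ?ltr_wpDl //.
by rewrite ler_wpM2l ?(ltW c0) // (le_trans vV) // lerDl.
Qed.

End young_pairs.

(** * Bounded power variation and its dual class *)

Section controls.
Context {R : realType}.
Implicit Types (a b p q r s t x y e : R) (om : option R) (f g h k K H V W : R -> R).

Lemma mono_lft V r : {homo V : x y / x <= y} -> V x @[x --> r^'-] --> lft V r.
Proof.
move=> mV; apply: nondecreasing_at_left_is_cvgr.
  by near=> x => u v _ _; exact: mV.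
near=> x; exists (V r) => _ [y /= + <-]; rewrite in_itv /= => /andP[_ yr].
exact/mV/ltW.
Unshelve. all: by end_near. Qed.

Lemma mono_rgt V r : {homo V : x y / x <= y} -> V x @[x --> r^'+] --> rgt V r.
Proof.
move=> mV; apply: nondecreasing_at_right_is_cvgr.
  by near=> x => u v _ _; exact: mV.
near=> x; exists (V r) => _ [y /= + <-]; rewrite in_itv /= => /andP[yr _].
exact/mV/ltW.
Unshelve. all: by end_near. Qed.

Lemma mono_regulated V a b : {homo V : x y / x <= y} -> regulated a b V.
Proof. by move=> mV; split=> r _; apply/cvg_ex; eexists; [exact: mono_lft|exact: mono_rgt]. Qed.

(** A nondecreasing function of the whole line in place of the variation function, so that
    one-sided limits of the control exist everywhere. *)
Definition controlled om a b K V := {homo V : x y / x <= y} /\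
  forall x y, a <= x -> x <= y -> y <= b -> power_le om `|K y - K x| (V y - V x).

Lemma controlled_None a b K : controlled None a b K (fun=> 0).
Proof. by split=> [x y _|]; rewrite ?lexx. Qed.

Definition clamp a b x : R := Num.max a (Num.min x b).

Lemma clamp_in a b x : a <= b -> a <= clamp a b x <= b.
Proof. by move=> ab; rewrite /clamp le_max lexx /= ge_max ab /= ge_min lexx orbT. Qed.

Lemma clamp_id a b x : a <= x <= b -> clamp a b x = x.
Proof. by move=> /andP[ax xb]; rewrite /clamp (min_idPl xb) (max_idPr ax). Qed.

Lemma clamp_mono a b : {homo clamp a b : x y / x <= y}.
Proof.
move=> x y xy; rewrite /clamp ge_max le_max lexx /= le_max; apply/orP; right.
by rewrite le_min !ge_min xy lexx orbT.
Qed.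

(** The variation function, continued by constants outside of the interval, is a
    control. *)
Lemma W_controlled p a b h : 0 < p -> a < b -> W p a b h <-> exists V, controlled (Some p) a b h V.
Proof.
move=> p0 ab; split=> [Wh|[V [mV hV]]]; last first.
  apply: (@le_lt_trans _ _ (V b - V a)%:E); last by rewrite ltry.
  apply: ub_ereal_sup => _ [xs [pxs /eqP lxs] <-]; rewrite lee_fin.
  have := psum_tele V a xs; rewrite lxs => <-; apply: ler_psum => // x y ax xy.
  by rewrite lxs => yb; apply: hV => //; exact: ltW.
pose S (t : R) := [set psum (fun x y => `|h y - h x| `^ p) a xs |
   xs in [set xs | itv_partition a t xs]].
pose v t := sup (S t).
have S0 t : a <= t -> S t !=set0.
  rewrite le_eqVlt => /orP[/eqP<-|at_]; last by exists (psum (fun x y => `|h y - h x| `^ p) a [:: t]), [:: t] => //; exact: itv_partition1.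
  by exists (psum (fun x y => `|h y - h x| `^ p) a [::]), [::] => //; split => //=.
have step x y xs : x <= y -> itv_partition a x xs ->
    exists2 ys, itv_partition a y ys &
    psum (fun x y => `|h y - h x| `^ p) a ys =
    psum (fun x y => `|h y - h x| `^ p) a xs + `|h y - h x| `^ p.
  rewrite le_eqVlt => /orP[/eqP<-|xy] [pxs lxs].
    exists xs; first by split.
    by rewrite subrr normr0 powR0 ?addr0 // gt_eqF.
  exists (rcons xs y); last by rewrite psum_rcons (eqP lxs).
  by split; rewrite ?last_rcons ?eqxx // rcons_path pxs (eqP lxs).
have [M HM] : exists M, forall t x, a <= t -> t <= b -> S t x -> x <= M.
  exists (fine (pvar p h a b)) => t _ at_ tb [xs pxs <-].
  have [ys pys E] := step t b xs tb pxs.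
  apply: (@le_trans _ _ (psum (fun x y => `|h y - h x| `^ p) a ys)).
    by rewrite E lerDl powR_ge0.
  have le : ((psum (fun x y => `|h y - h x| `^ p) a ys)%:E <= pvar p h a b)%E.
    by apply: ereal_sup_ubound; exists ys.
  rewrite -lee_fin fineK // fin_numElt; apply/andP; split; last exact: Wh.
  by apply: lt_le_trans le; rewrite ltNyr.
have hsS t : a <= t -> t <= b -> has_sup (S t).
  by move=> at_ tb; split; [exact: S0 | exists M => x; exact: HM].
have vstep x y : a <= x -> x <= y -> y <= b -> `|h y - h x| `^ p <= v y - v x.
  move=> ax xy yb; rewrite lerBrDl -lerBrDr; apply: sup_le_ub; first exact: S0.
  move=> _ [xs pxs <-]; have [ys pys E] := step x y xs xy pxs.
  rewrite lerBrDr -E; apply: sup_upper_bound; last by exists ys.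
  by apply: hsS => //; exact: le_trans xy.
exists (v \o clamp a b); split=> [x y xy|x y ax xy yb] /=.
  have /andP[ax xb] := clamp_in x (ltW ab); have /andP[ay yb] := clamp_in y (ltW ab).
  have := vstep _ _ ax (clamp_mono a b xy) yb.
  by move=> /(le_trans (powR_ge0 _ _)); rewrite subr_ge0.
by rewrite !clamp_id ?ax ?yb ?(le_trans xy) ?(le_trans ax) //; exact: vstep.
Qed.

Lemma controlled_regulated q a b h V : 0 < q -> controlled (Some q) a b h V -> regulated a b h.
Proof.
move=> q0 [mV hV].
have key e x y : 0 < e -> a <= x -> x <= y -> y <= b -> V y - V x <= e `^ q -> `|h y - h x| <= e.
  move=> e0 ax xy yb h1; have h2 := le_trans (hV _ _ ax xy yb) h1.
  rewrite leNgt; apply/negP => h3; move: h2; apply/negP; rewrite -ltNge.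
  by apply: gt0_ltr_powR; rewrite ?nnegrE // ltW.
split=> r /andP[ar rb].
  apply: left_cauchy => e e0.
  have eq0 : 0 < e `^ q / 2 by rewrite divr_gt0 // powR_gt0.
  have [u ur Hu] := (left_cvgP _ _ _).1 (mono_lft (r:=r) mV) _ eq0.
  exists (Num.max a u) => [|x y]; first by rewrite gt_max ar.
  rewrite gt_max => /andP[ax ux] xy yr; apply: key => //; [exact: ltW|exact: le_trans (ltW yr) rb|].
  have := Hu x; have := Hu y.
  rewrite ux yr (lt_le_trans ux xy) (le_lt_trans xy yr) !ler_distl.
  by move=> /(_ isT) /andP[? ?] /(_ isT) /andP[? ?]; lra.
apply: right_cauchy => e e0.
have eq0 : 0 < e `^ q / 2 by rewrite divr_gt0 // powR_gt0.
have [u ur Hu] := (right_cvgP _ _ _).1 (mono_rgt (r:=r) mV) _ eq0.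
exists (Num.min b u) => [|x y]; first by rewrite lt_min rb.
rewrite lt_min => rx xy /andP[yb yu]; apply: key => //; rewrite ?(ltW yb) //.
  exact: le_trans (ltW rx).
have := Hu x; have := Hu y.
rewrite rx yu (lt_le_trans rx xy) (le_lt_trans xy yu) !ler_distl.
by move=> /(_ isT) /andP[? ?] /(_ isT) /andP[? ?]; lra.
Qed.

(** Brings the two cases of the dual class into one form. *)
Lemma dualW_controlled p a b K : 1 <= p -> a < b -> dualW p a b K <->
  exists om V, [/\ young_pair om p, regulated a b K & controlled om a b K V].
Proof.
move=> p1 ab; split.
  move=> [[-> rK]|[p1' [q [q0 pq /W_controlled]]]].
    by exists None, (fun=> 0); split=> //; exact: controlled_None.
  move=> /(_ q0 ab)[V hV]; exists (Some q), V; split=> //.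
  exact: controlled_regulated q0 hV.
move=> [[q|] [V [[_ v] rK hV]]]; last by left.
case: v => q0 pq; have [->|pn1] := eqVneq p 1; first by left.
right; split; first by rewrite lt_neqAle eq_sym pn1.
by exists q; split=> //; apply/W_controlled => //; exists V.
Qed.

Lemma power_le_le om d d' w w' : (if om is Some q then 0 <= q else true) ->
  0 <= d -> d <= d' -> w' <= w -> power_le om d' w' -> power_le om d w.
Proof.
case: om => //= q q0 d0 dd ww h; apply: le_trans ww; apply: le_trans h.
exact: powR_mono.
Qed.

Lemma valid_ge0 om p : young_pair om p -> if om is Some q then 0 <= q else true.
Proof. by case=> _; case: om => // q [/ltW]. Qed.

Lemma powRD_le q x y : 0 <= q -> 0 <= x -> 0 <= y ->
  (x + y) `^ q <= 2 `^ q * (x `^ q + y `^ q).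
Proof.
move=> q0; wlog xy : x y / x <= y.
  move=> H x0 y0; have [xy|/ltW yx] := leP x y; first exact: H.
  by rewrite addrC [x `^ q + _]addrC; exact: H.
move=> x0 y0; apply: (@le_trans _ _ ((2 * y) `^ q)).
  by apply: powR_mono => //; [exact: addr_ge0 | lra].
by rewrite powRM // ler_wpM2l ?powR_ge0 // lerDr powR_ge0.
Qed.

(** Powers are subadditive up to a constant.  Products and propagators obtain their
    controls in this way. *)
Lemma controlled_dom om a b k K H V W c : (if om is Some q then 0 <= q else true) ->
  0 <= c -> controlled om a b K V -> controlled om a b H W ->
  (forall x y, a <= x -> x <= y -> y <= b ->
     `|k y - k x| <= c * (`|K y - K x| + `|H y - H x|)) ->
  exists U, controlled om a b k U.
Proof.
case: om => [q|_ _ _ _ _]; last by exists (fun=> 0); exact: controlled_None.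
move=> q0 c0 [mV KV] [mW HW] le.
exists (fun x => c `^ q * (2 `^ q * (V x + W x))); split=> [x y xy|x y ax xy yb].
  by rewrite !ler_wpM2l ?powR_ge0 // lerD // ?mV ?mW.
rewrite /= -!mulrBr; apply: (le_trans (powR_mono q0 (normr_ge0 _) (le x y ax xy yb))).
rewrite powRM ?addr_ge0 // ler_wpM2l ?powR_ge0 //.
apply: (le_trans (powRD_le _ _ _)) => //; rewrite ler_wpM2l ?powR_ge0 //.
have := KV x y ax xy yb; have := HW x y ax xy yb; rewrite /=; lra.
Qed.

(** The excess power of an increment of a bounded function is bounded. *)
Lemma controlled_raise q q' a b K V M : 0 < q -> q <= q' ->
  (forall x, a <= x <= b -> `|K x| <= M) -> controlled (Some q) a b K V ->
  exists U, controlled (Some q') a b K U.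
Proof.
move=> q0 qq KM [mV KV]; exists (fun x => (2 * M) `^ (q' - q) * V x).
split=> [x y xy|x y ax xy yb]; first by rewrite ler_wpM2l ?powR_ge0 ?mV.
rewrite /= -mulrBr; have := KV x y ax xy yb; rewrite /= => h.
have -> : `|K y - K x| `^ q' = `|K y - K x| `^ (q' - q) * `|K y - K x| `^ q.
  by rewrite -powRD ?subrK //; apply/implyP => /eqP ?; exfalso; lra.
apply: ler_pM; rewrite ?powR_ge0 //; apply: powR_mono; rewrite ?subr_ge0 //.
apply: (le_trans (ler_normB _ _)).
have h1 := KM y ltac:(rewrite yb (le_trans ax xy)//).
have h2 := KM x ltac:(rewrite ax (le_trans xy yb)//).
lra.
Qed.

(** Once the smaller exponent is raised to the larger one, the product rule for increments
    applies. *)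
Lemma dualW_mul p a b K H : 1 <= p -> a < b -> dualW p a b K -> dualW p a b H ->
  dualW p a b (fun x => K x * H x).
Proof.
move=> p1 ab dK dH.
have [om1 [V1 [v1 rK c1]]] := (dualW_controlled _ p1 ab).1 dK.
have [om2 [V2 [v2 rH c2]]] := (dualW_controlled _ p1 ab).1 dH.
have rKH : regulated a b (fun x => K x * H x) by exact: regulatedM.
have [M M0 HM] := regulated_bounded ab rK.
have [N N0 HN] := regulated_bounded ab rH.
have [om [U1 [U2 [v h1 h2]]]] : exists om U1 U2, [/\ young_pair om p, controlled om a b K U1 & controlled om a b H U2].
  case: om1 om2 v1 v2 c1 c2 => [q1|] [q2|] v1 v2 c1 c2; first last.
  - by exists None, V1, V2.
  - by exists None, (fun=> 0), (fun=> 0); split=> //; exact: controlled_None.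
  - by exists None, (fun=> 0), (fun=> 0); split=> //; exact: controlled_None.
  have q10 : 0 < q1 by case: v1 => _ [].
  have q20 : 0 < q2 by case: v2 => _ [].
  have [le|/ltW le] := leP q1 q2.
    by have [U hU] := controlled_raise q10 le HM c1; exists (Some q2), U, V2.
  by have [U hU] := controlled_raise q20 le HN c2; exists (Some q1), V1, U.
have MN0 : 0 <= M + N by rewrite addr_ge0 // ltW.
have [|U hU] := controlled_dom (k := fun x => K x * H x) (valid_ge0 v) MN0 h1 h2.
  move=> x y ax xy yb.
  have -> : K y * H y - K x * H x = (K y - K x) * H y + K x * (H y - H x) by ring.
  apply: (le_trans (ler_normD _ _)); rewrite !normrM.
  have b1 := HN y ltac:(rewrite yb (le_trans ax xy)//).
  have b2 := HM x ltac:(rewrite ax (le_trans xy yb)//).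
  have := ler_wpM2l (normr_ge0 (K y - K x)) b1.
  have := ler_wpM2r (normr_ge0 (H y - H x)) b2.
  have := mulr_ge0 (ltW N0) (normr_ge0 (H y - H x)).
  have := mulr_ge0 (ltW M0) (normr_ge0 (K y - K x)).
  lra.
by apply/(dualW_controlled _ p1 ab); exists om, U.
Qed.

End controls.

(** * Unconditional sums and products *)

Section exponential.
Context {R : realType}.
Implicit Types x : R.

(** As (i - k)! <= i!, the tail of the series is at most |x|^k times the exponential
    series of |x|. *)
Lemma exp_taylor x k : `|expR x - \sum_(0 <= i < k) x ^+ i / i`!%:R| <= `|x| ^+ k * expR `|x|.
Proof.
have pos : forall y n, 0 <= y -> series (exp_coeff y) n <= expR y :> R.
  move=> y n y0; apply: nondecreasing_cvgn_le; last exact: is_cvg_series_exp_coeff.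
  by apply: nondecreasing_series => i _ _; exact: exp_coeff_ge0.
suff : \forall n \near \oo,
    `|series (exp_coeff x) n - \sum_(0 <= i < k) x ^+ i / i`!%:R| <= `|x| ^+ k * expR `|x|.
  move=> H; have c : `|series (exp_coeff x) n - \sum_(0 <= i < k) x ^+ i / i`!%:R|
      @[n --> \oo] --> `|expR x - \sum_(0 <= i < k) x ^+ i / i`!%:R|.
    by apply: cvg_norm; apply: cvgB; [exact: is_cvg_series_exp_coeff|exact: cvg_cst].
  by rewrite -(cvg_lim _ c) //; apply: limr_le => //; apply/cvg_ex; eexists; exact: c.
apply/near_ooP; exists k => n kn.
rewrite /series /= (big_cat_nat (leq0n k) kn) /= [X in X - _]addrC addrK.
apply: (le_trans (ler_norm_sum _ _ _)).
apply: (@le_trans _ _ (\sum_(k <= i < n) `|x| ^+ k * (`|x| ^+ (i - k) / (i - k)`!%:R))).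
  apply: ler_sum_nat => i /andP[ki _].
  rewrite normrM normfV normrX (ger0_norm (ler0n _ _)) mulrA -exprD subnKC //.
  apply: ler_wpM2l; first exact: exprn_ge0.
  rewrite lef_pV2 ?posrE ?ltr0n ?fact_gt0 // ler_nat.
  by apply: leq_fact; exact: leq_subr.
rewrite -mulr_sumr ler_wpM2l ?exprn_ge0 //.
rewrite -{1}[k]add0n big_addn; apply: le_trans (pos `|x| (n - k)%N (normr_ge0 x)).
by rewrite /series /=; apply: ler_sum_nat => i _; rewrite addnK.
Qed.

Lemma exp_taylor1 x : `|expR x - 1| <= `|x| * expR `|x|.
Proof.
have := exp_taylor x 1; rewrite big_nat1 expr0 fact0 divr1.
by rewrite expr1.
Qed.

Lemma exp_taylor2 x : `|expR x - 1 - x| <= x ^+ 2 * expR `|x|.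
Proof.
have := exp_taylor x 2; rewrite big_nat_recr //= big_nat1 expr0 expr1 fact0 !divr1.
by rewrite -addrA -opprD real_normK ?num_real.
Qed.

Lemma exp_taylor3 x : `|expR x - 1 - x - x ^+ 2 / 2| <= `|x| ^+ 3 * expR `|x|.
Proof.
have := exp_taylor x 3; rewrite !big_nat_recr //= big_nil expr0 expr1 fact0 !divr1 add0r.
by rewrite !opprD !addrA.
Qed.

End exponential.

Section finite_sums.
Context {R : realType}.
Implicit Types (A : {fset R}) (D : set R) (c u F : R -> R) (s t r M : R).

Lemma prod_bound (s : seq R) (P : pred R) F :
  `|\prod_(t <- s | P t) F t| <= expR (\sum_(t <- s | P t) `|F t - 1|).
Proof.
rewrite expR_sum; elim/big_ind2 : _ => [|x1 x2 y1 y2 h1 h2|t _].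
- by rewrite normr1.
- by rewrite normrM; apply: ler_pM.
- have := expR_ge1Dx `|F t - 1|; apply: le_trans.
  by rewrite -{1}[F t](subrK 1) addrC (le_trans (ler_normD _ _)) // normr1.
Qed.

(** By induction, 1 + x <= exp x absorbing each new factor. *)
Lemma prod_dist1 (s : seq R) (P : pred R) F :
  `|\prod_(t <- s | P t) F t - 1| <= expR (\sum_(t <- s | P t) `|F t - 1|) - 1.
Proof.
elim: s => [|t s IH]; first by rewrite !big_nil expR0 !subrr normr0.
rewrite !big_cons; case: (P t) => //.
have h := prod_bound s P F.
have h2 := expR_ge1Dx `|F t - 1|.
set X := \prod_(_ <- _ | _) _ in IH h *; set S := \sum_(_ <- _ | _) _ in IH h *.
have -> : F t * X - 1 = (F t - 1) * X + (X - 1) by ring.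
rewrite expRD; apply: (le_trans (ler_normD _ _)); rewrite normrM.
have h3 : `|F t - 1| * `|X| <= `|F t - 1| * expR S by rewrite ler_wpM2l.
have h4 : (1 + `|F t - 1|) * expR S <= expR `|F t - 1| * expR S.
  by rewrite ler_wpM2r // expR_ge0.
lra.
Qed.

Lemma prod_dist2 (s : seq R) (P : pred R) F :
  `|\prod_(t <- s | P t) F t - 1 - \sum_(t <- s | P t) (F t - 1)|
  <= expR (\sum_(t <- s | P t) `|F t - 1|) - 1 - \sum_(t <- s | P t) `|F t - 1|.
Proof.
elim: s => [|t s IH]; first by rewrite !big_nil expR0 subrr !subr0 normr0.
rewrite !big_cons; case: (P t) => //.
have h := prod_dist1 s P F.
have h2 := expR_ge1Dx `|F t - 1|.
set X := \prod_(_ <- _ | _) _ in IH h *; set S := \sum_(_ <- _ | _) `|_| in IH h *.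
set T := \sum_(_ <- _ | _) _ in IH *.
have -> : F t * X - 1 - (F t - 1 + T) = (F t - 1) * (X - 1) + (X - 1 - T) by ring.
rewrite expRD; apply: (le_trans (ler_normD _ _)); rewrite normrM.
have h3 : `|F t - 1| * `|X - 1| <= `|F t - 1| * (expR S - 1) by rewrite ler_wpM2l.
have h4 : (1 + `|F t - 1|) * expR S <= expR `|F t - 1| * expR S.
  by rewrite ler_wpM2r // expR_ge0.
lra.
Qed.

Lemma fset_perm A0 A : (A0 `<=` A)%fset -> perm_eq A (A0 ++ (A `\` A0)%fset).
Proof.
move=> sub; apply: uniq_perm => [||x]; first exact: fset_uniq.
  rewrite cat_uniq !fset_uniq andbT /=; apply/hasPn => x.
  by rewrite in_fsetD => /andP[].
rewrite mem_cat in_fsetD; have [xA0|//] := boolP (x \in A0).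
by rewrite (fsubsetP sub).
Qed.

Lemma near_totP (P : {fset R} -> Prop) A0 :
  (forall A, (A0 `<=` A)%fset -> P A) -> \forall A \near summability.totally, P A.
Proof. by move=> H; exists A0. Qed.

(** Absolute summability stated without a limit; [usum_cvgP] and [uprod_cvgP] turn it into
    convergence of the sum and of the product. *)
Definition fin_bounded D c M := forall A, \sum_(t <- A | t \in D) `|c t| <= M.

Lemma fin_bounded_ge0 D c M : fin_bounded D c M -> 0 <= M.
Proof. by move=> /(_ fset0); rewrite big_mkcond big_seq_fset0. Qed.

Lemma fin_bounded_sup D c M : fin_bounded D c M -> forall e, 0 < e ->
  exists A0, forall A, (A0 `<=` A)%fset ->
    \sum_(t <- (A `\` A0)%fset | t \in D) `|c t| < e.
Proof.
move=> H e e0; pose S := [set \sum_(t <- A | t \in D) `|c t| | A in [set: {fset R}]].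
have hs : has_sup S.
  split; first by exists (\sum_(t <- fset0 | t \in D) `|c t|), fset0.
  by exists M => _ [A _ <-]; exact: H.
have [_ [A0 _ <-] h] := sup_adherent e0 hs; exists A0 => A sub.
have : \sum_(t <- A | t \in D) `|c t| <= sup S by apply: sup_upper_bound => //; exists A.
rewrite (perm_big _ (fset_perm sub)) big_cat /=; lra.
Qed.

Lemma usum_cvgP D c M : fin_bounded D c M -> usum_cvg D c (usum D c).
Proof.
move=> H; apply: cauchy_cvg; apply: cauchy_exP => e e0.
have [A0 HA] := fin_bounded_sup H e0.
exists (\sum_(t <- A0 | t \in D) c t); apply: (@near_totP _ A0) => A sub.
rewrite /ball /= (perm_big _ (fset_perm sub)) big_cat /= opprD addNKr normrN.
by apply: le_lt_trans (HA A sub); exact: ler_norm_sum.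
Qed.

Lemma usum_cvg_unique D c S : usum_cvg D c S -> usum D c = S.
Proof. exact: cvg_lim. Qed.

Lemma uprod_cvgP D F M : fin_bounded D (fun t => F t - 1) M ->
  (fun A : {fset R} => \prod_(t <- A | t \in D) F t) @ summability.totally --> uprod D F.
Proof.
move=> H; apply: cauchy_cvg; apply: cauchy_exP => e e0.
(* below 1 the exponential in the bound of the tail product is at most exp 1 *)
have d0 : 0 < Num.min 1 (e / (expR M * expR 1 + 1)).
  by rewrite lt_min ltr01 divr_gt0 // ltr_wpDl // mulr_ge0 // expR_ge0.
have [A0 HA] := fin_bounded_sup H d0.
exists (\prod_(t <- A0 | t \in D) F t); apply: (@near_totP _ A0) => A sub.
rewrite /ball /= (perm_big _ (fset_perm sub)) big_cat /=.
have h1 := prod_bound A0 (fun t => t \in D) F.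
have h2 := prod_dist1 (A `\` A0)%fset (fun t => t \in D) F.
have h3 := HA A sub.
set X := \prod_(t <- A0 | _) _ in h1 *; set Y := \prod_(_ <- _ | _) _ in h2 *.
set s := \sum_(_ <- _ | _) _ in h2 h3.
have s0 : 0 <= s by apply: sumr_ge0.
have -> : X - X * Y = - (X * (Y - 1)) by ring.
rewrite normrN normrM; rewrite lt_min in h3; case/andP: h3 => h3 h4.
have h5 : `|X| <= expR M by apply: le_trans h1 _; rewrite ler_expR; exact: H.
have h6 : `|Y - 1| <= s * expR 1.
  apply: (le_trans h2); apply: (le_trans (ler_norm _)); apply: (le_trans (exp_taylor1 _)).
  by rewrite ger0_norm // ler_wpM2l // ler_expR ltW.
apply: (@le_lt_trans _ _ (expR M * (s * expR 1))).
  by apply: ler_pM.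
move: h4; rewrite ltr_pdivlMr; last by rewrite ltr_wpDl // mulr_ge0 // expR_ge0.
apply: le_lt_trans; rewrite mulrDr mulr1 mulrCA lerDl //.
Qed.

Lemma tot_le (f : {fset R} -> R) l M : f @ summability.totally --> l ->
  (forall A, f A <= M) -> l <= M.
Proof.
move=> c H; rewrite -(cvg_lim _ c) //; apply: limr_le; first by apply/cvg_ex; exists l.
exact: nearW.
Qed.

Lemma usum_le D c M : fin_bounded D c M -> `|usum D c| <= M.
Proof.
move=> H; apply: (tot_le (cvg_norm (usum_cvgP H))) => A /=.
by apply: le_trans (H A); exact: ler_norm_sum.
Qed.

Lemma uprod_dist2 D F M : fin_bounded D (fun t => F t - 1) M ->
  `|uprod D F - 1 - usum D (fun t => F t - 1)| <= M ^+ 2 * expR M.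
Proof.
move=> H; have M0 := fin_bounded_ge0 H.
have c : (fun A : {fset R} => \prod_(t <- A | t \in D) F t - 1 -
    \sum_(t <- A | t \in D) (F t - 1)) @ summability.totally -->
    uprod D F - 1 - usum D (fun t => F t - 1).
  apply: cvgB; last exact: (usum_cvgP H).
  by apply: cvgB; [exact: uprod_cvgP H|exact: cvg_cst].
apply: (tot_le (cvg_norm c)) => A /=.
apply: (le_trans (prod_dist2 _ _ _)); set s := \sum_(_ <- _ | _) _.
have s0 : 0 <= s by apply: sumr_ge0.
have sM : s <= M by exact: H.
apply: (le_trans (ler_norm _)); apply: (le_trans (exp_taylor2 _)).
rewrite (ger0_norm s0); apply: ler_pM; rewrite ?exprn_ge0 ?expR_ge0 //.
  by rewrite lerXn2r ?nnegrE.
by rewrite ler_expR.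
Qed.

Lemma usumD D c1 c2 M1 M2 : fin_bounded D c1 M1 -> fin_bounded D c2 M2 ->
  usum D (fun t => c1 t + c2 t) = usum D c1 + usum D c2.
Proof.
move=> H1 H2; apply: usum_cvg_unique; rewrite /usum_cvg.
rewrite (_ : (fun A : {fset R} => _) = (fun A : {fset R} => \sum_(t <- A | t \in D) c1 t +
  \sum_(t <- A | t \in D) c2 t)); last by apply/funext => A; rewrite big_split.
by apply: cvgD; [exact: (usum_cvgP H1)|exact: (usum_cvgP H2)].
Qed.

Lemma usumZ D c k M : fin_bounded D c M -> usum D (fun t => k * c t) = k * usum D c.
Proof.
move=> H; apply: usum_cvg_unique; rewrite /usum_cvg.
rewrite (_ : (fun A : {fset R} => _) = (fun A : {fset R} => k * \sum_(t <- A | t \in D) c t)).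
  by apply: cvgM; [exact: cvg_cst|exact: (usum_cvgP H)].
by apply/funext => A; rewrite mulr_sumr.
Qed.

Lemma usum_ge0 D c M : fin_bounded D c M -> (forall t, 0 <= c t) -> 0 <= usum D c.
Proof.
move=> H c0; rewrite -oppr_le0.
have cc : (fun A : {fset R} => - \sum_(t <- A | t \in D) c t) @ summability.totally
    --> - usum D c by apply: cvgN; exact: (usum_cvgP H).
apply: (tot_le cc) => A /=.
by rewrite oppr_le0 sumr_ge0.
Qed.

Lemma fin_bounded_sub D D' c M : D' `<=` D -> fin_bounded D c M -> fin_bounded D' c M.
Proof.
move=> sub H A; apply: le_trans (H A); rewrite big_mkcond [leRHS]big_mkcond.
apply: ler_sum => t _; case: ifP => [/set_mem/sub/mem_set -> //|_].
by case: ifP.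
Qed.

Section splitting.
Variables (D1 D2 : set R).
Hypothesis D12 : forall t, D1 t -> D2 t -> False.

Lemma big_setU (T : Type) (idx : T) (op : Monoid.com_law idx) (s : seq R) (F : R -> T) :
  \big[op/idx]_(t <- s | t \in D1 `|` D2) F t =
  op (\big[op/idx]_(t <- s | t \in D1) F t) (\big[op/idx]_(t <- s | t \in D2) F t).
Proof.
rewrite big_mkcond [in X in op X _]big_mkcond [in X in op _ X]big_mkcond -big_split /=.
apply: eq_bigr => t _; rewrite in_setU.
have [/set_mem t1|t1] := boolP (t \in D1); have [/set_mem t2|t2] := boolP (t \in D2) => /=;
  rewrite ?Monoid.mulm1 ?Monoid.mul1m //.
by case: (D12 t1 t2).
Qed.

Lemma usumU c M1 M2 : fin_bounded D1 c M1 -> fin_bounded D2 c M2 ->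
  usum (D1 `|` D2) c = usum D1 c + usum D2 c.
Proof.
move=> H1 H2; apply: usum_cvg_unique; rewrite /usum_cvg.
rewrite (_ : (fun A : {fset R} => _) = (fun A : {fset R} => \sum_(t <- A | t \in D1) c t +
  \sum_(t <- A | t \in D2) c t)); last by apply/funext => A; rewrite big_setU.
by apply: cvgD; [exact: (usum_cvgP H1)|exact: (usum_cvgP H2)].
Qed.

Lemma uprodU F M1 M2 : fin_bounded D1 (fun t => F t - 1) M1 ->
  fin_bounded D2 (fun t => F t - 1) M2 ->
  uprod (D1 `|` D2) F = uprod D1 F * uprod D2 F.
Proof.
move=> H1 H2; apply: cvg_lim => //.
rewrite (_ : (fun A : {fset R} => _) = (fun A : {fset R} => \prod_(t <- A | t \in D1) F t *
  \prod_(t <- A | t \in D2) F t)); last by apply/funext => A; rewrite big_setU.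
by apply: cvgM; [exact: (uprod_cvgP H1)|exact: (uprod_cvgP H2)].
Qed.

End splitting.

Lemma in_set1E (t r : R) : (t \in [set r]%classic) = (t == r).
Proof. by apply/idP/eqP => [/set_mem //|->]; exact/mem_set. Qed.

Lemma big_set1 (T : Type) (idx : T) (op : Monoid.com_law idx) A r (F : R -> T) :
  ([fset r] `<=` A)%fset -> \big[op/idx]_(t <- A | t \in [set r]%classic) F t = F r.
Proof.
move=> sub; rewrite (perm_big _ (fset_perm sub)) big_cat /= big_mkcond big_seq_fset1.
rewrite in_set1E eqxx big_seq_cond big1 ?Monoid.mulm1 // => t.
by rewrite in_fsetD in_fset1 in_set1E => /andP[/andP[/negbTE->]].
Qed.

Lemma usum1 c r : usum [set r] c = c r.
Proof.
apply: usum_cvg_unique; apply: cvg_near_cst; apply: (@near_totP _ [fset r]%fset) => A sub.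
exact: big_set1.
Qed.

Lemma uprod1 F r : uprod [set r] F = F r.
Proof.
apply: cvg_lim => //; apply: cvg_near_cst; apply: (@near_totP _ [fset r]%fset) => A sub.
exact: big_set1.
Qed.

Lemma usum0 c : usum set0 c = 0.
Proof.
apply: usum_cvg_unique; apply: cvg_near_cst; apply: (@near_totP _ fset0) => A _.
by rewrite big1 // => t; rewrite in_set0.
Qed.

Lemma uprod0 F : uprod set0 F = 1.
Proof.
apply: cvg_lim => //; apply: cvg_near_cst; apply: (@near_totP _ fset0) => A _.
by rewrite big1 // => t; rewrite in_set0.
Qed.

Lemma fin_bounded1 r c : fin_bounded [set r] c `|c r|.
Proof.
move=> A; have [rA|rA] := boolP (r \in A); first by rewrite big_set1 // fsub1set.
rewrite big_seq_cond big1 // => t; rewrite in_set1E => /andP[tA /eqP tr].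
by move: rA; rewrite -tr tA.
Qed.

Lemma sum_sub (A : seq R) (P Q : pred R) c : (forall z, z \in A -> P z -> Q z) ->
  \sum_(z <- A | P z) `|c z| <= \sum_(z <- A | Q z) `|c z|.
Proof.
move=> H; rewrite big_seq_cond [leRHS]big_seq_cond big_mkcond [leRHS]big_mkcond.
apply: ler_sum => z _; case: ifP => [/andP[zA Pz]|_]; first by rewrite zA H.
by case: ifP.
Qed.

Lemma mono_le_lft W x r : {homo W : x y / x <= y} -> x < r -> W x <= lft W r.
Proof.
move=> mW xr; apply: limr_ge; first by apply/cvg_ex; eexists; exact: mono_lft.
by apply/near_leftP; exists x => // y /andP[/ltW /mW].
Qed.

Lemma mono_ge_rgt W y r : {homo W : x y / x <= y} -> r < y -> rgt W r <= W y.
Proof.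
move=> mW xr; apply: limr_le; first by apply/cvg_ex; eexists; exact: mono_rgt.
by apply/near_rightP; exists y => // x /andP[_ /ltW /mW].
Qed.

(** A joint bound on two families is sharper than the sum of two separate bounds: left and
    right jumps together are bounded by one increment. *)
Lemma usum_pair_le D1 D2 c1 c2 M : (forall A,
    \sum_(z <- A | z \in D1) `|c1 z| + \sum_(z <- A | z \in D2) `|c2 z| <= M) ->
  `|usum D1 c1| + `|usum D2 c2| <= M.
Proof.
move=> H; have H1 : fin_bounded D1 c1 M.
  by move=> A; apply: le_trans (H A); rewrite lerDl sumr_ge0.
have H2 : fin_bounded D2 c2 M.
  by move=> A; apply: le_trans (H A); rewrite lerDr sumr_ge0.
apply: (tot_le (f := fun A : {fset R} => `|\sum_(z <- A | z \in D1) c1 z| + `|\sum_(z <- A | z \in D2) c2 z|)).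
  by apply: cvgD; apply: cvg_norm; [exact: (usum_cvgP H1)|exact: (usum_cvgP H2)].
by move=> A; apply: le_trans (H A); apply: lerD; exact: ler_norm_sum.
Qed.

Lemma uprod_pair_le D1 D2 F1 F2 M : (forall A,
    \sum_(z <- A | z \in D1) `|F1 z - 1| + \sum_(z <- A | z \in D2) `|F2 z - 1| <= M) ->
  `|uprod D1 F1 * uprod D2 F2 - 1| <= expR M - 1.
Proof.
move=> H; have H1 : fin_bounded D1 (fun t => F1 t - 1) M.
  by move=> A; apply: le_trans (H A); rewrite lerDl sumr_ge0.
have H2 : fin_bounded D2 (fun t => F2 t - 1) M.
  by move=> A; apply: le_trans (H A); rewrite lerDr sumr_ge0.
apply: (tot_le (f := fun A : {fset R} => `|(\prod_(z <- A | z \in D1) F1 z) * (\prod_(z <- A | z \in D2) F2 z) - 1|)).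
  apply: cvg_norm; apply: cvgB; last exact: cvg_cst.
  by apply: cvgM; [exact: (uprod_cvgP H1)|exact: (uprod_cvgP H2)].
move=> A; have h := H A.
have h1 := prod_bound A (fun z => z \in D1) F1.
have h2 := prod_dist1 A (fun z => z \in D1) F1.
have h3 := prod_dist1 A (fun z => z \in D2) F2.
set X := \prod_(_ <- _ | _) _ in h1 h2 *; set Y := \prod_(_ <- _ | _) _ in h3 *.
set s := \sum_(_ <- _ | _) _ in h h1 h2; set s' := \sum_(_ <- _ | _) _ in h h3.
have -> : X * Y - 1 = X * (Y - 1) + (X - 1) by ring.
apply: (le_trans (ler_normD _ _)); rewrite normrM.
apply: (@le_trans _ _ (expR (s + s') - 1)); last by rewrite lerD2r ler_expR.
have h4 : `|X| * `|Y - 1| <= expR s * (expR s' - 1) by apply: ler_pM.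
rewrite expRD; lra.
Qed.

Lemma fin_gap_left (A : seq R) r : exists2 u, u < r & forall x, x \in A -> u < x -> r <= x.
Proof.
elim: A => [|y A [u ur IH]]; first by exists (r - 1) => //; rewrite gtrBl.
exists (if y < r then Num.max u y else u) => [|x]; first by case: ifP => // yr; rewrite gt_max ur.
rewrite inE => /orP[/eqP->|xA]; first by have [yr|//] := ltP y r; rewrite gt_max ltxx andbF.
by case: ifP => _; rewrite ?gt_max; first case/andP; move=> *; exact: IH.
Qed.

Lemma fin_gap_right (A : seq R) r : exists2 u, r < u & forall x, x \in A -> x < u -> x <= r.
Proof.
elim: A => [|y A [u ur IH]]; first by exists (r + 1) => //; rewrite ltrDl.
exists (if r < y then Num.min u y else u) => [|x]; first by case: ifP => // yr; rewrite lt_min ur.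
rewrite inE => /orP[/eqP->|xA]; first by have [yr|//] := ltP r y; rewrite lt_min ltxx andbF.
by case: ifP => _; rewrite ?lt_min; first case/andP; move=> *; exact: IH.
Qed.

End finite_sums.

(** * Pure jump functions and jump products *)

Section jump_sums.
Context {R : realType} (a b : R).
Implicit Types (A : {fset R}) (W cd cu F H : R -> R) (s t r x y M : R).

(** The bound is additive over adjacent intervals, because the left jumps of ]s, t] and the
    right jumps of [s, t[ split exactly at an intermediate point. *)
Definition tail_bound cd cu W := forall s t, a <= s -> s < t -> t <= b -> forall A,
  \sum_(z <- A | z \in `]s, t]%classic) `|cd z| +
  \sum_(z <- A | z \in `[s, t[%classic) `|cu z| <= W t - W s.

Lemma in_oc s t z : (z \in `]s, t]%classic) = (s < z <= t).
Proof. by rewrite mem_setE in_itv. Qed.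

Lemma in_co s t z : (z \in `[s, t[%classic) = (s <= z < t).
Proof. by rewrite mem_setE in_itv. Qed.

Lemma in_oo s t z : (z \in `]s, t[%classic) = (s < z < t).
Proof. by rewrite mem_setE in_itv. Qed.

Lemma oc_split s r t : s <= r -> r <= t ->
  (`]s, t] = `]s, r] `|` `]r, t])%classic.
Proof.
move=> sr rt; apply/seteqP; split=> z /=; rewrite !in_itv /=.
  by move=> /andP[sz zt]; have [zr|rz] := leP z r; [left; rewrite sz|right; rewrite zt].
move=> [/andP[sz zr]|/andP[rz zt]]; first by rewrite sz (le_trans zr).
by rewrite (le_lt_trans sr).
Qed.

Lemma co_split s r t : s <= r -> r <= t ->
  (`[s, t[ = `[s, r[ `|` `[r, t[)%classic.
Proof.
move=> sr rt; apply/seteqP; split=> z /=; rewrite !in_itv /=.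
  by move=> /andP[sz zt]; have [zr|rz] := ltP z r; [left; rewrite sz|right; rewrite zt].
move=> [/andP[sz zr]|/andP[rz zt]]; first by rewrite sz (lt_le_trans zr).
by rewrite (le_trans sr).
Qed.

Lemma oc_last s t : s < t -> (`]s, t] = `]s, t[ `|` [set t])%classic.
Proof.
move=> st; apply/seteqP; split=> z /=; rewrite !in_itv /=.
  by rewrite le_eqVlt => /andP[sz /orP[/eqP->|zt]]; [right|left; rewrite sz].
by move=> [/andP[-> /ltW ->]//|->]; rewrite st lexx.
Qed.

Lemma co_first s t : s < t -> (`[s, t[ = [set s] `|` `]s, t[)%classic.
Proof.
move=> st; apply/seteqP; split=> z /=; rewrite !in_itv /=.
  by rewrite le_eqVlt => /andP[/orP[/eqP->|sz] zt]; [left|right; rewrite sz].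
by move=> [->|/andP[/ltW -> ->]//]; rewrite st lexx.
Qed.

Lemma oc_disj s r t z : `]s, r]%classic z -> `]r, t]%classic z -> False.
Proof. by rewrite /= !in_itv /= => /andP[_ zr] /andP[]; rewrite ltNge zr. Qed.

Lemma co_disj s r t z : `[s, r[%classic z -> `[r, t[%classic z -> False.
Proof. by rewrite /= !in_itv /= => /andP[_ zr] /andP[]; rewrite leNgt zr. Qed.

(** Finitely many points leave a gap on both sides of [r], so that near [r] only the jump at
    [r] itself is summed; these bounds are glued. *)
Lemma jump_tail_bound cd cu W : {homo W : x y / x <= y} ->
  (forall r, a < r <= b -> exists2 u, u < r & forall x, u < x < r -> a <= x ->
     `|cd r| <= W r - W x) ->
  (forall r, a <= r < b -> exists2 u, r < u & forall y, r < y < u -> y <= b ->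
     `|cu r| <= W y - W r) ->
  tail_bound cd cu W.
Proof.
move=> mW HL HR s t as_ st tb A; move: s t as_ st tb.
apply: local_to_global.
- move=> s r t _ sr rt _ h1 h2.
  rewrite (oc_split (ltW sr) (ltW rt)) (co_split (ltW sr) (ltW rt)).
  by rewrite (big_setU (@oc_disj s r t)) (big_setU (@co_disj s r t)) /=; lra.
- move=> r h; have [u ur Hu] := HL r h; have [v vr Hv] := fin_gap_left A r.
  exists (Num.max u v) => [|s]; first by rewrite gt_max ur.
  rewrite gt_max => /andP[/andP[us vs] sr] as_.
  rewrite [X in _ + X]big1_seq ?addr0; last first.
    move=> z /andP[]; rewrite in_co => /andP[sz zr] zA.
    by have := Hv z zA (lt_le_trans vs sz); rewrite leNgt zr.
  apply: (@le_trans _ _ `|cd r|); last by apply: Hu as_; rewrite us.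
  apply: le_trans (fin_bounded1 r cd A); apply: sum_sub => z zA.
  rewrite in_oc in_set1E => /andP[sz zr].
  by rewrite eq_le zr (Hv z zA) // (lt_trans vs).
- move=> r h; have [u ur Hu] := HR r h; have [v vr Hv] := fin_gap_right A r.
  exists (Num.min u v) => [|t]; first by rewrite lt_min ur.
  rewrite lt_min => /andP[rt /andP[tu tv]] tb.
  rewrite [X in X + _]big1_seq ?add0r; last first.
    move=> z /andP[]; rewrite in_oc => /andP[rz zt] zA.
    by have := Hv z zA (le_lt_trans zt tv); rewrite leNgt rz.
  apply: (@le_trans _ _ `|cu r|); last by apply: Hu tb; rewrite rt.
  apply: le_trans (fin_bounded1 r cu A); apply: sum_sub => z zA.
  rewrite in_co in_set1E => /andP[rz zt].
  by rewrite eq_le rz (Hv z zA) // (lt_trans zt).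
Qed.

Section with_bound.
Variables (cd cu W : R -> R).
Hypotheses (mW : {homo W : x y / x <= y}) (tb : tail_bound cd cu W).

Lemma tail_boundW s t A : a <= s -> s <= t -> t <= b ->
  \sum_(z <- A | z \in `]s, t]%classic) `|cd z| +
  \sum_(z <- A | z \in `[s, t[%classic) `|cu z| <= W t - W s.
Proof.
move=> as_; rewrite le_eqVlt => /orP[/eqP<- _|st tb']; last exact: tb.
rewrite !big1 ?subrr ?addr0 // => z; rewrite ?in_oc ?in_co => /andP[].
  by move=> h1 h2; move: h2; rewrite ltNge h1.
by move=> h1 h2; move: h1; rewrite ltNge h2.
Qed.

Lemma fin_bounded_oc s t : a <= s -> s <= t -> t <= b ->
  fin_bounded `]s, t]%classic cd (W t - W s).
Proof.
move=> as_ st tb' A; apply: le_trans (tail_boundW A as_ st tb').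
by rewrite lerDl sumr_ge0.
Qed.

Lemma fin_bounded_co s t : a <= s -> s <= t -> t <= b ->
  fin_bounded `[s, t[%classic cu (W t - W s).
Proof.
move=> as_ st tb' A; apply: le_trans (tail_boundW A as_ st tb').
by rewrite lerDr sumr_ge0.
Qed.

(** The finitely many points of the open interval stay away from [r], hence the left limit
    of [W] suffices. *)
Lemma tail_left x r A : a <= x -> x < r -> r <= b ->
  \sum_(z <- A | z \in `]x, r[%classic) `|cd z| +
  \sum_(z <- A | z \in `[x, r[%classic) `|cu z| <= lft W r - W x.
Proof.
move=> ax xr rb; have [v vr Hv] := fin_gap_left A r.
pose y := (Num.max x v + r) / 2.
have [xm vm] : x <= Num.max x v /\ v <= Num.max x v by rewrite !le_max !lexx orbT.
have mr : Num.max x v < r by rewrite gt_max xr.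
have [xy [vy yr]] : x < y /\ v < y /\ y < r by rewrite /y; split; [lra|split; lra].
apply: (@le_trans _ _ (W y - W x)); last by rewrite lerD2r mono_le_lft.
apply: le_trans (tb _ xy _ A) => //; last exact: le_trans (ltW yr) rb.
apply: lerD; apply: sum_sub => z zA; rewrite ?in_oo ?in_oc ?in_co => /andP[-> zr] /=.
  by apply: ltW; apply: le_lt_trans vy; rewrite leNgt; apply/negP => /(Hv z zA); rewrite leNgt zr.
by apply: le_lt_trans vy; rewrite leNgt; apply/negP => /(Hv z zA); rewrite leNgt zr.
Qed.

Lemma tail_right r y A : a <= r -> r < y -> y <= b ->
  \sum_(z <- A | z \in `]r, y]%classic) `|cd z| +
  \sum_(z <- A | z \in `]r, y[%classic) `|cu z| <= W y - rgt W r.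
Proof.
move=> ar ry yb; have [v vr Hv] := fin_gap_right A r.
pose x := (Num.min y v + r) / 2.
have [xm vm] : Num.min y v <= y /\ Num.min y v <= v by rewrite !ge_min !lexx orbT.
have mr : r < Num.min y v by rewrite lt_min ry.
have [xy [vy yr]] : x < y /\ x < v /\ r < x by rewrite /x; split; [lra|split; lra].
apply: (@le_trans _ _ (W y - W x)); last by rewrite lerD2l lerN2 mono_ge_rgt.
apply: le_trans (tb _ xy yb A); last exact: le_trans ar (ltW yr).
apply: lerD; apply: sum_sub => z zA; rewrite ?in_oo ?in_oc ?in_co => /andP[rz ->]; rewrite andbT.
  by apply: lt_le_trans vy _; rewrite leNgt; apply/negP => /(Hv z zA); rewrite leNgt rz.
by apply: ltW; apply: lt_le_trans vy _; rewrite leNgt; apply/negP => /(Hv z zA); rewrite leNgt rz.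
Qed.

(** The pure jump function with left jumps [cd] and right jumps [cu]. *)
Definition jump_fun t := usum `]a, t]%classic cd + usum `[a, t[%classic cu.

Lemma jump_fun_inc s t : a <= s -> s <= t -> t <= b ->
  jump_fun t - jump_fun s = usum `]s, t]%classic cd + usum `[s, t[%classic cu.
Proof.
move=> as_ st tb'; have at_ := le_trans as_ st; have sb := le_trans st tb'.
rewrite /jump_fun (oc_split as_ st) (co_split as_ st).
rewrite (usumU (@oc_disj a s t) (fin_bounded_oc (lexx a) as_ sb) (fin_bounded_oc as_ st tb')).
rewrite (usumU (@co_disj a s t) (fin_bounded_co (lexx a) as_ sb) (fin_bounded_co as_ st tb')).
ring.
Qed.

Lemma jump_fun_inc_le s t : a <= s -> s <= t -> t <= b ->
  `|jump_fun t - jump_fun s| <= W t - W s.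
Proof.
move=> as_ st tb'; rewrite jump_fun_inc //; apply: (le_trans (ler_normD _ _)).
by apply: usum_pair_le => A; exact: tail_boundW.
Qed.

Lemma jump_fun_left r : a < r <= b -> jump_fun x @[x --> r^'-] --> jump_fun r - cd r.
Proof.
move=> /andP[ar rb]; apply/left_cvgP => e e0.
have [u ur Hu] := (left_cvgP _ _ _).1 (mono_lft (r:=r) mW) e e0.
exists (Num.max a u) => [|x]; first by rewrite gt_max ar.
rewrite gt_max => /andP[/andP[/ltW ax ux] xr].
have hx := jump_fun_inc ax (ltW xr) rb.
have fb1 : fin_bounded `]x, r[%classic cd (W r - W x).
  by apply: fin_bounded_sub (fin_bounded_oc ax (ltW xr) rb); rewrite (oc_last xr); exact: subsetUl.
rewrite (oc_last xr) (usumU _ fb1 (fin_bounded1 _ _)) ?usum1 in hx; last first.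
  by move=> z /=; rewrite in_itv /= => /andP[_ zr] zr'; rewrite zr' ltxx in zr.
have -> : jump_fun x - (jump_fun r - cd r) = - (usum `]x, r[%classic cd + usum `[x, r[%classic cu).
  by rewrite -[jump_fun r](subrK (jump_fun x)) hx; ring.
rewrite normrN; apply: (le_trans (ler_normD _ _)); apply: (@le_trans _ _ (lft W r - W x)).
  by apply: usum_pair_le => A; exact: tail_left.
have := Hu x; rewrite ux xr => /(_ isT); rewrite distrC; apply: le_trans; exact: ler_norm.
Qed.

Lemma jump_fun_right r : a <= r < b -> jump_fun y @[y --> r^'+] --> jump_fun r + cu r.
Proof.
move=> /andP[ar rb]; apply/right_cvgP => e e0.
have [u ur Hu] := (right_cvgP _ _ _).1 (mono_rgt (r:=r) mW) e e0.
exists (Num.min b u) => [|x]; first by rewrite lt_min rb.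
rewrite lt_min => /andP[rx /andP[/ltW xb xu]].
have hx := jump_fun_inc ar (ltW rx) xb.
have fb1 : fin_bounded `]r, x[%classic cu (W x - W r).
  by apply: fin_bounded_sub (fin_bounded_co ar (ltW rx) xb); rewrite (co_first rx); exact: subsetUr.
rewrite (co_first rx) (usumU _ (fin_bounded1 _ _) fb1) ?usum1 in hx; last first.
  by move=> z /= ->; rewrite in_itv /= ltxx.
have -> : jump_fun x - (jump_fun r + cu r) = usum `]r, x]%classic cd + usum `]r, x[%classic cu.
  by rewrite -[jump_fun x](subrK (jump_fun r)) hx; ring.
apply: (le_trans (ler_normD _ _)); apply: (@le_trans _ _ (W x - rgt W r)).
  by apply: usum_pair_le => A; exact: tail_right.
by have := Hu x; rewrite xu rx => /(_ isT); apply: le_trans; exact: ler_norm.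
Qed.

Lemma jump_fun_regulated : regulated a b jump_fun.
Proof.
by split=> r h; apply/cvg_ex; eexists; [exact: jump_fun_left|exact: jump_fun_right].
Qed.

Lemma djump_jump_fun r : a < r <= b -> djump jump_fun r = cd r.
Proof. by move=> h; rewrite /djump (lft_eq (jump_fun_left h)); ring. Qed.

Lemma ujump_jump_fun r : a <= r < b -> ujump jump_fun r = cu r.
Proof. by move=> h; rewrite /ujump (rgt_eq (jump_fun_right h)); ring. Qed.

End with_bound.

Section products.
Variables (F H W : R -> R).
Hypotheses (mW : {homo W : x y / x <= y}).
Hypothesis (tb : tail_bound (fun t => F t - 1) (fun t => H t - 1) W).

Definition jump_prod x y := uprod `]x, y]%classic F * uprod `[x, y[%classic H.

Lemma jump_prod_mul x y z : a <= x -> x <= y -> y <= z -> z <= b ->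
  jump_prod x z = jump_prod x y * jump_prod y z.
Proof.
move=> ax xy yz zb; have ay := le_trans ax xy; have yb := le_trans yz zb.
rewrite /jump_prod (oc_split xy yz) (co_split xy yz).
rewrite (uprodU (@oc_disj x y z) (fin_bounded_oc tb ax xy yb) (fin_bounded_oc tb ay yz zb)).
rewrite (uprodU (@co_disj x y z) (fin_bounded_co tb ax xy yb) (fin_bounded_co tb ay yz zb)).
ring.
Qed.

Lemma jump_prod_dist1 x y : a <= x -> x <= y -> y <= b ->
  `|jump_prod x y - 1| <= expR (W y - W x) - 1.
Proof. by move=> ax xy yb; apply: uprod_pair_le => A; exact: tail_boundW. Qed.

Lemma jump_prod_left r : a < r <= b -> jump_prod x r @[x --> r^'-] --> F r.
Proof.
move=> /andP[ar rb].
suff c : (fun x => F r * (uprod `]x, r[%classic F * uprod `[x, r[%classic H)) x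
     @[x --> r^'-] --> F r * 1.
  rewrite mulr1 in c; apply: cvg_trans c; apply: near_eq_cvg; apply/near_leftP.
  exists a => // x /andP[ax xr].
  have fb1 : fin_bounded `]x, r[%classic (fun t => F t - 1) (W r - W x).
    apply: fin_bounded_sub (fin_bounded_oc tb (ltW ax) (ltW xr) rb).
    by rewrite (oc_last xr); exact: subsetUl.
  rewrite /jump_prod (oc_last xr) (uprodU _ fb1 (fin_bounded1 _ _)) ?uprod1; first by ring.
  by move=> z /=; rewrite in_itv /= => /andP[_ zr] zr'; rewrite zr' ltxx in zr.
apply: cvgM; first exact: cvg_cst.
have c : (expR (lft W r - W x)) @[x --> r^'-] --> expR 0.
  apply: continuous_cvg; first exact: continuous_expR.
  by rewrite -[X in _ --> X](subrr (lft W r)); apply: cvgB; [exact: cvg_cst|exact: mono_lft].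
rewrite expR0 in c; apply/left_cvgP => e e0.
have [u ur Hu] := (left_cvgP _ _ _).1 c e e0.
exists (Num.max a u) => [|x]; first by rewrite gt_max ar.
rewrite gt_max => /andP[/andP[/ltW ax ux] xr].
apply: (@le_trans _ _ (expR (lft W r - W x) - 1)).
  by apply: uprod_pair_le => A; exact: tail_left.
by have := Hu x; rewrite ux xr => /(_ isT); apply: le_trans; exact: ler_norm.
Qed.

Lemma jump_prod_right r : a <= r < b -> jump_prod r y @[y --> r^'+] --> H r.
Proof.
move=> /andP[ar rb].
suff c : (fun x => H r * (uprod `]r, x]%classic F * uprod `]r, x[%classic H)) x
     @[x --> r^'+] --> H r * 1.
  rewrite mulr1 in c; apply: cvg_trans c; apply: near_eq_cvg; apply/near_rightP.
  exists b => // x /andP[rx xb].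
  have fb1 : fin_bounded `]r, x[%classic (fun t => H t - 1) (W x - W r).
    apply: fin_bounded_sub (fin_bounded_co tb ar (ltW rx) (ltW xb)).
    by rewrite (co_first rx); exact: subsetUr.
  rewrite /jump_prod (co_first rx) (uprodU _ (fin_bounded1 _ _) fb1) ?uprod1; first by ring.
  by move=> z /= ->; rewrite in_itv /= ltxx.
apply: cvgM; first exact: cvg_cst.
have c : (expR (W x - rgt W r)) @[x --> r^'+] --> expR 0.
  apply: continuous_cvg; first exact: continuous_expR.
  by rewrite -[X in _ --> X](subrr (rgt W r)); apply: cvgB; [exact: mono_rgt|exact: cvg_cst].
rewrite expR0 in c; apply/right_cvgP => e e0.
have [u ur Hu] := (right_cvgP _ _ _).1 c e e0.
exists (Num.min b u) => [|x]; first by rewrite lt_min rb.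
rewrite lt_min => /andP[rx /andP[/ltW xb xu]].
apply: (@le_trans _ _ (expR (W x - rgt W r) - 1)).
  by apply: uprod_pair_le => A; exact: tail_right.
by have := Hu x; rewrite rx xu => /(_ isT); apply: le_trans; exact: ler_norm.
Qed.

End products.

End jump_sums.

(** * Step functions and refinement integrals *)

Section approximation.
Context {R : realType}.

(** A net that is uniformly close to convergent ones is Cauchy. *)
Lemma approx_cvg (T : Type) (F : set_system T) {FF : ProperFilter F} (f : T -> R) :
  (forall e, 0 < e -> exists g l, g @ F --> (l : R) /\ forall x, `|f x - g x| <= e) ->
  cvg (f @ F).
Proof.
move=> H; apply: cauchy_cvg; apply: cauchy_exP => e e0.
have [|g [l [gl fg]]] := H (e / 3); first by rewrite divr_gt0.
exists l; have /cvgrPdist_le /(_ (e / 3)) := gl.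
move=> /(_ ltac:(rewrite divr_gt0//)); apply: filterS => x h.
rewrite /ball /=; have := ler_distD (g x) l (f x); have := fg x; have := distrC (g x) (f x); lra.
Qed.

Lemma approx_lim (T : Type) (F : set_system T) {FF : ProperFilter F} (f g : T -> R) l k e :
  f @ F --> l -> g @ F --> k -> (forall x, `|f x - g x| <= e) -> `|l - k| <= e.
Proof.
move=> fl gk fg; have c : (fun x => `|f x - g x|) @ F --> `|l - k|.
  by apply: cvg_norm; exact: cvgB.
rewrite -(cvg_lim _ c) //; apply: limr_le; first by apply/cvg_ex; eexists; exact: c.
exact: nearW.
Qed.

End approximation.

Section step_functions.
Context {R : realType}.
Implicit Types (a b c e r s t x y z : R) (K S phi : R -> R).

(** Both kinds of indicators are needed, because the value of a regulated function at a
    jump is unrelated to its one-sided limits. *)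
Inductive step_fun : (R -> R) -> Prop :=
| stepf_cst c : step_fun (fun=> c)
| stepf_ge S c z : step_fun S -> step_fun (fun x => S x + c * (z <= x)%R%:R)
| stepf_gt S c z : step_fun S -> step_fun (fun x => S x + c * (z < x)%R%:R).

(** The argument is held constant on each small interval.  In the form [K] composed
    with a nondecreasing [phi] the approximation inherits all controls of [K]. *)
Lemma step_approx a b K e : a < b -> regulated a b K -> 0 < e ->
  exists phi S, [/\ step_fun S,
    forall x y, a <= x -> x <= y -> y <= b -> phi x <= phi y &
    forall x, a <= x <= b -> [/\ a <= phi x <= b, `|K (phi x) - K x| <= e & K (phi x) = S x]].
Proof.
move=> ab rK e0.
pose Q t := exists phi S, [/\ step_fun S, phi t = t,
    forall x y, a <= x -> x <= y -> y <= t -> phi x <= phi y,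
    forall x, a <= x <= t -> [/\ a <= phi x <= t, `|K (phi x) - K x| <= e & K (phi x) = S x] &
    forall x, t <= x -> S x = K t].
have ext s t : a <= s -> s < t -> Q s ->
    (forall x y, s < x < t -> s < y < t -> `|K y - K x| <= e) -> Q t.
  (* K is evaluated at the midpoint on the open interval and keeps its value at t *)
  move=> as_ st [phi [S [stS ps pm pP Se]]] osc; pose m := (s + t) / 2.
  have [sm mt] : s < m /\ m < t by rewrite /m; split; lra.
  exists (fun x => if x <= s then phi x else if x < t then m else t).
  exists (fun x => (S x + (K m - K s) * (s < x)%R%:R) + (K t - K m) * (t <= x)%R%:R).
  split.
  - by do 2 constructor.
  - by rewrite leNgt st ltxx.
  - move=> x y ax xy yt; have [ys|sy] := leP y s.
      by rewrite (le_trans xy ys) pm.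
    have [xs|sx] := leP x s.
      have /andP[_ ps'] : a <= phi x <= s by case: (pP x _) => //; rewrite ax.
      by case: ltP => _; apply: (le_trans ps'); apply: ltW => //; exact: lt_trans st.
    have [yt'|ty] := ltP y t; first by rewrite (le_lt_trans xy yt') lexx.
    by case: ltP => // _; exact: ltW.
  - move=> x /andP[ax xt]; have [xs|sx] := leP x s.
      have [/andP[h1 h2] h3 h4] : [/\ a <= phi x <= s, `|K (phi x) - K x| <= e & K (phi x) = S x].
        by apply: pP; rewrite ax.
      rewrite h1 (le_trans h2 (ltW st)) h3 [t <= x]leNgt (le_lt_trans xs st) /= !mulr0 !addr0.
      by split.
    rewrite (Se x (ltW sx)) mulr1; have [xt'|tx] := ltP x t.
      rewrite (le_trans as_ (ltW sm)) (ltW mt); split => //; last by rewrite /=; ring.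
      by apply: osc; rewrite ?sx ?sm.
    have -> : x = t by apply/le_anti; rewrite xt tx.
    by rewrite (le_trans as_ (ltW st)) lexx subrr normr0 (ltW e0); split=> //=; ring.
  - move=> x tx; have sx := lt_le_trans st tx.
    by rewrite (Se x (ltW sx)) sx tx /=; ring.
have Qa : Q a.
  exists id, (fun=> K a); split=> //; first exact: stepf_cst.
  move=> x /andP[ax xa]; have -> : x = a by apply/le_anti; rewrite ax xa.
  by rewrite lexx subrr normr0 ltW.
have e2 : 0 < e / 2 by rewrite divr_gt0.
have osc l x y : `|K x - l| <= e / 2 -> `|K y - l| <= e / 2 -> `|K y - K x| <= e.
  by move=> h1 h2; have := ler_distD l (K y) (K x); have := distrC l (K x); lra.
have := @real_induction R a b Q (ltW ab) Qa _ _ b; case.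
- move=> t h Qt; have [u ur Hu] := (right_cvgP _ _ _).1 (reg_rgt rK h) _ e2.
  exists u => // v /andP[tv vu] vb; apply: ext Qt _ => //; first by case/andP: h.
  move=> x y /andP[tx xv] /andP[ty yv]; apply: (osc (rgt K t)); apply: Hu.
    by rewrite tx (lt_trans xv).
  by rewrite ty (lt_trans yv).
- move=> t h; have [u ur Hu] := (left_cvgP _ _ _).1 (reg_lft rK h) _ e2.
  exists u => // v /andP[uv vt] av Qv; apply: ext Qv _ => //.
  move=> x y /andP[tx xv] /andP[ty yv]; apply: (osc (lft K t)); apply: Hu.
    by rewrite xv (lt_trans uv).
  by rewrite yv (lt_trans uv).
- by rewrite lexx ltW.
- by move=> phi [S [stS _ pm pP _]]; exists phi, S; split.
Qed.

End step_functions.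

Section refinement_integral.
Context {R : realType}.
Implicit Types (G h : R -> R) (u v x y z c I : R) (xs ks : seq R) (tag : nat -> R).

Definition rsum G h u xs tag :=
  \sum_(0 <= i < size xs) G (tag i) * (h (ppt u xs i.+1) - h (ppt u xs i)).

Lemma rsum_cons G h u x xs tag :
  rsum G h u (x :: xs) tag = G (tag 0%N) * (h x - h u) + rsum G h x xs (fun i => tag i.+1).
Proof.
rewrite /rsum /ppt /= big_nat_recl //=; congr (_ + _).
apply: eq_big_nat => i /andP[_ ix].
by rewrite (set_nth_default x) ?(set_nth_default x u) //= ltnS ltnW.
Qed.

Definition tagged u xs tag :=
  forall i, (i < size xs)%N -> ppt u xs i <= tag i <= ppt u xs i.+1.

Lemma tagged_cons u x xs tag : tagged u (x :: xs) tag ->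
  u <= tag 0%N <= x /\ tagged x xs (fun i => tag i.+1).
Proof.
move=> H; split; first by have := H 0%N isT.
move=> i ix; have := H i.+1 ix; rewrite /ppt /=.
by rewrite (set_nth_default x) ?(set_nth_default x u) //= ltnS ltnW.
Qed.

Lemma partition_through u v (A : seq R) : u < v ->
  exists2 ks, itv_partition u v ks & forall x, x \in A -> u < x <= v -> x \in ks.
Proof.
move=> uv; pose ks := sort <=%R (undup [seq x <- v :: A | u < x <= v]).
have memk x : (x \in ks) = (x \in v :: A) && (u < x <= v).
  by rewrite mem_sort mem_undup mem_filter andbC.
exists ks; last by move=> x xA h; rewrite memk inE xA orbT h.
have sk : sorted <%R ks by rewrite lt_sorted_uniq_le sort_uniq undup_uniq sort_le_sorted.
have pk : path <%R u ks.
  by rewrite lt_path_sortedE sk andbT; apply/allP => x; rewrite memk => /andP[_ /andP[]].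
split=> //; have vk : v \in ks by rewrite memk mem_head uv lexx.
rewrite eq_le (last_ge pk vk) andbT.
have [->|] := last_in u ks; first exact: ltW.
by rewrite memk => /andP[_ /andP[]].
Qed.

Lemma partition_ppt u v xs i : itv_partition u v xs -> (i <= size xs)%N ->
  u <= ppt u xs i <= v.
Proof.
move=> [pxs /eqP lxs] ix; rewrite /ppt; case: i ix => [|i] ix /=.
  by rewrite lexx -lxs path_le_last.
have m : nth u xs i \in xs by apply: mem_nth.
have := last_ge pxs m; rewrite lxs => ->; rewrite andbT ltW //.
by move: pxs; rewrite lt_path_sortedE => /andP[/allP /(_ _ m)].
Qed.

Lemma tagged_in u v xs tag i : itv_partition u v xs -> tagged u xs tag ->
  (i < size xs)%N -> u <= tag i <= v.
Proof.
move=> pxs txs ix; have /andP[h1 h2] := txs i ix.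
have /andP[h3 _] := partition_ppt pxs (ltnW ix); have /andP[_ h4] := partition_ppt pxs ix.
by rewrite (le_trans h3 h1) (le_trans h2 h4).
Qed.

Lemma eq_rsum G G' h h' u v xs tag : itv_partition u v xs -> tagged u xs tag ->
  (forall x, u <= x <= v -> G x = G' x) -> (forall x, u <= x <= v -> h x = h' x) ->
  rsum G h u xs tag = rsum G' h' u xs tag.
Proof.
move=> pxs txs eG eh; apply: eq_big_nat => i /andP[_ ix].
rewrite eG ?eh ?(tagged_in pxs txs) ?(partition_ppt pxs) //; exact: ltnW.
Qed.

Lemma is_RRS_unique G h u v I I' : u < v -> is_RRS G h u v I -> is_RRS G h u v I' -> I = I'.
Proof.
move=> uv H H'; apply/eqP; rewrite -subr_eq0 -normr_le0; apply/ler_addgt0Pl => e e0.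
have e2 : 0 < e / 2 by rewrite divr_gt0.
have [ks pk Hk] := H _ e2; have [ks' pk' Hk'] := H' _ e2.
have [xs pxs sub] := partition_through (ks ++ ks') uv.
have kin (k : seq R) x : itv_partition u v k -> x \in k -> u < x <= v.
  move=> [pk0 /eqP lk] xk; rewrite -lk (last_ge pk0 xk) andbT.
  by move: pk0; rewrite lt_path_sortedE => /andP[/allP /(_ _ xk)].
have txs : tagged u xs (fun i => ppt u xs i.+1).
  move=> i ix; rewrite lexx andbT; apply: ltW; rewrite /ppt /=.
  by case: pxs => /(pathP u)/(_ i ix).
have h1 := Hk xs _ pxs (fun x xk => sub x ltac:(by rewrite mem_cat xk) (kin _ _ pk xk)) txs.
have h2 := Hk' xs _ pxs (fun x xk => sub x ltac:(by rewrite mem_cat xk orbT) (kin _ _ pk' xk)) txs.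
rewrite addr0 ; move: h1 h2; rewrite -![\sum_(_ <= _ < _) _]/(rsum G h u xs _).
set T := rsum _ _ _ _ _ => h1 h2.
have := ler_distD T I I'; have := distrC I T; lra.
Qed.

Lemma eq_is_RRS G G' h h' u v I :
  (forall x, u <= x <= v -> G x = G' x) -> (forall x, u <= x <= v -> h x = h' x) ->
  is_RRS G h u v I -> is_RRS G' h' u v I.
Proof.
move=> eG eh H e e0; have [ks pk Hk] := H e e0; exists ks => // xs tag pxs sub txs.
by have := Hk xs tag pxs sub txs; rewrite -!/(rsum _ _ _ _ _) (eq_rsum pxs txs eG eh).
Qed.

Lemma is_RRS_lin G1 G2 h u v I1 I2 c : u < v -> is_RRS G1 h u v I1 -> is_RRS G2 h u v I2 ->
  is_RRS (fun x => G1 x + c * G2 x) h u v (I1 + c * I2).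
Proof.
move=> uv H1 H2 e e0; have c0 : 0 < `|c| + 1 by rewrite ltr_wpDl.
have [|ks1 pk1 Hk1] := H1 (e / 2); first by rewrite divr_gt0.
have [|ks2 pk2 Hk2] := H2 (e / 2 / (`|c| + 1)); first by rewrite !divr_gt0.
have [ks pk sub] := partition_through (ks1 ++ ks2) uv.
have kin (k : seq R) x : itv_partition u v k -> x \in k -> u < x <= v.
  move=> [pk0 /eqP lk] xk; rewrite -lk (last_ge pk0 xk) andbT.
  by move: pk0; rewrite lt_path_sortedE => /andP[/allP /(_ _ xk)].
exists ks => // xs tag pxs sk txs.
have h1 := Hk1 xs tag pxs (fun x xk => sk x (sub x ltac:(by rewrite mem_cat xk) (kin _ _ pk1 xk))) txs.
have h2 := Hk2 xs tag pxs (fun x xk => sk x (sub x ltac:(by rewrite mem_cat xk orbT) (kin _ _ pk2 xk))) txs.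
have -> : \sum_(0 <= i < size xs) (G1 (tag i) + c * G2 (tag i)) * (h (ppt u xs i.+1) - h (ppt u xs i)) - (I1 + c * I2)
  = (rsum G1 h u xs tag - I1) + c * (rsum G2 h u xs tag - I2).
  rewrite mulrBr /rsum mulr_sumr opprD addrACA -big_split /=; congr (_ + _).
  by apply: eq_bigr => i _; ring.
apply: (le_lt_trans (ler_normD _ _)); rewrite normrM.
have h3 : `|c| * `|rsum G2 h u xs tag - I2| <= e / 2.
  apply: (@le_trans _ _ (`|c| * (e / 2 / (`|c| + 1)))); first by rewrite ler_wpM2l // ltW.
  rewrite mulrA ler_pdivrMr // mulrC ler_wpM2l ?lerDl //; lra.
have : `|rsum G1 h u xs tag - I1| < e / 2 by [].
lra.
Qed.

Lemma rsum_all G h u xs tag : path <%R u xs -> tagged u xs tag ->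
  (forall x, u <= x -> G x = 1) -> rsum G h u xs tag = h (last u xs) - h u.
Proof.
elim: xs u tag => [|x xs IH] u tag /=; first by rewrite /rsum big_geq // subrr.
move=> /andP[ux xxs] /tagged_cons[/andP[t0 _] txs] H; rewrite rsum_cons IH // ?H //; last first.
  by move=> y xy; apply: H; exact: le_trans (ltW ux) xy.
ring.
Qed.

Lemma is_RRS_one h u v : u < v -> is_RRS (fun=> 1) h u v (h v - h u).
Proof.
move=> uv e e0; exists [:: v]; first exact: itv_partition1.
move=> xs tag [pxs /eqP lxs] _ txs.
by rewrite -/(rsum (fun=> 1) h u xs tag) (rsum_all h pxs txs) // lxs subrr normr0.
Qed.

(** Only the term over the interval that ends at [z] depends on its tag. *)
Lemma rsum_ge h u xs tag z : path <%R u xs -> tagged u xs tag -> u < z -> z \in xs ->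
  `|rsum (fun x => (z <= x)%R%:R) h u xs tag - (h (last u xs) - h z)|
  <= `|h z - h (last u [seq x <- xs | x < z])|.
Proof.
elim: xs u tag => [|x xs IH] u tag //= /andP[ux xxs] /tagged_cons[/andP[_ t0] txs] uz.
rewrite inE rsum_cons; have [zx|xz|zx] := ltgtP z x.
- move=> /= zxs; have := xxs; rewrite lt_path_sortedE => /andP[/allP /(_ _ zxs)].
  by rewrite ltNge (ltW zx).
- move=> /= zxs; rewrite [z <= _]leNgt (le_lt_trans t0 xz) mul0r add0r.
  exact: IH.
- move=> _; rewrite -zx in xxs txs t0 *; rewrite (rsum_all h xxs txs); last by move=> y ->.
  have -> : [seq x0 <- xs | x0 < z] = [::].
    apply/eqP; rewrite -(negbK (_ == _)) -has_filter; apply/hasPn => y yxs.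
    by move: xxs; rewrite lt_path_sortedE => /andP[/allP /(_ _ yxs) /ltW]; rewrite leNgt.
  rewrite addrK /= normrM ler_piMl //; case: (z <= _); by rewrite ?normr1 ?normr0.
Qed.

(** Left continuity of [h] at [z] makes the only term that depends on its tag small. *)
Lemma is_RRS_ge h u v z : u < z -> z <= v -> h x @[x --> z^'-] --> h z ->
  is_RRS (fun x => (z <= x)%R%:R) h u v (h v - h z).
Proof.
move=> uz zv hz e e0; have uv := lt_le_trans uz zv.
have [|w wz Hw] := (left_cvgP _ _ _).1 hz (e / 2); first by rewrite divr_gt0.
pose y := (Num.max u w + z) / 2.
have [uy wy yz] : [/\ u < y, w < y & y < z].
  have [h1 h2] : u <= Num.max u w /\ w <= Num.max u w by rewrite !le_max !lexx orbT.
  have h3 : Num.max u w < z by rewrite gt_max uz.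
  by rewrite /y; split; lra.
(* y forces the interval that ends at z into the neighbourhood where h is close to h z *)
have [ks pk sub] := partition_through [:: y; z] uv.
exists ks => // xs tag [pxs /eqP lxs] sk txs.
have yxs : y \in xs by apply: sk; apply: sub; rewrite ?inE ?eqxx ?uy //= (le_trans (ltW yz)).
have zxs : z \in xs by apply: sk; apply: sub; rewrite ?inE ?eqxx ?orbT // uz.
rewrite -/(rsum _ h u xs tag); apply: (@le_lt_trans _ _ (e / 2)); last by lra.
have := rsum_ge h pxs txs uz zxs; rewrite lxs => /le_trans; apply.
rewrite distrC; apply: Hw; apply/andP; split.
  apply: (lt_le_trans wy); apply: (@last_ge _ u); last by rewrite mem_filter yz.
  exact: path_filter_lt.
have [->//|] := last_in u [seq x <- xs | x < z].
by rewrite mem_filter => /andP[].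
Qed.

End refinement_integral.

(** * The Right Young integral *)

Section one_sided_controls.
Context {R : realType}.
Implicit Types (p q u v x y z e l w : R) (om : option R) (h k D V : R -> R).

(** Strict inequalities between powers are used on both sides, which avoids the continuity
    of the power at zero. *)
Lemma power_le_cvg om (T : Type) (F : set_system T) {FF : ProperFilter F} (f g : T -> R) l w :
  (if om is Some q then 0 < q else true) -> f @ F --> l -> g @ F --> w ->
  (\forall x \near F, power_le om `|f x| (g x)) -> power_le om `|l| w.
Proof.
case: om => [q|//] q0 fl gw H /=; rewrite leNgt; apply/negP => lw.
have w0 : 0 <= w.
  rewrite -(cvg_lim _ gw) //; apply: limr_ge; first by apply/cvg_ex; exists w.
  by apply: filterS H => x; apply: le_trans; exact: powR_ge0.
pose w' := (w + `|l| `^ q) / 2.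
have [w1 w2] : w < w' /\ w' < `|l| `^ q by rewrite /w'; split; lra.
have w'0 : 0 < w' by exact: le_lt_trans w1.
have l1 : w' `^ q^-1 < `|l|.
  rewrite ltNge; apply/negP => h; have := powR_mono (ltW q0) (normr_ge0 l) h.
  rewrite -powRrM mulVf ?gt_eqF // powRr1 ?(ltW w'0) // => h'.
  by have := lt_le_trans w2 h'; rewrite ltxx.
have n1 : \forall x \near F, w' `^ q^-1 < `|f x|.
  have c : `|f x| @[x --> F] --> `|l| by exact: cvg_norm.
  have l0 : 0 < `|l| - w' `^ q^-1 by rewrite subr_gt0.
  have /cvgrPdist_lt /(_ _ l0) := c; apply: filterS => x.
  by rewrite ltr_distlC => /andP[+ _]; rewrite subKr.
have n2 : \forall x \near F, g x < w'.
  have l0 : 0 < w' - w by rewrite subr_gt0.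
  have /cvgrPdist_lt /(_ _ l0) := gw; apply: filterS => x.
  by rewrite ltr_distlC => /andP[_]; rewrite addrC subrK.
have [x [[h1 h2] h3]] := filter_ex (filterI (filterI n1 n2) H).
have := powR_mono (ltW q0) (powR_ge0 w' q^-1) (ltW h1).
rewrite -powRrM mulVf ?gt_eqF // powRr1 ?(ltW w'0) // => h4.
by have := lt_le_trans h2 (le_trans h4 h3); rewrite ltxx.
Qed.

Lemma rgt_le V x y : {homo V : x y / x <= y} -> x <= y -> rgt V x <= rgt V y.
Proof.
move=> mV; rewrite le_eqVlt => /orP[/eqP->//|xy].
apply: (le_trans (mono_ge_rgt mV xy)); apply: limr_ge.
  by apply/cvg_ex; eexists; exact: mono_rgt.
by apply/near_rightP; exists (y + 1) => [|z /andP[/ltW/mV]]; rewrite ?ltrDl.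
Qed.

Lemma le_rgt V x : {homo V : x y / x <= y} -> V x <= rgt V x.
Proof.
move=> mV; apply: limr_ge; first by apply/cvg_ex; eexists; exact: mono_rgt.
by apply/near_rightP; exists (x + 1) => [|z /andP[/ltW/mV]]; rewrite ?ltrDl.
Qed.

Lemma lft_le V x : {homo V : x y / x <= y} -> lft V x <= V x.
Proof.
move=> mV; apply: limr_le; first by apply/cvg_ex; eexists; exact: mono_lft.
by apply/near_leftP; exists (x - 1) => [|z /andP[_ /ltW/mV]]; rewrite ?gtrBl.
Qed.

Variables (om : option R) (u v : R) (D V : R -> R).
Hypothesis om0 : if om is Some q then 0 < q else true.
Hypotheses (rD : regulated u v D) (mV : {homo V : x y / x <= y}).
Hypothesis DV : forall x y, u <= x -> x <= y -> y <= v -> power_le om `|D y - D x| (V y - V x).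

Lemma power_le0 w : 0 <= w -> power_le om `|0 : R| w.
Proof.
by case: om om0 => //= q q0 w0; rewrite normr0 powR0 // gt_eqF.
Qed.

Lemma power_le_ujump x : u <= x -> x < v -> power_le om `|ujump D x| (rgt V x - V x).
Proof.
move=> ux xv; apply: (power_le_cvg om0 (F := x^'+) (f := fun y => D y - D x) (g := fun y => V y - V x)).
- by apply: cvgB; [apply: (reg_rgt rD); rewrite ux|exact: cvg_cst].
- by apply: cvgB; [exact: mono_rgt|exact: cvg_cst].
- by apply/near_rightP; exists v => // y /andP[/ltW xy /ltW yv]; exact: DV.
Qed.

Lemma power_le_djump x : u < x -> x <= v -> power_le om `|djump D x| (V x - lft V x).
Proof.
move=> ux xv; apply: (power_le_cvg om0 (F := x^'-) (f := fun y => D x - D y) (g := fun y => V x - V y)).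
- by apply: cvgB; [exact: cvg_cst|apply: (reg_lft rD); rewrite ux].
- by apply: cvgB; [exact: cvg_cst|exact: mono_lft].
- by apply/near_leftP; exists u => // y /andP[/ltW xy /ltW yv]; exact: DV.
Qed.

(** Increments of a one-sided regularisation are limits of increments of the function. *)
Lemma power_le_Gplus x y : u <= x -> x <= y -> y <= v ->
  power_le om `|Gplus D v y - Gplus D v x| (Gplus V v y - Gplus V v x).
Proof.
move=> ux; rewrite le_eqVlt => /orP[/eqP<- _|xy yv].
  by rewrite !subrr; exact: power_le0.
have one z : x < z -> z < y \/ z = y -> power_le om `|Gplus D v y - D z| (Gplus V v y - V z).
  rewrite /Gplus => xz zy; have zley : z <= y by case: zy => [/ltW|->].
  case: ltP => [yv'|_]; last by apply: DV => //; exact: le_trans (ltW xz).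
  apply: (power_le_cvg om0 (F := y^'+) (f := fun y => D y - D z) (g := fun y => V y - V z)).
  - apply: cvgB; last exact: cvg_cst.
    by apply: (reg_rgt rD); rewrite yv' (le_trans ux (ltW xy)).
  - by apply: cvgB; [exact: mono_rgt|exact: cvg_cst].
  - apply/near_rightP; exists v => // t /andP[/ltW yt /ltW tv]; apply: DV => //.
      exact: le_trans (ltW xz).
    exact: le_trans yt.
rewrite {2 4}/Gplus (lt_le_trans xy yv).
apply: (power_le_cvg om0 (F := x^'+) (f := fun z => Gplus D v y - D z) (g := fun z => Gplus V v y - V z)).
- apply: cvgB; first exact: cvg_cst.
  by apply: (reg_rgt rD); rewrite ux (lt_le_trans xy).
- by apply: cvgB; [exact: cvg_cst|exact: mono_rgt].
- by apply/near_rightP; exists y => // z /andP[xz zy]; apply: one => //; left.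
Qed.

Lemma power_le_hminus x y : u <= x -> x <= y -> y <= v ->
  power_le om `|hminus D u y - hminus D u x| (hminus V u y - hminus V u x).
Proof.
move=> ux; rewrite le_eqVlt => /orP[/eqP<- _|xy yv].
  by rewrite !subrr; exact: power_le0.
have one z : x <= z -> z < y -> power_le om `|D z - hminus D u x| (V z - hminus V u x).
  rewrite /hminus => xz zy.
  case: ltP => [ux'|_]; last by apply: DV => //; exact: le_trans (ltW zy) yv.
  apply: (power_le_cvg om0 (F := x^'-) (f := fun y => D z - D y) (g := fun y => V z - V y)).
  - apply: cvgB; first exact: cvg_cst.
    by apply: (reg_lft rD); rewrite ux' (le_trans (ltW xy)).
  - by apply: cvgB; [exact: cvg_cst|exact: mono_lft].
  - apply/near_leftP; exists u => // t /andP[/ltW yt /ltW tv]; apply: DV => //.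
      exact: le_trans xz.
    exact: le_trans (ltW zy) yv.
rewrite {1 3}/hminus (le_lt_trans ux xy).
apply: (power_le_cvg om0 (F := y^'-) (f := fun z => D z - hminus D u x) (g := fun z => V z - hminus V u x)).
- apply: cvgB; last exact: cvg_cst.
  by apply: (reg_lft rD); rewrite yv (le_lt_trans ux).
- by apply: cvgB; [exact: mono_lft|exact: cvg_cst].
- by apply/near_leftP; exists x => // z /andP[/ltW xz zy]; apply: one.
Qed.

Lemma Gplus_mono : {homo Gplus V v : x y / x <= y}.
Proof.
move=> x y; rewrite /Gplus le_eqVlt => /orP[/eqP->//|xy].
have [yv|vy] := ltP y v; first by rewrite (lt_trans xy yv); exact/rgt_le/ltW.
by case: ifP => _; [exact: mono_ge_rgt|exact/mV/ltW].
Qed.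

Lemma hminus_mono : {homo hminus V u : x y / x <= y}.
Proof.
move=> x y; rewrite /hminus le_eqVlt => /orP[/eqP->//|xy].
have [ux|xu] := ltP u x; first rewrite (lt_trans ux xy).
  by apply: le_trans (mono_le_lft mV xy); exact: lft_le.
by case: ifP => _; [exact: mono_le_lft|exact/mV/ltW].
Qed.

Lemma Gplus_norm e : (forall x, u <= x <= v -> `|D x| <= e) ->
  forall x, u <= x <= v -> `|Gplus D v x| <= e.
Proof.
move=> De x /andP[ux xv']; rewrite /Gplus; case: ltP => xv; last by apply: De; rewrite ux xv'.
have hx : u <= x < v by rewrite ux xv.
have c : `|D x| @[x --> x^'+] --> `|rgt D x| by apply: cvg_norm; exact: reg_rgt hx.
rewrite -(cvg_lim _ c) //; apply: limr_le; first by apply/cvg_ex; eexists; exact: c.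
by apply/near_rightP; exists v => // y /andP[xy yv]; apply: De; rewrite (le_trans ux (ltW xy)) ltW.
Qed.

End one_sided_controls.

Section norms.
Context {R : realType}.
Implicit Types x y c d : R.

Lemma normD_le x y c d : `|x| <= c -> `|y| <= d -> `|x + y| <= c + d.
Proof. by move=> h1 h2; apply: le_trans (ler_normD _ _) _; exact: lerD. Qed.

Lemma normB_le x y c d : `|x| <= c -> `|y| <= d -> `|x - y| <= c + d.
Proof. by move=> h1 h2; apply: le_trans (ler_normB _ _) _; exact: lerD. Qed.

Lemma sum5_lt x d : 0 < d -> d + d + d + d + x < x + 5 * d.
Proof. lra. Qed.

End norms.

Section young_integral.
Context {R : realType} (a b : R) (lam : nat -> seq R).
Hypotheses (ab : a < b) (lamP : Lambda a b lam).
Implicit Types (K S D h F V : R -> R) (s t u v x y z c e : R).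

Local Notation jumps_in_cup := (jumps_in_cup a b lam).

(** The integral, the limit of the right sums along the partitions and the one-sided limits
    are kept together: the theorem needs them for the same [F], and each of them passes
    to uniform limits in the same way. *)
Definition RY_integral K h F := [/\ forall u v, a <= u -> u < v -> v <= b -> is_RY K h u v (F v - F u),
  forall s t, a <= s -> s < t -> t <= b ->
    psum (fun x y => K y * (h y - h x)) s (restr lam s t m) @[m --> \oo] --> F t - F s,
  forall r, a < r <= b -> F x @[x --> r^'-] --> F r - K r * djump h r &
  forall r, a <= r < b -> F x @[x --> r^'+] --> F r + rgt K r * ujump h r].

Variable h : R -> R.
Hypotheses (rh : regulated a b h) (nh : jumps_in_cup h).

Lemma rgtD K1 K2 c r : regulated a b K1 -> regulated a b K2 -> a <= r < b ->
  rgt (fun x => K1 x + c * K2 x) r = rgt K1 r + c * rgt K2 r.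
Proof.
move=> r1 r2 hr; apply: rgt_eq; apply: cvgD; first exact: reg_rgt hr.
by apply: cvgM; [exact: cvg_cst|exact: reg_rgt hr].
Qed.

Lemma RY_integral_lin c K1 K2 F1 F2 : regulated a b K1 -> regulated a b K2 ->
  RY_integral K1 h F1 -> RY_integral K2 h F2 ->
  RY_integral (fun x => K1 x + c * K2 x) h (fun x => F1 x + c * F2 x).
Proof.
move=> r1 r2 [A1 B1 C1 D1] [A2 B2 C2 D2].
have r12 : regulated a b (fun x => K1 x + c * K2 x).
  by apply: regulatedD => //; apply: regulatedM => //; exact: regulated_cst.
split.
- move=> u v au uv vb; right.
  case: (A1 u v au uv vb) => [[uv' _]|[_ _ _ [J1 [S1 [h1 h2 h3]]]]].
    by rewrite uv' ltxx in uv.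
  case: (A2 u v au uv vb) => [[uv' _]|[_ _ _ [J2 [S2 [k1 k2 k3]]]]].
    by rewrite uv' ltxx in uv.
  split=> //; [exact: regulated_sub r12|exact: regulated_sub rh|].
  exists (J1 + c * J2), (S1 + c * S2); split.
  - apply: (eq_is_RRS _ _ (is_RRS_lin c uv h1 k1)) => // x /andP[ux xv].
    by rewrite /Gplus; case: ifP => // xv'; rewrite rgtD // (le_trans au ux) (lt_le_trans xv').
  - have e : forall A : {fset R}, \sum_(t <- A | t \in `]u, v[%classic)
        ujump (fun x => K1 x + c * K2 x) t * djump h t =
        \sum_(t <- A | t \in `]u, v[%classic) ujump K1 t * djump h t +
        c * \sum_(t <- A | t \in `]u, v[%classic) ujump K2 t * djump h t.
      move=> A; rewrite mulr_sumr -big_split /=; apply: eq_bigr => t.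
      rewrite in_oo => /andP[ut tv]; rewrite /ujump rgtD //; first by ring.
      by rewrite (le_trans au (ltW ut)) (lt_le_trans tv).
    rewrite /usum_cvg (funext e).
    by apply: cvgD; [exact: h2|apply: cvgM; [exact: cvg_cst|exact: k2]].
  - have -> : F1 v + c * F2 v - (F1 u + c * F2 u) = (F1 v - F1 u) + c * (F2 v - F2 u) by ring.
    rewrite h3 k3; ring.
- move=> s t as_ st tb.
  have -> : (fun m => psum (fun x y => (K1 y + c * K2 y) * (h y - h x)) s (restr lam s t m)) =
    (fun m => psum (fun x y => K1 y * (h y - h x)) s (restr lam s t m) +
       c * psum (fun x y => K2 y * (h y - h x)) s (restr lam s t m)).
    apply/funext => m; rewrite -psumZ -psumD; congr psum.
    by apply/funext => x; apply/funext => y; ring.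
  have -> : F1 t + c * F2 t - (F1 s + c * F2 s) = (F1 t - F1 s) + c * (F2 t - F2 s) by ring.
  by apply: cvgD; [exact: B1|apply: cvgM; [exact: cvg_cst|exact: B2]].
- move=> r hr.
  have -> : F1 r + c * F2 r - (K1 r + c * K2 r) * djump h r =
     (F1 r - K1 r * djump h r) + c * (F2 r - K2 r * djump h r) by ring.
  by apply: cvgD; [exact: C1|apply: cvgM; [exact: cvg_cst|exact: C2]].
- move=> r hr; rewrite rgtD //.
  have -> : F1 r + c * F2 r + (rgt K1 r + c * rgt K2 r) * ujump h r =
     (F1 r + rgt K1 r * ujump h r) + c * (F2 r + rgt K2 r * ujump h r) by ring.
  by apply: cvgD; [exact: D1|apply: cvgM; [exact: cvg_cst|exact: D2]].
Qed.

(** The right sums telescope from the last partition point outside the up-set. *)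
Lemma psum_up (P : pred R) s xs : (forall x y, x <= y -> P x -> P y) -> path <%R s xs ->
  psum (fun x y => (P y)%:R * (h y - h x)) s xs =
  if P s then h (last s xs) - h s else h (last s xs) - h (last s [seq x <- xs | ~~ P x]).
Proof.
move=> up; elim: xs s => [|x xs IH] s /=; first by rewrite psum_nil subrr if_same.
move=> /andP[sx xxs]; rewrite psum_cons IH //; have [Ps|Ps] := boolP (P s).
  by rewrite (up _ _ (ltW sx) Ps) mul1r; ring.
case: ifP => Px /=; last by rewrite mul0r add0r.
have -> : [seq x <- xs | ~~ P x] = [::].
  apply/eqP; rewrite -(negbK (_ == _)) -has_filter; apply/hasPn => y yxs.
  by rewrite negbK (up x) //; move: xxs; rewrite lt_path_sortedE => /andP[/allP /(_ _ yxs) /ltW].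
by rewrite mul1r /=; ring.
Qed.

Lemma filter_restr (P : pred R) s t m : [seq x <- restr lam s t m | P x] =
  if P t then rcons [seq x <- lam m | P x && (s < x < t)] t
  else [seq x <- lam m | P x && (s < x < t)].
Proof. by rewrite /restr filter_rcons -filter_predI. Qed.

Lemma cvg_at_left_eq F G r l w : w < r -> (forall x, w < x < r -> F x = G x) ->
  G x @[x --> r^'-] --> (l : R) -> F x @[x --> r^'-] --> l.
Proof.
move=> wr FG; apply: cvg_trans; apply: near_eq_cvg; apply/near_leftP.
by exists w => // x /FG ->.
Qed.

Lemma cvg_at_right_eq F G r l w : r < w -> (forall x, r < x < w -> F x = G x) ->
  G x @[x --> r^'+] --> (l : R) -> F x @[x --> r^'+] --> l.
Proof.
move=> wr FG; apply: cvg_trans; apply: near_eq_cvg; apply/near_rightP.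
by exists w => // x /FG ->.
Qed.

Lemma rgt_ge z r : rgt (fun x => (z <= x)%R%:R) r = (z <= r)%R%:R.
Proof.
apply: rgt_eq; have [zr|rz] := leP z r.
  apply: (cvg_at_right_eq (w := r + 1) (G := fun=> 1)); rewrite ?ltrDl //; last exact: cvg_cst.
  by move=> x /andP[rx _]; rewrite (le_trans zr (ltW rx)).
apply: (cvg_at_right_eq (w := z) (G := fun=> 0)) => //; last exact: cvg_cst.
by move=> x /andP[_ xz]; rewrite leNgt xz.
Qed.

Lemma rgt_gt z r : rgt (fun x => (z < x)%R%:R) r = (z <= r)%R%:R.
Proof.
apply: rgt_eq; have [zr|rz] := leP z r.
  apply: (cvg_at_right_eq (w := r + 1) (G := fun=> 1)); rewrite ?ltrDl //; last exact: cvg_cst.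
  by move=> x /andP[rx _]; rewrite (le_lt_trans zr rx).
apply: (cvg_at_right_eq (w := z) (G := fun=> 0)) => //; last exact: cvg_cst.
by move=> x /andP[_ xz]; rewrite ltNge (ltW xz).
Qed.

Lemma regulated_ge z : regulated a b (fun x => (z <= x)%R%:R).
Proof.
by apply: mono_regulated => x y xy; rewrite ler_nat; case: (leP z x) => // zx; rewrite (le_trans zx xy).
Qed.

Lemma regulated_gt z : regulated a b (fun x => (z < x)%R%:R).
Proof.
by apply: mono_regulated => x y xy; rewrite ler_nat; case: (ltP z x) => // zx; rewrite (lt_le_trans zx xy).
Qed.

Lemma hminus_left u r : a <= u -> u < r -> r <= b ->
  hminus h u x @[x --> r^'-] --> hminus h u r.
Proof.
move=> au ur rb; rewrite /hminus ur; apply/left_cvgP => e e0.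
have hr : a < r <= b by rewrite (le_lt_trans au ur).
have [w wr Hw] := (left_cvgP _ _ _).1 (reg_lft rh hr) e e0.
exists (Num.max u w) => [|x]; first by rewrite gt_max ur.
rewrite gt_max => /andP[/andP[ux wx] xr]; rewrite ux.
have hx : a < x <= b by rewrite (le_lt_trans au ux) (le_trans (ltW xr)).
have c : `|h y - lft h r| @[y --> x^'-] --> `|lft h x - lft h r|.
  by apply: cvg_norm; apply: cvgB; [exact: reg_lft hx|exact: cvg_cst].
rewrite -(cvg_lim _ c) //; apply: limr_le; first by apply/cvg_ex; eexists; exact: c.
by apply/near_leftP; exists w => // y /andP[wy yx]; apply: Hw; rewrite wy (lt_trans yx).
Qed.

Lemma usum_zero (D : set R) (c : R -> R) : (forall t, D t -> c t = 0) -> usum_cvg D c 0.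
Proof.
move=> H; rewrite /usum_cvg (_ : (fun A : {fset R} => _) = fun=> 0); first exact: cvg_cst.
by apply/funext => A; rewrite big1 // => t /set_mem/H.
Qed.

Lemma hminus_end u v : u < v -> hminus h u v = lft h v.
Proof. by rewrite /hminus => ->. Qed.

Lemma hminus_start u : hminus h u u = h u.
Proof. by rewrite /hminus ltxx. Qed.

Lemma is_RY_one K u v : a <= u -> u < v -> v <= b -> regulated a b K ->
  (forall x, u <= x <= v -> Gplus K v x = 1) -> (forall x, u < x < v -> ujump K x = 0) ->
  K v = 1 -> is_RY K h u v (h v - h u).
Proof.
move=> au uv vb rK G1 K0 Kv; right; split=> //; [exact: regulated_sub rK|exact: regulated_sub rh|].
exists (hminus h u v - hminus h u u), 0; split.
- by apply: (eq_is_RRS _ _ (is_RRS_one (hminus h u) uv)) => // x /G1.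
- by apply: usum_zero => t /=; rewrite in_itv => /K0->; rewrite mul0r.
- by rewrite hminus_end // hminus_start Kv /djump; ring.
Qed.

Lemma is_RY_zero K u v : a <= u -> u < v -> v <= b -> regulated a b K ->
  (forall x, u <= x <= v -> Gplus K v x = 0) -> (forall x, u < x < v -> ujump K x = 0) ->
  K v = 0 -> is_RY K h u v 0.
Proof.
move=> au uv vb rK G1 K0 Kv; right; split=> //; [exact: regulated_sub rK|exact: regulated_sub rh|].
exists 0, 0; split.
- move=> e e0; exists [:: v]; first exact: itv_partition1.
  move=> xs tag pxs _ txs; rewrite big_nat_cond big1 ?subr0 ?normr0 // => i /andP[/andP[_ ix] _].
  by rewrite G1 ?mul0r // (tagged_in pxs txs).
- by apply: usum_zero => t /=; rewrite in_itv => /K0->; rewrite mul0r.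
- by rewrite Kv; ring.
Qed.

Lemma RY_integral_one : RY_integral (fun=> 1) h h.
Proof.
have r1 r : rgt (fun=> 1 : R) r = 1 by apply: rgt_eq; exact: cvg_cst.
split.
- move=> u v au uv vb; apply: is_RY_one => //; first exact: regulated_cst.
    by move=> x _; rewrite /Gplus r1 if_same.
  by move=> x _; rewrite /ujump r1 subrr.
- move=> s t _ _ _; rewrite (_ : (fun m => _) = fun=> h t - h s); first exact: cvg_cst.
  apply/funext => m; rewrite -(restr_last lam s t m) -psum_tele restr_last.
  by congr psum; apply/funext => x; apply/funext => y; rewrite mul1r.
- by move=> r hr; rewrite mul1r /djump subKr; exact: reg_lft hr.
- by move=> r hr; rewrite r1 mul1r /ujump addrC subrK; exact: reg_rgt hr.
Qed.

Lemma cvg_pred (u l : R) s z : a <= s -> s < z -> z <= b ->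
  h (before lam s z m) @[m --> \oo] --> lft h z.
Proof.
move=> as_ sz zb; apply: (cvg_before lamP) => //.
by apply: (reg_lft rh); rewrite zb (le_lt_trans as_).
Qed.

(** The left-continuous version of [h] has the Riemann-Stieltjes integral
    h(v-) - h(z-) against the indicator; the end point term adds the left jump at [v]. *)
Lemma RY_integral_ge z : RY_integral (fun x => (z <= x)%R%:R) h (fun x => if z <= x then h x else lft h z).
Proof.
have rz := regulated_ge z.
have uj x : ujump (fun x => (z <= x)%R%:R : R) x = 0 by rewrite /ujump rgt_ge subrr.
have Gz v x : Gplus (fun x => (z <= x)%R%:R) v x = (z <= x)%R%:R by rewrite /Gplus rgt_ge if_same.
split.
- move=> u v au uv vb; have [zu|uz] := leP z u.
    rewrite (le_trans zu (ltW uv)); apply: is_RY_one => //; last by rewrite (le_trans zu (ltW uv)).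
    by move=> x /andP[ux _]; rewrite Gz (le_trans zu ux).
  have [zv|vz] := leP z v; last first.
    rewrite subrr; apply: is_RY_zero => //; last by rewrite leNgt vz.
    by move=> x /andP[_ xv]; rewrite Gz leNgt (le_lt_trans xv vz).
  right; split=> //; [exact: regulated_sub rz|exact: regulated_sub rh|].
  exists (hminus h u v - hminus h u z), 0; split.
  + have hz := hminus_left au uz (le_trans zv vb).
    by apply: (eq_is_RRS _ _ (is_RRS_ge uz zv hz)) => // x _; rewrite Gz.
  + by apply: usum_zero => t _; rewrite uj mul0r.
  + by rewrite !hminus_end // zv mul1r /djump; ring.
- move=> s t as_ st tb; have up x y : x <= y -> z <= x -> z <= y by move=> xy zx; exact: le_trans xy.
  have E m := psum_up up (restr_path lamP m st).
  rewrite (_ : (fun m => _) = (fun m => if z <= s then h t - h s else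
     h t - h (last s [seq x <- restr lam s t m | ~~ (z <= x)]))); last first.
    by apply/funext => m; rewrite E !restr_last.
  have [zs|sz] := leP z s; first by rewrite (le_trans zs (ltW st)); exact: cvg_cst.
  have [zt|tz] := leP z t; last first.
    rewrite (_ : (fun m => _) = fun=> lft h z - lft h z); first exact: cvg_cst.
    by apply/funext => m; rewrite filter_restr -ltNge tz last_rcons !subrr.
  rewrite (_ : (fun m => _) = fun m => h t - h (before lam s z m)).
    by apply: cvgB; [exact: cvg_cst|apply: cvg_pred => //; exact: le_trans tb].
  apply/funext => m; rewrite filter_restr zt /before; congr (_ - h (last _ _)).
  apply: eq_filter => x; rewrite -ltNge; case: ltP => xz; rewrite ?andbF //=.
  by rewrite (lt_le_trans xz zt) andbT.
- move=> r hr; have [rz'|zr|zr] := ltgtP r z.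
  + rewrite mul0r subr0; apply: (cvg_at_left_eq (w := a) (G := fun=> lft h z)); last exact: cvg_cst.
      by case/andP: hr.
    by move=> x /andP[_ xr]; rewrite leNgt (lt_trans xr rz').
  + rewrite mul1r /djump subKr; apply: (cvg_at_left_eq (w := z) (G := h)) => //; last exact: reg_lft hr.
    by move=> x /andP[zx _]; rewrite (ltW zx).
  + rewrite -zr mul1r /djump subKr; apply: (cvg_at_left_eq (w := a) (G := fun=> lft h r)); last exact: cvg_cst.
      by case/andP: hr.
    by move=> x /andP[_ xr]; rewrite leNgt xr.
- move=> r hr; rewrite rgt_ge; have [zr|rz'] := leP z r.
    rewrite mul1r /ujump addrC subrK.
    apply: (cvg_at_right_eq (w := b) (G := h)); last exact: reg_rgt hr.
      by case/andP: hr.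
    by move=> x /andP[rx _]; rewrite (le_trans zr (ltW rx)).
  rewrite mul0r addr0; apply: (cvg_at_right_eq (w := z) (G := fun=> lft h z)) => //; last exact: cvg_cst.
  by move=> x /andP[_ xz]; rewrite leNgt xz.
Qed.

(** The correction sum consists of the left jump of [h] at [z].  If [z] is never a
    partition point the right sums see h(z-) in place of h(z), and this is the one
    place where [jumps_in_cup] enters the construction of the integral. *)
Lemma RY_integral_gt z : RY_integral (fun x => (z < x)%R%:R) h (fun x => if z < x then h x else h z).
Proof.
have rz := regulated_gt z.
have uj x : ujump (fun x => (z < x)%R%:R : R) x = (x == z)%:R.
  by rewrite /ujump rgt_gt; case: ltgtP; rewrite ?subrr ?subr0.
have Gz v x : x < v -> Gplus (fun x => (z < x)%R%:R) v x = (z <= x)%R%:R.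
  by move=> xv; rewrite /Gplus xv rgt_gt.
have Gv v : Gplus (fun x => (z < x)%R%:R) v v = (z < v)%R%:R.
  by rewrite /Gplus ltxx.
split.
- move=> u v au uv vb; have [zu|uz] := leP z u.
    have zv := le_lt_trans zu uv.
    have -> : (if z < v then h v else h z) - (if z < u then h u else h z) = h v - h u.
      by rewrite zv; case: ltP => // uz; have -> : z = u by apply/le_anti; rewrite zu uz.
    apply: is_RY_one => //; last by rewrite zv.
      move=> x /andP[ux]; rewrite le_eqVlt => /orP[/eqP->|xv]; first by rewrite Gv zv.
      by rewrite Gz // (le_trans zu ux).
    by move=> x /andP[ux _]; rewrite uj gt_eqF // (le_lt_trans zu).
  rewrite [z < u]ltNge (ltW uz) /=; have [zv|vz] := ltP z v; last first.
    rewrite subrr; apply: is_RY_zero => //; last by rewrite ltNge vz.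
      move=> x /andP[ux]; rewrite le_eqVlt => /orP[/eqP->|xv]; first by rewrite Gv ltNge vz.
      by rewrite Gz // leNgt (lt_le_trans xv vz).
    by move=> x /andP[_ xv]; rewrite uj lt_eqF // (lt_le_trans xv).
  right; split=> //; [exact: regulated_sub rz|exact: regulated_sub rh|].
  exists (hminus h u v - hminus h u z), (djump h z); split.
  + have hz := hminus_left au uz (le_trans (ltW zv) vb).
    apply: (eq_is_RRS _ _ (is_RRS_ge uz (ltW zv) hz)) => // x /andP[ux].
    rewrite le_eqVlt => /orP[/eqP->|xv]; last by rewrite Gz.
    by rewrite Gv zv (ltW zv).
  + apply: cvg_near_cst; apply: (@near_totP _ _ [fset z]%fset) => A sub.
    rewrite (perm_big _ (fset_perm sub)) big_cat /= big_mkcond big_seq_fset1.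
    rewrite in_oo uz zv uj eqxx mul1r big_seq_cond big1 ?addr0 // => t.
    by rewrite in_fsetD in_fset1 uj => /andP[/andP[/negbTE-> _] _]; rewrite mul0r.
  + by rewrite !hminus_end // zv mul1r /djump; ring.
- move=> s t as_ st tb; have up x y : x <= y -> z < x -> z < y by move=> xy zx; exact: lt_le_trans xy.
  have E m := psum_up up (restr_path lamP m st).
  rewrite (_ : (fun m => _) = (fun m => if z < s then h t - h s else
     h t - h (last s [seq x <- restr lam s t m | ~~ (z < x)]))); last first.
    by apply/funext => m; rewrite E !restr_last.
  have [zs|sz] := ltP z s; first by rewrite (lt_trans zs st); exact: cvg_cst.
  have [zt|tz] := ltP z t; last first.
    rewrite (_ : (fun m => _) = fun=> h z - h z); first exact: cvg_cst.
    by apply/funext => m; rewrite filter_restr -leNgt tz last_rcons !subrr.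
  have E2 m : [seq x <- restr lam s t m | ~~ (z < x)] = [seq x <- lam m | s < x <= z].
    rewrite filter_restr zt /=; apply: eq_filter => x; rewrite -leNgt.
    by case: (leP x z) => xz; rewrite ?andbF //= (le_lt_trans xz zt) !andbT.
  apply: cvgB; first exact: cvg_cst.
  rewrite (_ : (fun m => _) = fun m => h (last s [seq x <- lam m | s < x <= z])); last first.
    by apply/funext => m; rewrite E2.
  move: sz; rewrite le_eqVlt => /orP[/eqP sz|sz].
    rewrite (_ : (fun m => _) = fun=> h z); first exact: cvg_cst.
    apply/funext => m; rewrite (eq_filter (a2 := pred0)) ?filter_pred0 ?sz // => x.
    by rewrite -sz; case: ltgtP.
  have aux m : h (last s [seq x <- lam m | s < x <= z]) =
      if z \in lam m then h z else h (before lam s z m).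
    case: ifP => zm.
      have pz : path <%R s [seq x <- lam m | s < x <= z].
        rewrite lt_path_sortedE; apply/andP; split.
          by apply/allP => x; rewrite mem_filter => /andP[/andP[]].
        apply: (sorted_filter (@lt_trans _ R)); case: lamP => /(_ m)[pl _] _ _.
        exact: path_sorted pl.
      have zin : z \in [seq x <- lam m | s < x <= z] by rewrite mem_filter sz lexx.
      congr h; apply/le_anti; rewrite (last_ge pz zin) andbT.
      have [->|] := last_in s [seq x <- lam m | s < x <= z]; first exact: ltW.
      by rewrite mem_filter => /andP[/andP[]].
    rewrite /before; congr (h (last _ _)); apply: eq_in_filter => x xm.
    by rewrite [x <= z]le_eqVlt; case: eqP => // xz; rewrite xz zm in xm.
  rewrite (funext aux); have [zc|zn] := pselect (cup a lam z).
    apply: cvg_near_cst; have := cup_near lamP (le_lt_trans as_ sz) zc.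
    by apply: filterS => m ->.
  have hz : lft h z = h z.
    apply/eqP; rewrite eq_sym -subr_eq0; apply/eqP; apply: nh => //.
    by rewrite (le_lt_trans as_ sz) (lt_le_trans zt tb).
  rewrite (_ : (fun m => _) = fun m => h (before lam s z m)).
    by rewrite -hz; apply: cvg_pred => //; exact: le_trans (ltW zt) tb.
  by apply/funext => m; case: ifP => // zm; case: zn; exists m; rewrite inE zm orbT.
- move=> r hr; have [zr|rz'] := ltP z r.
    rewrite mul1r /djump subKr; apply: (cvg_at_left_eq (w := z) (G := h)) => //; last exact: reg_lft hr.
    by move=> x /andP[zx _]; rewrite zx.
  rewrite mul0r subr0; apply: (cvg_at_left_eq (w := a) (G := fun=> h z)); last exact: cvg_cst.
    by case/andP: hr.
  by move=> x /andP[_ xr]; rewrite ltNge (le_trans (ltW xr) rz').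
- move=> r hr; rewrite rgt_gt; have [zr|rz'] := leP z r.
    have -> : (if z < r then h r else h z) = h r.
      by case: ltP => // rz'; have -> : z = r by apply/le_anti; rewrite zr rz'.
    rewrite mul1r /ujump addrC subrK.
    apply: (cvg_at_right_eq (w := b) (G := h)); last exact: reg_rgt hr.
      by case/andP: hr.
    by move=> x /andP[rx _]; rewrite (le_lt_trans zr rx).
  rewrite [z < r]ltNge (ltW rz') mul0r addr0.
  apply: (cvg_at_right_eq (w := z) (G := fun=> h z)) => //; last exact: cvg_cst.
  by move=> x /andP[_ xz]; rewrite ltNge (ltW xz).
Qed.

Lemma stepf_regulated S : step_fun S -> regulated a b S.
Proof.
elim=> [c|S' c z _ IH|S' c z _ IH]; first exact: regulated_cst.
  by apply: regulatedD => //; apply: regulatedM; [exact: regulated_cst|exact: regulated_ge].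
by apply: regulatedD => //; apply: regulatedM; [exact: regulated_cst|exact: regulated_gt].
Qed.

Lemma RY_integral_step S : step_fun S -> exists F, RY_integral S h F.
Proof.
elim=> [c|S' c z stS [F HF]|S' c z stS [F HF]].
- have H := RY_integral_lin (c - 1) (regulated_cst a b 1) (regulated_cst a b 1) RY_integral_one RY_integral_one.
  have e : (fun=> 1 + (c - 1) * 1) = (fun=> c : R) :> (R -> R) by apply/funext => _; ring.
  by rewrite e in H; eexists; exact: H.
- by eexists; exact: RY_integral_lin (stepf_regulated stS) (regulated_ge z) HF (RY_integral_ge z).
- by eexists; exact: RY_integral_lin (stepf_regulated stS) (regulated_gt z) HF (RY_integral_gt z).
Qed.

(** One bound for the four quantities from which [RY_integral] is built: integrand, right
    sums, Riemann-Stieltjes sums and correction sums. *)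
Definition approx_by e K S := let D x := K x - S x in
  [/\ forall x, a <= x <= b -> `|D x| <= e,
      forall u v xs, a <= u -> u < v -> v <= b -> itv_partition u v xs ->
        `|psum (fun x y => D y * (h y - h x)) u xs| <= e,
      forall u v xs tag, a <= u -> u < v -> v <= b -> itv_partition u v xs ->
        tagged u xs tag -> `|rsum (Gplus D v) (hminus h u) u xs tag| <= e &
      forall u v (A : {fset R}), a <= u -> u < v -> v <= b ->
        `|\sum_(t <- A | t \in `]u, v[%classic) ujump D t * djump h t| <= e].

(** The limits of the right sums define the integral; every other clause is a limit that
    is uniformly close to the one for a step function. *)
Lemma RY_integral_closure K : regulated a b K ->
  (forall e, 0 < e -> exists2 S, step_fun S & approx_by e K S) -> exists F, RY_integral K h F.
Proof.
move=> rK H.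
pose T s t m := psum (fun x y => K y * (h y - h x)) s (restr lam s t m).
pose L s t := lim (T s t m @[m --> \oo]).
have TS e S s t m : approx_by e K S -> a <= s -> s < t -> t <= b ->
    `|T s t m - psum (fun x y => S y * (h y - h x)) s (restr lam s t m)| <= e.
  move=> [_ h2 _ _] as_ st tb; have := h2 s t _ as_ st tb (restr_partition lamP m st).
  rewrite /T -psumB (_ : (fun x y => _) = fun x y => K y * (h y - h x) - S y * (h y - h x)) //.
  by apply/funext => x; apply/funext => y; rewrite mulrBl.
have TL s t : a <= s -> s < t -> t <= b -> T s t m @[m --> \oo] --> L s t.
  move=> as_ st tb; apply: approx_cvg => e e0.
  have [S stS AS] := H e e0; have [F' [_ B _ _]] := RY_integral_step stS.
  exists (fun m => psum (fun x y => S y * (h y - h x)) s (restr lam s t m)), (F' t - F' s).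
  by split; [exact: B|move=> m; exact: TS].
have LS e S F' s t : approx_by e K S -> RY_integral S h F' -> a <= s -> s < t -> t <= b ->
    `|L s t - (F' t - F' s)| <= e.
  move=> AS [_ B _ _] as_ st tb; apply: (approx_lim (TL s t as_ st tb) (B s t as_ st tb)) => m.
  exact: TS.
pose F x := if a < x then L a x else 0.
have FL s t : a <= s -> s < t -> t <= b -> F t - F s = L s t.
  move=> as_ st tb; apply/eqP; rewrite -subr_eq0 -normr_le0; apply/ler_addgt0Pl => e e0.
  have e3 : 0 < e / 3 by rewrite divr_gt0.
  have [S stS AS] := H _ e3; have [F' RF'] := RY_integral_step stS.
  have h1 := LS _ _ _ _ _ AS RF' as_ st tb.
  have at_ := le_lt_trans as_ st; have h2 := LS _ _ _ _ _ AS RF' (lexx a) at_ tb.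
  rewrite /F at_; move: as_; rewrite le_eqVlt => /orP[/eqP sa|as_].
    by rewrite -sa ltxx subr0 addr0 subrr normr0 ltW.
  have h3 := LS _ _ _ _ _ AS RF' (lexx a) as_ (le_trans (ltW st) tb).
  rewrite as_ addr0; move: h1 h2 h3; rewrite !ler_norml => /andP[? ?] /andP[? ?] /andP[? ?].
  by apply/andP; split; lra.
have FS e S F' s t : approx_by e K S -> RY_integral S h F' -> a <= s -> s < t -> t <= b ->
    `|F t - F s - (F' t - F' s)| <= e by move=> AS RF' as_ st tb; rewrite FL //; exact: LS AS RF' as_ st tb.
exists F; split.
- move=> u v au uv vb; right; split=> //; [exact: regulated_sub rK|exact: regulated_sub rh|].
  pose g (A : {fset R}) := \sum_(t <- A | t \in `]u, v[%classic) ujump K t * djump h t.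
  have gS e S A : step_fun S -> approx_by e K S -> `|g A -
      \sum_(t <- A | t \in `]u, v[%classic) ujump S t * djump h t| <= e.
    move=> stS [_ _ _ h4]; have := h4 u v A au uv vb.
    rewrite -sumrB (eq_bigr (fun t => ujump K t * djump h t - ujump S t * djump h t)) // => t.
    rewrite in_oo => /andP[ut tv].
    have ht : a <= t < b by rewrite (le_trans au (ltW ut)) (lt_le_trans tv).
    have := rgtD (-1) rK (stepf_regulated stS) ht.
    rewrite (_ : (fun x => K x + -1 * S x) = fun x => K x - S x); last by apply/funext => x; ring.
    by rewrite /ujump => ->; ring.
  have RYS S F' : RY_integral S h F' -> exists (J S1 : R), [/\ is_RRS (Gplus S v) (hminus h u) u v J,
        usum_cvg `]u, v[%classic (fun x => ujump S x * djump h x) S1 &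
        F' v - F' u = J - S1 + S v * djump h v].
    by move=> [A _ _ _]; case: (A u v au uv vb) => [[uv' _]|[_ _ _ //]]; rewrite uv' ltxx in uv.
  have gc : g @ summability.totally --> lim (g @ summability.totally).
    apply: approx_cvg => e e0; have [S stS AS] := H e e0.
    have [F' RF'] := RY_integral_step stS; have [J [S1 [_ c _]]] := RYS _ _ RF'.
    exists (fun A : {fset R} => \sum_(t <- A | t \in `]u, v[%classic) ujump S t * djump h t), S1.
    by split=> // A; exact: gS.
  set SS := lim _ in gc.
  exists (F v - F u + SS - K v * djump h v), SS; split=> //; last by ring.
  move=> e e0; pose d := e / (`|djump h v| + 5).
  have d4 : 0 < `|djump h v| + 5 by rewrite ltr_wpDl.
  have d0 : 0 < d by rewrite divr_gt0.
  have [S stS AS] := H d d0; have [F' RF'] := RY_integral_step stS.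
  have [J [S1 [HJ c E]]] := RYS _ _ RF'.
  have [ks pk Hk] := HJ d d0; exists ks => // xs tag pxs sub txs.
  have h1 := Hk xs tag pxs sub txs; rewrite -/(rsum (Gplus S v) _ u xs tag) in h1.
  have h2 : `|rsum (Gplus K v) (hminus h u) u xs tag - rsum (Gplus S v) (hminus h u) u xs tag| <= d.
    case: AS => _ _ h3 _; have := h3 u v xs tag au uv vb pxs txs.
    rewrite /rsum -sumrB (eq_big_nat _ _ (F2 := fun i => Gplus K v (tag i) * (hminus h u (ppt u xs i.+1) -
      hminus h u (ppt u xs i)) - Gplus S v (tag i) * (hminus h u (ppt u xs i.+1) -
      hminus h u (ppt u xs i)))) // => i /andP[_ ix].
    rewrite -mulrBl; congr (_ * _); rewrite /Gplus; case: ltP => // tv.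
    have /andP[ut _] := tagged_in pxs txs ix.
    have ht : a <= tag i < b by rewrite (le_trans au ut) (lt_le_trans tv).
    have := rgtD (-1) rK (stepf_regulated stS) ht.
    by rewrite (_ : (fun x => K x + -1 * S x) = fun x => K x - S x); [move=> ->; ring|apply/funext => x; ring].
  have h3 := FS _ _ _ _ _ AS RF' au uv vb.
  have h4 : `|SS - S1| <= d by apply: (approx_lim gc c) => A; exact: gS.
  have h5 : `|(K v - S v) * djump h v| <= d * `|djump h v|.
    by case: AS => h5 _ _ _; rewrite normrM ler_wpM2r // h5 // vb (le_trans au) // ltW.
  rewrite -/(rsum (Gplus K v) _ u xs tag).
  have ed : e = d * `|djump h v| + 5 * d by rewrite /d; field; rewrite gt_eqF.
  set X := rsum _ _ _ _ _ in h2 *; set Y := rsum _ _ _ _ _ in h1 h2.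
  have -> : X - (F v - F u + SS - K v * djump h v) = (X - Y) + (Y - J) -
    (F v - F u - (F' v - F' u)) - (SS - S1) + (K v - S v) * djump h v.
    by rewrite E; ring.
  have := normD_le (normB_le (normB_le (normD_le h2 (ltW h1)) h3) h4) h5.
  by move=> /le_lt_trans; apply; rewrite ed; exact: sum5_lt.
- by move=> s t as_ st tb; rewrite FL //; exact: TL.
- move=> r hr; have /andP[ar rb] := hr; apply/left_cvgP => e e0.
  pose d := e / (`|djump h r| + 2).
  have d4 : 0 < `|djump h r| + 2 by rewrite ltr_wpDl.
  have d0 : 0 < d by rewrite divr_gt0.
  have [S stS AS] := H d d0; have [F' RF'] := RY_integral_step stS.
  have [_ _ c _] := RF'; have [w wr Hw] := (left_cvgP _ _ _).1 (c r hr) d d0.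
  exists (Num.max a w) => [|x]; first by rewrite gt_max ar.
  rewrite gt_max => /andP[/andP[ax wx] xr].
  have h1 := Hw x; rewrite wx xr in h1; have {}h1 := h1 isT.
  have h2 := FS _ _ _ _ _ AS RF' (ltW ax) xr rb.
  have h5 : `|(K r - S r) * djump h r| <= d * `|djump h r|.
    by case: AS => h5 _ _ _; rewrite normrM ler_wpM2r // h5 // rb ltW.
  have ed : e = d * `|djump h r| + 2 * d by rewrite /d; field; rewrite gt_eqF.
  have -> : F x - (F r - K r * djump h r) = (F' x - (F' r - S r * djump h r)) -
    (F r - F x - (F' r - F' x)) + (K r - S r) * djump h r by ring.
  have := normD_le (normB_le h1 h2) h5.
  by move=> /le_trans; apply; rewrite ed addrC mulrDl mul1r.
- move=> r hr; have /andP[ar rb] := hr; apply/right_cvgP => e e0.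
  pose d := e / (`|ujump h r| + 2).
  have d4 : 0 < `|ujump h r| + 2 by rewrite ltr_wpDl.
  have d0 : 0 < d by rewrite divr_gt0.
  have [S stS AS] := H d d0; have [F' RF'] := RY_integral_step stS.
  have [_ _ _ c] := RF'; have [w wr Hw] := (right_cvgP _ _ _).1 (c r hr) d d0.
  exists (Num.min b w) => [|x]; first by rewrite lt_min rb.
  rewrite lt_min => /andP[rx /andP[xb xw]].
  have h1 := Hw x; rewrite rx xw in h1; have {}h1 := h1 isT.
  have h2 := FS _ _ _ _ _ AS RF' ar rx (ltW xb).
  have h5 : `|(rgt K r - rgt S r) * ujump h r| <= d * `|ujump h r|.
    rewrite normrM ler_wpM2r //; case: AS => h5 _ _ _.
    have := rgtD (-1) rK (stepf_regulated stS) hr.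
    rewrite (_ : (fun x => K x + -1 * S x) = fun x => K x - S x); last by apply/funext => y; ring.
    rewrite mulN1r => <-; have rD : regulated a b (fun x => K x - S x).
      apply: regulatedD => //; apply: (@eq_regulated _ _ _ (fun x => -1 * S x)).
        by move=> y _; rewrite mulN1r.
      by apply: regulatedM; [exact: regulated_cst|exact: stepf_regulated].
    have := Gplus_norm rD h5 (x := r); rewrite /Gplus rb; apply.
    by rewrite ar ltW.
  have ed : e = d * `|ujump h r| + 2 * d by rewrite /d; field; rewrite gt_eqF.
  have -> : F x - (F r + rgt K r * ujump h r) = (F' x - (F' r + rgt S r * ujump h r)) +
    (F x - F r - (F' x - F' r)) - (rgt K r - rgt S r) * ujump h r by ring.
  have := normB_le (normD_le h1 h2) h5.
  by move=> /le_trans; apply; rewrite ed addrC mulrDl mul1r.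
Qed.

Lemma ppt_mono u v xs i j : itv_partition u v xs -> (i <= j)%N -> (j <= size xs)%N ->
  ppt u xs i <= ppt u xs j.
Proof.
move=> [pxs _] ij js; move: ij; rewrite leq_eqVlt => /orP[/eqP->//|ij].
have := @lt_sorted_ltn_nth _ R u (u :: xs) pxs i j; rewrite !inE /=.
by move=> /(_ (leq_trans ij (leq_trans js (leqnSn _))) js); rewrite ij => /ltW.
Qed.

Lemma tag_mono u v xs tag i j : itv_partition u v xs -> tagged u xs tag ->
  (i <= j)%N -> (j < size xs)%N -> tag i <= tag j.
Proof.
move=> pxs txs ij js; move: ij; rewrite leq_eqVlt => /orP[/eqP->//|ij].
have /andP[_ h1] := txs i (ltn_trans ij js); have /andP[h2 _] := txs j js.
by apply: (le_trans h1); apply: le_trans h2; apply: (ppt_mono pxs) => //; exact: ltnW.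
Qed.

(** Young's theorem.  The difference between an integrand and its step approximation is
    uniformly small and still controlled, so that [young_sum] makes all its sums
    small at once. *)
Lemma RY_integral_exists om p K V V2 : young_pair om p -> regulated a b K ->
  controlled om a b K V -> controlled (Some p) a b h V2 -> exists F, RY_integral K h F.
Proof.
move=> vd rK [mV KV] [mV2 hV2]; apply: RY_integral_closure => // e e0.
have p0 : 0 < p by case: vd; lra.
have om0 : is_true (if om is Some q then 0 < q else true) by case: vd; case: (om) => // q _ [].
pose cq := if om is Some q then 2 `^ q * 2 else 0 : R.
have cq0 : 0 <= cq by rewrite /cq; case: (om) => // q; rewrite mulr_ge0 ?powR_ge0.
(* a - 1 lies strictly to the left of a, so that V (a - 1) bounds left limits at a from below *)
have a1b : a - 1 <= b by rewrite lerBlDr (le_trans (ltW ab)) // lerDl.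
have a1 x : a <= x -> a - 1 <= x by apply: le_trans; rewrite lerBlDr lerDl.
have VV : 0 <= V b - V (a - 1) by rewrite subr_ge0; exact: mV.
pose Vt := cq * (V b - V (a - 1)) + (V2 b - V2 (a - 1)).
have VV2 : 0 <= V2 b - V2 (a - 1) by rewrite subr_ge0; exact: mV2.
have Vt0 : 0 <= Vt by rewrite addr_ge0 // mulr_ge0.
pose c := e / (Vt + 1).
have Vt1 : 0 < Vt + 1 by rewrite ltr_wpDl.
have c0 : 0 < c by rewrite divr_gt0.
have Vt20 : 0 <= Vt + Vt by rewrite addr_ge0.
have [e1 e10 H1] := young_sum vd Vt20 e0; have [e2 e20 H2] := pair_bound vd Vt0 c0.
pose eta := Num.min e (Num.min e1 (e2 / 2)).
have eta0 : 0 < eta by rewrite !lt_min e0 e10 divr_gt0.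
have [etae etae1 etae2] : [/\ eta <= e, eta <= e1 & eta <= e2 / 2].
  by rewrite /eta !ge_min !lexx !orbT.
have [phi [S [stS pm pP]]] := step_approx ab rK eta0.
exists S => //; pose D x := K x - S x.
have rD : regulated a b D.
  apply: regulatedD => //; apply: (@eq_regulated _ _ _ (fun x => -1 * S x)).
    by move=> y _; rewrite mulN1r.
  by apply: regulatedM; [exact: regulated_cst|exact: stepf_regulated].
have Deta x : a <= x <= b -> `|D x| <= eta.
  by move=> hx; have [_ h1 h2] := pP x hx; rewrite /D -h2 distrC.
have cl x := clamp_in x (ltW ab).
(* K and its composition with phi, continued by constants, each contribute one copy of V *)
pose U x := if om is Some q then 2 `^ q * (V x + V (phi (clamp a b x))) else 0.
have mU : {homo U : x y / x <= y}.
  move=> x y xy; rewrite /U; case: (om) => [q|]; last by [].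
  rewrite ler_wpM2l ?powR_ge0 // lerD ?mV //.
  have /andP[h1 _] := cl x; have /andP[_ h2] := cl y.
  by apply: pm => //; exact: clamp_mono.
have DU x y : a <= x -> x <= y -> y <= b -> power_le om `|D y - D x| (U y - U x).
  move=> ax xy yb; have := KV x y ax xy yb.
  have hx : a <= x <= b by rewrite ax (le_trans xy). 
  have hy : a <= y <= b by rewrite yb (le_trans ax).
  have [/andP[px1 px2] _ px] := pP x hx; have [/andP[py1 py2] _ py] := pP y hy.
  have := KV _ _ px1 (pm x y ax xy yb) py2.
  rewrite /U /D -px -py !clamp_id //; case: om om0 {vd cq cq0 Vt Vt0 c c0 Vt1 Vt20 H1 H2 KV U mU} => //= q q0 h1 h2.
  have -> : K y - K (phi y) - (K x - K (phi x)) = (K y - K x) - (K (phi y) - K (phi x)) by ring.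
  apply: (@le_trans _ _ ((`|K y - K x| + `|K (phi y) - K (phi x)|) `^ q)).
    by apply: powR_mono => //; [exact: ltW|exact: ler_normB].
  apply: (le_trans (powRD_le (ltW q0) (normr_ge0 _) (normr_ge0 _))).
  rewrite -mulrBr ler_wpM2l ?powR_ge0 //; lra.
(* one monotone function for both K - S and h *)
pose X x := U x + V2 x.
have mX : {homo X : x y / x <= y} by move=> x y xy; rewrite lerD ?mU ?mV2.
have Xtot : X b - X (a - 1) <= Vt.
  have -> : X b - X (a - 1) = (U b - U (a - 1)) + (V2 b - V2 (a - 1)) by rewrite /X; ring.
  rewrite lerD2r /U /cq; case: (om) => [q|]; last by rewrite subrr mul0r.
  rewrite -mulrBr -mulrA ler_wpM2l ?powR_ge0 //.
  have /andP[h1 h2] := cl b; have /andP[h3 h4] := cl (a - 1).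
  have [/andP[_ h5] _ _] := pP (clamp a b b) (cl b).
  have [/andP[h6 _] _ _] := pP (clamp a b (a - 1)) (cl (a - 1)).
  have := mV _ _ h5; have : V (a - 1) <= V (phi (clamp a b (a - 1))) by exact/mV/a1.
  lra.
have DX x y : a <= x -> x <= y -> y <= b -> power_le om `|D y - D x| (X y - X x).
  move=> ax xy yb; apply: power_le_le (DU x y ax xy yb) => //; first exact: valid_ge0 vd.
  by have := mV2 _ _ xy; rewrite /X; lra.
have hX x y : a <= x -> x <= y -> y <= b -> power_le (Some p) `|h y - h x| (X y - X x).
  move=> ax xy yb; apply: (le_trans (hV2 x y ax xy yb)).
  by have := mU _ _ xy; rewrite /X; lra.
have Xin x y : a - 1 <= x -> x <= y -> y <= b -> X y - X x <= Vt.
  by move=> h1 h2 h3; apply: le_trans Xtot; apply: lerB; exact: mX.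
split.
- by move=> x hx; exact: le_trans (Deta x hx) etae.
- move=> u v xs au uv vb pxs.
  have pin i : (i <= size xs)%N -> a <= ppt u xs i <= b.
    by move=> ix; have /andP[h1 h2] := partition_ppt pxs ix; rewrite (le_trans au) // (le_trans h2).
  apply: (H1 (fun i => D (ppt u xs i)) (fun i => h (ppt u xs i)) (fun i => X (ppt u xs i))).
  + by move=> i j ij js; exact/mX/(ppt_mono pxs).
  + have /andP[h1 _] := pin 0%N isT; have /andP[_ h2] := pin (size xs) (leqnn _).
    have : X (ppt u xs (size xs)) - X (ppt u xs 0) <= Vt.
      by apply: Xin => //; [exact: a1|exact: (ppt_mono pxs)].
    lra.
  + by move=> i ix; apply: le_trans etae1; apply/Deta/pin.
  + move=> i j ij js; have /andP[h1 _] := pin i (leq_trans ij js); have /andP[_ h2] := pin j js.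
    by apply: DX => //; exact: (ppt_mono pxs).
  + move=> i j ij js; have /andP[h1 _] := pin i (leq_trans ij js); have /andP[_ h2] := pin j js.
    by apply: (hX _ _ h1 _ h2); exact: (ppt_mono pxs).
- move=> u v xs tag au uv vb pxs txs.
  have rDu : regulated u v D by exact: regulated_sub rD.
  have rhu : regulated u v h by exact: regulated_sub rh.
  have DXu x y : u <= x -> x <= y -> y <= v -> power_le om `|D y - D x| (X y - X x).
    by move=> h1 h2 h3; apply: DX => //; [exact: le_trans h1|exact: le_trans vb].
  have hXu x y : u <= x -> x <= y -> y <= v -> power_le (Some p) `|h y - h x| (X y - X x).
    by move=> h1 h2 h3; apply: hX => //; [exact: le_trans h1|exact: le_trans vb].
  have sz : (0 < size xs)%N.
    case: (xs) pxs => // -[_ /eqP uv']; by rewrite /= in uv'; rewrite uv' ltxx in uv.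
  have pred i : (i <= size xs)%N -> (i.-1 < size xs)%N by case: i.
  have pin i : (i <= size xs)%N -> u <= ppt u xs i <= v by exact: partition_ppt.
  have tin i : (i <= size xs)%N -> u <= tag i.-1 <= v.
    by move=> ix; apply: (tagged_in pxs txs); exact: pred.
  have tm i j : (i <= j)%N -> (j <= size xs)%N -> tag i.-1 <= tag j.-1.
    by move=> ij js; apply: (tag_mono pxs txs); [case: i j ij {js} => [|i] [|j]|exact: pred].
  have mG : {homo Gplus X v : x y / x <= y} by exact: Gplus_mono.
  have mH : {homo hminus X u : x y / x <= y} by exact: hminus_mono.
  (* the tag of the interval before the i-th point becomes the value at that point;
     at the index 0 the first tag is repeated *)
  apply: (H1 (fun i => Gplus D v (tag i.-1)) (fun i => hminus h u (ppt u xs i))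
     (fun i => Gplus X v (tag i.-1) + hminus X u (ppt u xs i))).
  + by move=> i j ij js; apply: lerD; [exact/mG/tm|exact/mH/(ppt_mono pxs)].
  + rewrite opprD addrACA; apply: lerD.
      have /andP[h1 h2] := tin (size xs) (leqnn _); have /andP[h3 h4] := tin 0%N isT.
      apply: le_trans Xtot; apply: lerB.
        apply: (@le_trans _ _ (Gplus X v v)); first exact: mG.
        by rewrite /Gplus ltxx mX.
      apply: (@le_trans _ _ (Gplus X v u)); last exact: mG.
      by rewrite /Gplus uv; apply: le_trans (le_rgt _ mX); exact/mX/a1.
    have /andP[h1 h2] := pin (size xs) (leqnn _); have /andP[h3 h4] := pin 0%N isT.
    apply: le_trans Xtot; apply: lerB.
      apply: (@le_trans _ _ (hminus X u v)); first exact: mH.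
      by rewrite /hminus uv (le_trans (lft_le _ mX)) // mX.
    apply: (@le_trans _ _ (hminus X u u)); last exact: mH.
    by rewrite /hminus ltxx; exact/mX/a1.
  + move=> i ix; apply: (le_trans _ etae1); apply: (Gplus_norm rDu); last exact: tin.
    move=> x /andP[h1 h2]; apply: Deta; by rewrite (le_trans au) // (le_trans h2).
  + move=> i j ij js; have /andP[h1 _] := tin i (leq_trans ij js); have /andP[_ h2] := tin j js.
    have hG := power_le_Gplus om0 rDu mX DXu h1 (tm i j ij js) h2.
    apply: power_le_le hG => //; first exact: valid_ge0 vd.
    by have := mH _ _ (ppt_mono pxs ij js); lra.
  + move=> i j ij js; have /andP[h1 _] := pin i (leq_trans ij js); have /andP[_ h2] := pin j js.
    have := power_le_hminus (om := Some p) p0 rhu mX hXu h1 (ppt_mono pxs ij js) h2.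
    by move=> /le_trans; apply; have := mG _ _ (tm i j ij js); lra.
- move=> u v A au uv vb.
  have rDu : regulated u v D by exact: regulated_sub rD.
  have rhu : regulated u v h by exact: regulated_sub rh.
  have DXu x y : u <= x -> x <= y -> y <= v -> power_le om `|D y - D x| (X y - X x).
    by move=> h1 h2 h3; apply: DX => //; [exact: le_trans h1|exact: le_trans vb].
  have hXu x y : u <= x -> x <= y -> y <= v -> power_le (Some p) `|h y - h x| (X y - X x).
    by move=> h1 h2 h3; apply: hX => //; [exact: le_trans h1|exact: le_trans vb].
  pose cu t := if u < t then ujump D t * djump h t else 0.
  pose W t := c * lft X t.
  have mW : {homo W : x y / x <= y}.
    move=> x y; rewrite /W le_eqVlt => /orP[/eqP->//|xy]; rewrite ler_wpM2l ?(ltW c0) //.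
    exact: le_trans (lft_le _ mX) (mono_le_lft mX xy).
  have tb : tail_bound u v (fun=> 0) cu W.
    apply: jump_tail_bound => //.
      move=> r /andP[ur _]; exists u => // x /andP[_ xr] _; rewrite normr0 subr_ge0 mW //.
      exact: ltW.
    move=> r /andP[ur rv]; exists v => // y /andP[ry yv] _; rewrite /cu.
    case: ltP => [ur'|_]; last by rewrite normr0 subr_ge0 mW // ltW.
    have h1 := power_le_ujump om0 rDu mX DXu ur rv.
    have h2 := power_le_djump (om := Some p) p0 rhu mX hXu ur' (ltW rv).
    have h3 := le_rgt r mX; have h4 := lft_le r mX.
    rewrite normrM; apply: (@le_trans _ _ (c * (rgt X r - lft X r))).
      apply: H2.
      - rewrite normr_ge0 /=; have d1 : `|D r| <= eta by apply: Deta; rewrite (le_trans au ur) (le_trans (ltW rv)).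
        have d2 : `|rgt D r| <= eta.
          have := Gplus_norm rDu (e := eta) _ (x := r); rewrite /Gplus rv; apply; last by rewrite ur ltW.
          by move=> x /andP[k1 k2]; apply: Deta; rewrite (le_trans au) // (le_trans k2).
        rewrite /ujump; apply: (le_trans (ler_normB _ _)); lra.
      - exact: normr_ge0.
      - apply/andP; split; first by lra.
        have k1 : rgt X r <= X b by apply: mono_ge_rgt => //; exact: lt_le_trans rv vb.
        have k2 : X (a - 1) <= lft X r by apply: mono_le_lft => //; lra.
        lra.
      - apply: power_le_le h1 => //; first exact: valid_ge0 vd.
        lra.
      - apply: (le_trans h2); lra.
    rewrite /W -mulrBr ler_wpM2l ?(ltW c0) // lerD2r.
    apply: limr_ge; first by apply/cvg_ex; eexists; exact: mono_lft.
    by apply/near_leftP; exists r => // x /andP[rx _]; exact: mono_ge_rgt.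
  have h1 := tail_right mW tb A (lexx u) uv (lexx v).
  rewrite [X in X + _]big1 ?add0r in h1; last by move=> z _; rewrite normr0.
  apply: (le_trans (ler_norm_sum _ _ _)).
  rewrite (eq_bigr (fun t => `|cu t|)); last first.
    by move=> t; rewrite in_oo /cu => /andP[-> _].
  apply: (le_trans h1); apply: (@le_trans _ _ (c * Vt)).
    apply: (@le_trans _ _ (W v - W u)); first by rewrite lerD2l lerN2 le_rgt.
    rewrite /W -mulrBr ler_wpM2l ?(ltW c0) //.
    have k1 := lft_le v mX; have k2 : X (a - 1) <= lft X u by apply: mono_le_lft => //; lra.
    have k3 := mX _ _ vb; lra.
  rewrite /c mulrAC ler_pdivrMr // ler_wpM2l ?(ltW e0) // lerDl //.
Qed.

End young_integral.

(** * Quadratic covariation *)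

Section uniqueness.
Context {R : realType} (a b : R) (lam : nat -> seq R).
Hypothesis ab : a < b.
Implicit Types (f g h K B F : R -> R) (s t u v x y I : R).

Lemma is_RY_unique K h u v I I' : is_RY K h u v I -> is_RY K h u v I' -> I = I'.
Proof.
move=> [[uv ->]|[uv _ _ [J [S [h1 h2 ->]]]]] [[uv' ->]|[uv' _ _ [J' [S' [k1 k2 ->]]]]] //.
- by move: uv'; rewrite uv ltxx.
- by move: uv; rewrite uv' ltxx.
- by rewrite (is_RRS_unique uv h1 k1) -(usum_cvg_unique h2) (usum_cvg_unique k2).
Qed.

Lemma is_qcov_unique f1 f2 B B' : is_qcov a b lam f1 f2 B -> is_qcov a b lam f1 f2 B' ->
  forall x, a <= x <= b -> B x = B' x.
Proof.
move=> [_ _ _ Ba H] [_ _ _ Ba' H'] x /andP[]; rewrite le_eqVlt => /orP[/eqP<- _|ax xb].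
  by rewrite Ba Ba'.
have [c _ _] := H a x (lexx a) ax xb; have [c' _ _] := H' a x (lexx a) ax xb.
by have := cvg_unique _ c c'; rewrite Ba Ba' !subr0; apply.
Qed.

Lemma qcovP f1 f2 : has_qcov a b lam f1 f2 -> is_qcov a b lam f1 f2 (qcov a b lam f1 f2).
Proof. by move=> h; apply: (@xgetPex _ _ [set B | is_qcov a b lam f1 f2 B] h). Qed.

Lemma qcov_eq f1 f2 B : is_qcov a b lam f1 f2 B -> forall x, a <= x <= b -> qcov a b lam f1 f2 x = B x.
Proof.
move=> hB; have h : has_qcov a b lam f1 f2 by exists B.
exact: is_qcov_unique (qcovP h) hB.
Qed.

End uniqueness.

Section covariation.
Context {R : realType} (a b : R) (lam : nat -> seq R).
Hypotheses (ab : a < b) (lamP : Lambda a b lam).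
Implicit Types (k f g h K B F W : R -> R) (s t u v x y c r : R).

Local Notation jumps_in_cup := (jumps_in_cup a b lam).
Local Notation S phi s t m := (psum phi s (restr lam s t m)).

Lemma cvg_tele (phi : R -> R -> R) B s t l :
  S (fun x y => phi x y - (B y - B x)) s t m @[m --> \oo] --> l ->
  S phi s t m @[m --> \oo] --> l + (B t - B s).
Proof.
move=> c; rewrite (_ : (fun m => _) = fun m => S (fun x y => phi x y - (B y - B x)) s t m + (B t - B s)).
  by apply: cvgD => //; exact: cvg_cst.
by apply/funext => m; rewrite psumB psum_tele restr_last subrK.
Qed.

(** The first increment is scaled below the threshold of [pair_bound]. *)
Lemma pair_bound_global om p (Vt M : R) : young_pair om p -> 0 <= Vt -> 0 <= M ->
  exists2 C, 0 < C & forall d1 d2 w, 0 <= d1 <= M -> 0 <= d2 -> 0 <= w <= Vt ->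
    power_le om d1 w -> d2 `^ p <= w -> d1 * d2 <= C * w.
Proof.
move=> vd Vt0 M0; have [e e0 H] := pair_bound vd Vt0 ltr01.
have M1 : 0 < M + 1 by rewrite ltr_wpDl.
(* at most 1, so that scaling keeps the bound on the first increment;
   at most e / (M + 1), so that the result is below e *)
pose s := Num.min 1 (e / (M + 1)).
have s0 : 0 < s by rewrite lt_min ltr01 divr_gt0.
exists s^-1; first by rewrite invr_gt0.
move=> d1 d2 w /andP[d10 d1M] d20 w0 h1 h2.
have : (d1 * s) * d2 <= 1 * w.
  apply: H => //.
  - rewrite mulr_ge0 ?(ltW s0) //=; apply: (@le_trans _ _ ((M + 1) * (e / (M + 1)))).
      apply: ler_pM => //; [exact: ltW|by rewrite (le_trans d1M) // lerDl|].
      by rewrite /s ge_min lexx orbT.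
    by rewrite mulrCA mulfV ?mulr1 // gt_eqF.
  - apply: power_le_le h1 => //; [exact: valid_ge0 vd|by rewrite mulr_ge0 // ltW|].
    by rewrite ler_piMr // /s ge_min lexx.
by rewrite mul1r mulrAC [s^-1 * w]mulrC ler_pdivlMr.
Qed.

Variables (k1 k2 W : R -> R).
Hypotheses (r1 : regulated a b k1) (r2 : regulated a b k2).
Hypothesis mW : {homo W : x y / x <= y}.

(** Jumps are limits of increments. *)
Lemma jump_local s t c : a <= s -> t <= b -> 0 <= c ->
  (forall x y, s <= x -> x <= y -> y <= t -> `|(k1 y - k1 x) * (k2 y - k2 x)| <= c * (W y - W x)) ->
  tail_bound s t (fun r => djump k1 r * djump k2 r) (fun r => ujump k1 r * ujump k2 r) (fun x => c * W x).
Proof.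
move=> as_ tb c0 H; apply: jump_tail_bound.
- by move=> x y xy; rewrite ler_wpM2l // mW.
- move=> r /andP[sr rt]; exists s => // x /andP[sx xr] _.
  have hr : a < r <= b by rewrite (le_lt_trans as_ sr) (le_trans rt tb).
  have cc : `|(k1 r - k1 z) * (k2 r - k2 z)| @[z --> r^'-] --> `|djump k1 r * djump k2 r|.
    by apply: cvg_norm; apply: cvgM; apply: cvgB; by [exact: cvg_cst|exact: reg_lft hr].
  rewrite -(cvg_lim _ cc) //; apply: limr_le; first by apply/cvg_ex; eexists; exact: cc.
  apply/near_leftP; exists x => // z /andP[xz zr].
  apply: (le_trans (H z r _ (ltW zr) rt)); first exact: le_trans (ltW sx) (ltW xz).
  by rewrite -mulrBr ler_wpM2l // lerD2l lerN2 mW // ltW.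
- move=> r /andP[sr rt]; exists t => // y /andP[ry yt] _.
  have hr : a <= r < b by rewrite (le_trans as_ sr) (lt_le_trans rt tb).
  have cc : `|(k1 z - k1 r) * (k2 z - k2 r)| @[z --> r^'+] --> `|ujump k1 r * ujump k2 r|.
    by apply: cvg_norm; apply: cvgM; apply: cvgB; by [exact: cvg_cst|exact: reg_rgt hr].
  rewrite -(cvg_lim _ cc) //; apply: limr_le; first by apply/cvg_ex; eexists; exact: cc.
  apply/near_rightP; exists y => // z /andP[rz zy].
  apply: (le_trans (H r z sr (ltW rz) _)); first exact: le_trans (ltW zy) (ltW yt).
  by rewrite -mulrBr ler_wpM2l // lerD2r mW // ltW.
Qed.

Hypotheses (n1 : jumps_in_cup k1) (n2 : jumps_in_cup k2).
Variable C : R.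
Hypothesis C0 : 0 <= C.
Hypothesis glob : forall x y, a <= x -> x <= y -> y <= b ->
  `|(k1 y - k1 x) * (k2 y - k2 x)| <= C * (W y - W x).
Hypothesis small : forall c, 0 < c -> exists2 e, 0 < e & forall x y, a <= x -> x <= y -> y <= b ->
  `|k1 y - k1 x| <= e -> `|(k1 y - k1 x) * (k2 y - k2 x)| <= c * (W y - W x).

(** Both the products of increments and the increments of their jump sums are locally
    small against [W], so that nothing but the common jumps survives. *)
Lemma jump_covariation : has_qcov a b lam k1 k2.
Proof.
pose cd r := djump k1 r * djump k2 r; pose cu r := ujump k1 r * ujump k2 r.
have mCW : {homo (fun x => C * W x) : x y / x <= y} by move=> x y xy; rewrite ler_wpM2l // mW.
have tb : tail_bound a b cd cu (fun x => C * W x) by exact: jump_local.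
pose J := jump_fun a cd cu.
have rJ : regulated a b J by exact: jump_fun_regulated mCW tb.
have dJ r : a < r <= b -> djump J r = cd r by exact: djump_jump_fun mCW tb r.
have uJ r : a <= r < b -> ujump J r = cu r by exact: ujump_jump_fun mCW tb r.
have nJ : jumps_in_cup J.
  by move=> r hr rn; rewrite dJ ?/cd ?n1 ?mul0r //; case/andP: hr => -> /ltW.
have vphi : vanishing a b lam (fun x y => (k1 y - k1 x) * (k2 y - k2 x) - (J y - J x)).
  apply: (eq_jump_limit (jump_limitB (jump_limitM (jump_limit_inc r1 n1) (jump_limit_inc r2 n2)) (jump_limit_inc rJ nJ))) => r hr.
    by rewrite dJ // subrr.
  by rewrite uJ // subrr.
have Jloc s t c : a <= s -> s < t -> t <= b -> 0 <= c -> (forall x y, s <= x -> x <= y -> y <= t ->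
    `|(k1 y - k1 x) * (k2 y - k2 x)| <= c * (W y - W x)) ->
    `|(k1 t - k1 s) * (k2 t - k2 s) - (J t - J s)| <= (c + c) * (W t - W s).
  move=> as_ st tb' c0 H; rewrite [(c + c) * _]mulrDl; apply: normB_le; first by apply: H => //; exact: ltW.
  rewrite (jump_fun_inc tb as_ (ltW st) tb'); apply: (le_trans (ler_normD _ _)).
  apply: usum_pair_le => A; rewrite mulrBr.
  exact: (jump_local as_ tb' c0 H (lexx s) st (lexx t) A).
have sm : loc_small a b (fun x y => (k1 y - k1 x) * (k2 y - k2 x) - (J y - J x))
    (fun x y => W y - W x).
  move=> e e0; have e2 : 0 < e / 2 by rewrite divr_gt0.
  have ee : e = e / 2 + e / 2 by field.
  have [d d0 Hd] := small e2; have d2 : 0 < d / 2 by rewrite divr_gt0.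
  have osc l x y : `|k1 x - l| <= d / 2 -> `|k1 y - l| <= d / 2 -> `|k1 y - k1 x| <= d.
    move=> h1 h2; have -> : k1 y - k1 x = (k1 y - l) - (k1 x - l) by ring.
    by apply: (le_trans (normB_le h2 h1)); lra.
  split=> r hr.
    have [u ur Hu] := (left_cvgP _ _ _).1 (reg_lft r1 hr) _ d2.
    exists u => // x y ux ax xy yr; rewrite ee; have rb : r <= b by case/andP: hr.
    apply: Jloc => //; [exact: le_trans (ltW yr) rb|exact: ltW|] => x' y' h1 h2 h3.
    apply: Hd => //; [exact: le_trans h1|exact: le_trans h3 (le_trans (ltW yr) rb)|].
    apply: (osc (lft k1 r)); apply: Hu; rewrite (lt_le_trans ux) /=; last 1 first.
    - exact: le_trans h2.
    - exact: le_lt_trans (le_trans h2 h3) yr.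
    - exact: h1.
    - exact: le_lt_trans h3 yr.
  have [u ur Hu] := (right_cvgP _ _ _).1 (reg_rgt r1 hr) _ d2.
  exists u => // x y rx xy yu yb; rewrite ee; have ar : a <= r by case/andP: hr.
  apply: Jloc => //; [exact: le_trans ar (ltW rx)|exact: ltW|] => x' y' h1 h2 h3.
  apply: Hd => //; [exact: le_trans (le_trans ar (ltW rx)) h1|exact: le_trans h3 yb|].
  apply: (osc (rgt k1 r)); apply: Hu; rewrite (lt_le_trans rx) /=; last 1 first.
  - exact: le_trans h2.
  - exact: le_lt_trans (le_trans h2 h3) yu.
  - exact: h1.
  - exact: le_lt_trans h3 yu.
have key : negligible a b lam (fun x y => (k1 y - k1 x) * (k2 y - k2 x) - (J y - J x)).
  apply: (negligible_small lamP vphi); apply: (small_sum lamP vphi (@eventually_le_tele _ a b lam W)) => //.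
  by move=> x y _ xy _; rewrite subr_ge0 mW // ltW.
exists J; split=> //.
  rewrite /J /jump_fun.
  have -> : `]a, a]%classic = set0 by apply/seteqP; split=> z //=; rewrite in_itv /= => /andP[/lt_le_trans h /h]; rewrite ltxx.
  have -> : `[a, a[%classic = set0 by apply/seteqP; split=> z //=; rewrite in_itv /= => /andP[/le_lt_trans h /h]; rewrite ltxx.
  by rewrite !usum0 addr0.
move=> s t as_ st tb'; split.
- case: key => _ _ /(_ s t as_ st tb') /cvg_tele; by rewrite add0r.
- by rewrite dJ // (le_lt_trans as_ st).
- by rewrite uJ // as_ (lt_le_trans st tb').
Qed.

End covariation.

Section decomposition.
Context {R : realType} (a b : R) (lam : nat -> seq R).
Hypotheses (ab : a < b) (lamP : Lambda a b lam).
Implicit Types (k f g h K B F W V : R -> R) (s t u v x y c r p : R) (om : option R).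

Local Notation jumps_in_cup := (jumps_in_cup a b lam).

(** Applies to the pair (g, h), and to (h, h) as p < 2. *)
Lemma young_covariation om p k1 k2 V1 V2 : young_pair om p -> regulated a b k1 -> regulated a b k2 ->
  jumps_in_cup k1 -> jumps_in_cup k2 -> controlled om a b k1 V1 -> controlled (Some p) a b k2 V2 ->
  has_qcov a b lam k1 k2.
Proof.
move=> vd r1 r2 n1 n2 [mV1 kV1] [mV2 kV2].
pose W x := V1 x + V2 x.
have mW : {homo W : x y / x <= y} by move=> x y xy; rewrite lerD ?mV1 ?mV2.
have W1 x y : a <= x -> x <= y -> y <= b -> power_le om `|k1 y - k1 x| (W y - W x).
  move=> ax xy yb; apply: power_le_le (kV1 x y ax xy yb) => //; first exact: valid_ge0 vd.
  by have := mV2 _ _ xy; rewrite /W; lra.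
have W2 x y : a <= x -> x <= y -> y <= b -> `|k2 y - k2 x| `^ p <= W y - W x.
  move=> ax xy yb; apply: (le_trans (kV2 x y ax xy yb)).
  by have := mV1 _ _ xy; rewrite /W; lra.
have Wt x y : a <= x -> x <= y -> y <= b -> 0 <= W y - W x <= W b - W a.
  by move=> ax xy yb; rewrite subr_ge0 mW //= lerB // mW.
have Vt0 : 0 <= W b - W a by rewrite subr_ge0 mW // ltW.
have [M M0 HM] := regulated_bounded ab r1.
have [C C0 HC] := pair_bound_global vd Vt0 (addr_ge0 (ltW M0) (ltW M0)).
apply: (jump_covariation lamP r1 r2 mW n1 n2 (ltW C0)).
  move=> x y ax xy yb; rewrite normrM; apply: HC; rewrite ?normr_ge0 ?Wt ?W2 //=; last exact: W1.
  by apply: normB_le; apply: HM; rewrite ?ax ?yb ?(le_trans xy) ?(le_trans ax).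
move=> c c0; have [e e0 He] := pair_bound vd Vt0 c0; exists e => // x y ax xy yb h.
by rewrite normrM; apply: He; rewrite ?normr_ge0 ?Wt ?W2 //=; exact: W1.
Qed.

(** The square of an increment of g + h expands into that of g and the products
    belonging to (g, h) and (h, h), which are Young pairs. *)
Lemma has_qvar_sum p f : 1 <= p -> p < 2 -> regulated a b f ->
  (exists gh, decomp_left a b lam p f gh) -> has_qvar a b lam f /\ jumps_in_cup f.
Proof.
move=> p1 p2 rf [[g h] [[[rg rh] [qg dg] Wh _ [C fC]] jumps]] /=.
have ng : jumps_in_cup g.
  move=> r hr rn; apply/eqP/negPn/negP => d; apply: rn; apply: jumps; left.
  by split.
have nh : jumps_in_cup h.
  move=> r hr rn; apply/eqP/negPn/negP => d; apply: rn; apply: jumps; right.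
  by split.
have p0 : 0 < p by lra.
have [om [V1 [vd _ c1]]] := (dualW_controlled _ p1 ab).1 dg.
have [V2 c2] := (W_controlled _ p0 ab).1 Wh.
have vp : young_pair (Some p) p.
  split=> //; split=> //; have : 2^-1 < p^-1 by rewrite ltf_pV2 ?posrE //.
  lra.
have [Bg [_ _ rBg Bg0 HBg]] := qg.
have [J1 [_ _ rJ1 J10 HJ1]] := young_covariation vd rg rh ng nh c1 c2.
have [J2 [_ _ rJ2 J20 HJ2]] := young_covariation vp rh rh nh nh c2 c2.
have dD k1 k2 c r : regulated a b k1 -> regulated a b k2 -> a < r <= b ->
    djump (fun x => k1 x + c * k2 x) r = djump k1 r + c * djump k2 r.
  move=> h1 h2 hr; rewrite /djump; have -> : lft (fun x => k1 x + c * k2 x) r = lft k1 r + c * lft k2 r.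
    apply: lft_eq; apply: cvgD; first exact: reg_lft hr.
    by apply: cvgM; [exact: cvg_cst|exact: reg_lft hr].
  by ring.
have uD k1 k2 c r : regulated a b k1 -> regulated a b k2 -> a <= r < b ->
    ujump (fun x => k1 x + c * k2 x) r = ujump k1 r + c * ujump k2 r.
  by move=> h1 h2 hr; rewrite /ujump (rgtD c h1 h2 hr); ring.
have rZ c k : regulated a b k -> regulated a b (fun x => c * k x).
  by move=> rk; apply: regulatedM => //; exact: regulated_cst.
have fE x : a <= x <= b -> (C + g x) + 1 * h x = f x by move=> hx; rewrite fC // mul1r.
have rCg : regulated a b (fun x => C + g x) by apply: regulatedD => //; exact: regulated_cst.
have rCgh : regulated a b (fun x => (C + g x) + 1 * h x) by apply: regulatedD => //; exact: rZ.
have df r : a < r <= b -> djump f r = djump g r + djump h r.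
  move=> hr; rewrite -(eq_djump rCgh hr fE) dD // mul1r; congr (_ + _).
  rewrite /djump; have -> : lft (fun x => C + g x) r = C + lft g r.
    by apply: lft_eq; apply: cvgD; [exact: cvg_cst|exact: reg_lft hr].
  ring.
have uf r : a <= r < b -> ujump f r = ujump g r + ujump h r.
  move=> hr; rewrite -(eq_ujump rCgh hr fE) uD // mul1r; congr (_ + _).
  rewrite /ujump; have -> : rgt (fun x => C + g x) r = C + rgt g r.
    by apply: rgt_eq; apply: cvgD; [exact: cvg_cst|exact: reg_rgt hr].
  ring.
split; last first.
  move=> r hr rn; rewrite df ?ng ?nh ?addr0 //; by case/andP: hr => -> /ltW.
exists (fun x => (Bg x + 2 * J1 x) + 1 * J2 x); split=> //.
- by apply: regulatedD; [apply: regulatedD => //; exact: rZ|exact: rZ].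
- by rewrite Bg0 J10 J20; ring.
have rB1 : regulated a b (fun x => Bg x + 2 * J1 x) by apply: regulatedD => //; exact: rZ.
move=> s t as_ st tb; have [c3 d3 u3] := HBg s t as_ st tb.
have [c4 d4 u4] := HJ1 s t as_ st tb; have [c5 d5 u5] := HJ2 s t as_ st tb.
have ht : a < t <= b by rewrite (le_lt_trans as_ st).
have hs : a <= s < b by rewrite as_ (lt_le_trans st).
split.
- have -> : (Bg t + 2 * J1 t + 1 * J2 t) - (Bg s + 2 * J1 s + 1 * J2 s) =
    (Bg t - Bg s) + 2 * (J1 t - J1 s) + (J2 t - J2 s) by ring.
  rewrite (_ : (fun m => _) = (fun m => psum (fun x y => (g y - g x) * (g y - g x)) s (restr lam s t m) +
    2 * psum (fun x y => (g y - g x) * (h y - h x)) s (restr lam s t m) +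
    psum (fun x y => (h y - h x) * (h y - h x)) s (restr lam s t m))).
    by apply: cvgD => //; apply: cvgD => //; apply: cvgM => //; exact: cvg_cst.
  apply/funext => m; rewrite -psumZ -!psumD; apply: eq_psum; first exact: (restr_path lamP).
  rewrite restr_last => x y sx xy yt.
  have hx : a <= x <= b by rewrite (le_trans as_ sx) (le_trans (ltW xy)) // (le_trans yt).
  have hy : a <= y <= b by rewrite (le_trans yt tb) andbT (le_trans as_) // (le_trans sx) // ltW.
  by rewrite !fC //; ring.
- by rewrite !dD // df // d3 d4 d5; ring.
- by rewrite !uD // uf // u3 u4 u5; ring.
Qed.

End decomposition.

(** * The Doleans exponential between two points *)

Section expansions.
Context {R : realType}.
Implicit Types (u x z A p r : R).

(** Compensated by exp (-u), the factor 1 + u of a jump differs from one to second order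
    only, so that summable squares of jumps are enough for convergent products. *)
Definition jump_factor u : R := (1 + u) * expR (- u).

Lemma jump_factor_dist1 u : `|jump_factor u - 1| <= u ^+ 2 * expR (2 * `|u|).
Proof.
have -> : jump_factor u - 1 = - (expR (- u) * (expR u - 1 - u)).
  by rewrite /jump_factor !mulrBr [expR (- u) * expR u]mulrC expRxMexpNx_1 mulr1; ring.
rewrite normrN normrM (ger0_norm (expR_ge0 _)) mulr_natl mulr2n expRD mulrCA mulrA.
rewrite -mulrA; apply: ler_pM => //.
  by rewrite ler_expR -normrN ler_norm.
exact: exp_taylor2.
Qed.

Lemma jump_factor_dist2 u : `|u| <= 1 ->
  `|jump_factor u - 1 + u ^+ 2 / 2| <= (1 + 2 * expR 1) * `|u| ^+ 3.
Proof.
move=> u1; have -> : jump_factor u - 1 + u ^+ 2 / 2 = u ^+ 3 / 2 +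
   (1 + u) * (expR (- u) - 1 - (- u) - (- u) ^+ 2 / 2) by rewrite /jump_factor; field.
rewrite [leRHS]mulrDl mul1r; apply: normD_le.
  by rewrite normrM normrX (@ger0_norm _ 2^-1) ?invr_ge0 // ler_piMr ?exprn_ge0 // invf_le1 // ler1n.
rewrite normrM -mulrA; apply: ler_pM => //.
  by apply: (le_trans (ler_normD _ _)); rewrite normr1; lra.
apply: (le_trans (exp_taylor3 _)); rewrite normrN mulrC ler_wpM2r ?exprn_ge0 //.
by rewrite ler_expR.
Qed.

(** The product of the two deviations from one is of order z^2 <= r z. *)
Lemma mul_first_order P P' p p' A A' r z : `|P - 1 + p| <= A * (r * z) -> `|P' - 1 + p'| <= A' * (r * z) ->
  `|p| <= z -> `|p'| <= z -> 0 <= A -> 0 <= A' -> 0 <= z -> z <= r -> r <= 1 ->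
  `|P * P' - 1 + (p + p')| <= (A + A' + (1 + A) * (1 + A')) * (r * z).
Proof.
move=> h1 h2 h3 h4 A0 A0' z0 zr r1.
have r0 : 0 <= r by exact: le_trans zr.
have -> : P * P' - 1 + (p + p') = (P - 1 + p) + (P' - 1 + p') + (P - 1) * (P' - 1) by ring.
rewrite !mulrDl; apply: normD_le; first exact: normD_le.
rewrite -!mulrDl.
have rz : r * z <= z by rewrite ler_piMl.
have b1 : `|P - 1| <= (1 + A) * z.
  have -> : P - 1 = (P - 1 + p) - p by ring.
  apply: (le_trans (normB_le h1 h3)); have := ler_wpM2l A0 rz; lra.
have b2 : `|P' - 1| <= (1 + A') * z.
  have -> : P' - 1 = (P' - 1 + p') - p' by ring.
  apply: (le_trans (normB_le h2 h4)); have := ler_wpM2l A0' rz; lra.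
rewrite normrM; apply: (le_trans (ler_pM (normr_ge0 _) (normr_ge0 _) b1 b2)).
rewrite mulrACA ler_wpM2l ?mulr_ge0 ?addr_ge0 //.
by rewrite ler_wpM2r.
Qed.

(** Here [X] is an increment of the driver and [z] one of its quadratic variation: the
    exponential contributes X + X^2 / 2 and [Q], the jumps and the continuous part
    together, contributes - z / 2. *)
Lemma exp_combine X Q z r A : `|Q - 1 + z / 2| <= A * (r * z) -> `|X| <= r -> 0 <= z -> z <= r ->
  r <= 1 -> 0 <= A ->
  `|expR X * Q - 1 - X - (X ^+ 2 - z) / 2| <= (expR 1 * (2 + A) + 3 * A + 1) * (r * (X ^+ 2 + z)).
Proof.
move=> h1 Xr z0 zr r1 A0.
have r0 : 0 <= r by exact: le_trans zr.
have X2 : X ^+ 2 = `|X| ^+ 2 by rewrite real_normK ?num_real.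
have Q2 : `|Q| <= 2 + A.
  have -> : Q = (Q - 1 + z / 2) + (1 - z / 2) by ring.
  have rz : r * z <= 1 by rewrite mulr_ile1 // (le_trans zr).
  have h2 : `|1 - z / 2| <= 2 by rewrite ler_norml; apply/andP; split; lra.
  apply: (le_trans (normD_le h1 h2)); have := ler_wpM2l A0 rz; lra.
have e3 : `|expR X - 1 - X - X ^+ 2 / 2| <= expR 1 * (r * X ^+ 2).
  apply: (le_trans (exp_taylor3 _)); rewrite mulrC; apply: ler_pM; rewrite ?expR_ge0 ?exprn_ge0 //.
    by rewrite ler_expR (le_trans Xr).
  by rewrite exprS X2 ler_wpM2r ?exprn_ge0.
have -> : expR X * Q - 1 - X - (X ^+ 2 - z) / 2 = (expR X - 1 - X - X ^+ 2 / 2) * Q +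
   (1 + X + X ^+ 2 / 2) * (Q - 1 + z / 2) - z * ((X + X ^+ 2 / 2) / 2) by field.
have Xr2 : X ^+ 2 <= r by rewrite X2 expr2 -[r]mulr1; apply: ler_pM => //; exact: le_trans r1.
have X20 : 0 <= X ^+ 2 by exact: sqr_ge0.
have t1 : `|(expR X - 1 - X - X ^+ 2 / 2) * Q| <= expR 1 * (2 + A) * (r * X ^+ 2).
  have -> : expR 1 * (2 + A) * (r * X ^+ 2) = expR 1 * (r * X ^+ 2) * (2 + A) by ring.
  by rewrite normrM; apply: ler_pM.
have t2 : `|(1 + X + X ^+ 2 / 2) * (Q - 1 + z / 2)| <= 3 * (A * (r * z)).
  rewrite normrM; apply: ler_pM => //.
  move: Xr; rewrite !ler_norml => /andP[? ?]; apply/andP; split; lra.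
have t3 : `|z * ((X + X ^+ 2 / 2) / 2)| <= z * r.
  rewrite normrM (ger0_norm z0) ler_wpM2l //.
  move: Xr; rewrite !ler_norml => /andP[? ?]; apply/andP; split; lra.
apply: (le_trans (normB_le (normD_le t1 t2) t3)).
have k1 : 0 <= expR 1 * (2 + A) * (r * z) by rewrite !mulr_ge0 ?expR_ge0 ?addr_ge0.
have k2 : 0 <= A * (r * X ^+ 2) by apply: mulr_ge0 => //; apply: mulr_ge0.
have k3 : 0 <= r * X ^+ 2 by rewrite mulr_ge0.
have -> : (expR 1 * (2 + A) + 3 * A + 1) * (r * (X ^+ 2 + z)) = expR 1 * (2 + A) * (r * X ^+ 2) +
  3 * (A * (r * z)) + z * r + (expR 1 * (2 + A) * (r * z) + 3 * (A * (r * X ^+ 2)) + r * X ^+ 2) by ring.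
by rewrite lerDl !addr_ge0 // mulr_ge0.
Qed.

End expansions.

Section propagator.
Context {R : realType} (a b : R) (lam : nat -> seq R).
Hypotheses (ab : a < b) (lamP : Lambda a b lam).
Implicit Types (s t u v x y z c r : R).

Local Notation jumps_in_cup := (jumps_in_cup a b lam).
Local Notation S phi s t m := (psum phi s (restr lam s t m)).

Variables (f B : R -> R).
Hypotheses (rf : regulated a b f) (nf : jumps_in_cup f) (qB : is_qcov a b lam f f B).

Let rB : regulated a b B. Proof. by case: qB. Qed.

Lemma qvar_mono x y : a <= x -> x <= y -> y <= b -> B x <= B y.
Proof.
move=> ax; rewrite le_eqVlt => /orP[/eqP->//|xy] yb.
case: qB => _ _ _ _ /(_ x y ax xy yb)[c _ _]; rewrite -subr_ge0 -(cvg_lim _ c) //.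
apply: limr_ge; first by apply/cvg_ex; eexists; exact: c.
apply: nearW => m; apply: psum_ge0 => [|u v _ _ _]; first exact: (restr_path lamP).
by rewrite -expr2 sqr_ge0.
Qed.

(** The quadratic variation continued by constants, to serve as a control. *)
Definition qvar_ext x := B (clamp a b x).

Lemma qvar_extE x : a <= x <= b -> qvar_ext x = B x.
Proof. by move=> h; rewrite /qvar_ext clamp_id. Qed.

Lemma qvar_ext_mono : {homo qvar_ext : x y / x <= y}.
Proof.
move=> x y xy; have /andP[h1 _] := clamp_in x (ltW ab); have /andP[_ h2] := clamp_in y (ltW ab).
by apply: qvar_mono => //; exact: clamp_mono.
Qed.

Lemma qvar_controlled : controlled (Some 1) a b B qvar_ext.
Proof.
split; first exact: qvar_ext_mono.
move=> x y ax xy yb /=; rewrite powRr1 // !qvar_extE ?ax ?yb ?(le_trans xy) ?(le_trans ax) //.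
by rewrite ger0_norm // subr_ge0; exact: qvar_mono.
Qed.

Lemma djump_qvar r : a < r <= b -> djump B r = djump f r ^+ 2.
Proof. by move=> /andP[ar rb]; case: qB => _ _ _ _ /(_ a r (lexx a) ar rb)[_ -> _]; rewrite expr2. Qed.

Lemma ujump_qvar r : a <= r < b -> ujump B r = ujump f r ^+ 2.
Proof. by move=> /andP[ar rb]; case: qB => _ _ _ _ /(_ r b ar rb (lexx b))[_ _ ->]; rewrite expr2. Qed.

Lemma qvar_jumps_in_cup : jumps_in_cup B.
Proof. by move=> r hr rn; rewrite djump_qvar ?nf ?expr0n //; case/andP: hr => -> /ltW. Qed.

Lemma djump_qvar_ext r : a < r <= b -> djump qvar_ext r = djump f r ^+ 2.
Proof.
move=> hr; rewrite -djump_qvar //; apply/esym/(eq_djump rB hr) => x hx.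
by rewrite qvar_extE.
Qed.

Lemma ujump_qvar_ext r : a <= r < b -> ujump qvar_ext r = ujump f r ^+ 2.
Proof.
move=> hr; rewrite -ujump_qvar //; apply/esym/(eq_ujump rB hr) => x hx.
by rewrite qvar_extE.
Qed.

Lemma djump_sqr_le r x : a < r <= b -> x < r -> djump f r ^+ 2 <= qvar_ext r - qvar_ext x.
Proof. by move=> hr xr; rewrite -djump_qvar_ext // /djump lerD2l lerN2; apply: mono_le_lft => //; exact: qvar_ext_mono. Qed.

Lemma ujump_sqr_le r y : a <= r < b -> r < y -> ujump f r ^+ 2 <= qvar_ext y - qvar_ext r.
Proof. by move=> hr xr; rewrite -ujump_qvar_ext // /ujump lerD2r; apply: mono_ge_rgt => //; exact: qvar_ext_mono. Qed.

(** Any function of the jumps that is dominated by their squares is summable. *)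
Lemma tail_bound_sqr s t (F : R -> R) K : a <= s -> t <= b -> 0 <= K ->
  (forall u, u ^+ 2 <= qvar_ext t - qvar_ext s -> `|F u| <= K * u ^+ 2) ->
  tail_bound s t (fun r => F (djump f r)) (fun r => F (ujump f r)) (fun x => K * qvar_ext x).
Proof.
move=> as_ tb K0 HF; apply: jump_tail_bound.
- by move=> x y xy; rewrite ler_wpM2l // qvar_ext_mono.
- move=> r /andP[sr rt]; have hr : a < r <= b by rewrite (le_lt_trans as_ sr) (le_trans rt).
  exists s => // x /andP[sx xr] _; rewrite -mulrBr.
  apply: (@le_trans _ _ (K * djump f r ^+ 2)).
    apply: HF; apply: (le_trans (djump_sqr_le hr sr)); rewrite lerD2r; exact: qvar_ext_mono.
  by rewrite ler_wpM2l // djump_sqr_le.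
- move=> r /andP[sr rt]; have hr : a <= r < b by rewrite (le_trans as_ sr) (lt_le_trans rt).
  exists t => // y /andP[ry yt] _; rewrite -mulrBr.
  apply: (@le_trans _ _ (K * ujump f r ^+ 2)).
    apply: HF; apply: (le_trans (ujump_sqr_le hr rt)); rewrite lerD2l lerN2; exact: qvar_ext_mono.
  by rewrite ler_wpM2l // ujump_sqr_le.
Qed.

Let dsq r := djump f r ^+ 2.
Let usq r := ujump f r ^+ 2.

Lemma tail_bound_jumps : tail_bound a b dsq usq qvar_ext.
Proof.
have := @tail_bound_sqr a b (fun u => u ^+ 2) 1 (lexx a) (lexx b) ler01.
rewrite (_ : (fun x => 1 * qvar_ext x) = qvar_ext); last by apply/funext => x; rewrite mul1r.
by apply => u _; rewrite mul1r ger0_norm // sqr_ge0.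
Qed.

Let Kd := expR (2 * (1 + (qvar_ext b - qvar_ext a))).
Let Kd0 : 0 <= Kd. Proof. exact: expR_ge0. Qed.

Lemma dist1_small u (z : R) : 0 <= z -> u ^+ 2 <= z -> `|u| <= 1 + z.
Proof.
move=> z0 uz; rewrite leNgt; apply/negP => h; move: uz; apply/negP; rewrite -ltNge.
rewrite -(real_normK (num_real u)); apply: (@lt_le_trans _ _ `|u|); first lra.
by rewrite expr2 ler_peMr //; lra.
Qed.

Lemma tail_bound_factors :
  tail_bound a b (fun r => dfactor f r - 1) (fun r => ufactor f r - 1) (fun x => Kd * qvar_ext x).
Proof.
apply: (@tail_bound_sqr a b (fun u => jump_factor u - 1)) => // u hu.
apply: (le_trans (jump_factor_dist1 u)); rewrite mulrC ler_wpM2r ?sqr_ge0 //.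
rewrite ler_expR ler_wpM2l //; apply: dist1_small => //.
by rewrite subr_ge0 qvar_ext_mono // ltW.
Qed.

Let mKB : {homo (fun x => Kd * qvar_ext x) : x y / x <= y}.
Proof. by move=> x y xy; rewrite ler_wpM2l // qvar_ext_mono. Qed.

Definition cont_qvar t := B t - usum `]a, t]%classic dsq - usum `[a, t[%classic usq.

(** The Doleans exponential with both end points free: the backward solution with the value
    one at [y]. *)
Definition propagator x y := expR (f y - f x - 2^-1 * cont_qvar y + 2^-1 * cont_qvar x) *
  jump_prod (dfactor f) (ufactor f) x y.

Lemma cont_qvarE t : cont_qvar t = B t - jump_fun a dsq usq t.
Proof. by rewrite /cont_qvar /jump_fun opprD addrA. Qed.

(** The squares of the jumps are only a part of the quadratic variation. *)
Lemma cont_qvar_inc x y : a <= x -> x <= y -> y <= b -> 0 <= cont_qvar y - cont_qvar x <= B y - B x.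
Proof.
move=> ax xy yb; have yB : a <= y <= b by rewrite yb (le_trans ax).
have xB : a <= x <= b by rewrite ax (le_trans xy).
have -> : cont_qvar y - cont_qvar x = (B y - B x) - (jump_fun a dsq usq y - jump_fun a dsq usq x) by rewrite !cont_qvarE; ring.
have := jump_fun_inc_le tail_bound_jumps ax xy yb; rewrite !qvar_extE // => h.
rewrite subr_ge0 gerBl (le_trans (ler_norm _) h) /=.
rewrite (jump_fun_inc tail_bound_jumps ax xy yb) addr_ge0 //.
  by apply: (usum_ge0 (fin_bounded_oc tail_bound_jumps ax xy yb)) => t; exact: sqr_ge0.
by apply: (usum_ge0 (fin_bounded_co tail_bound_jumps ax xy yb)) => t; exact: sqr_ge0.
Qed.

Lemma propagator_mul x y z : a <= x -> x <= y -> y <= z -> z <= b -> propagator x z = propagator x y * propagator y z.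
Proof.
move=> ax xy yz zb; rewrite /propagator (jump_prod_mul tail_bound_factors ax xy yz zb).
rewrite [RHS]mulrACA -expRD; congr (expR _ * _); ring.
Qed.

Lemma propagator_refl x : propagator x x = 1.
Proof.
rewrite /propagator /jump_prod.
have -> : `]x, x]%classic = set0 by apply/seteqP; split=> z //=; rewrite in_itv /= => /andP[/lt_le_trans h /h]; rewrite ltxx.
have -> : `[x, x[%classic = set0 by apply/seteqP; split=> z //=; rewrite in_itv /= => /andP[/le_lt_trans h /h]; rewrite ltxx.
by rewrite !uprod0 !mulr1 -[RHS]expR0; congr expR; ring.
Qed.

Lemma propagator_bounded : exists2 M, 1 <= M & forall x y, a <= x -> x <= y -> y <= b -> `|propagator x y| <= M.
Proof.
have [N N0 HN] := regulated_bounded ab rf.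
exists (expR (N + N) * expR (Kd * qvar_ext b - Kd * qvar_ext a)).
  by rewrite -expRD -expR0 ler_expR; have := mKB (ltW ab); lra.
move=> x y ax xy yb; have hx : a <= x <= b by rewrite ax (le_trans xy).
have hy : a <= y <= b by rewrite yb (le_trans ax).
rewrite /propagator normrM (ger0_norm (expR_ge0 _)); apply: ler_pM; rewrite ?expR_ge0 //.
  rewrite ler_expR; have /andP[c1 _] := cont_qvar_inc ax xy yb.
  have := le_trans (ler_norm _) (normB_le (HN y hy) (HN x hx)); lra.
have h1 := jump_prod_dist1 tail_bound_factors ax xy yb.
set P := jump_prod _ _ _ _ in h1 *.
have -> : P = (P - 1) + 1 by ring.
apply: (le_trans (ler_normD _ _)); rewrite normr1 -lerBrDr; apply: (le_trans h1).
rewrite lerD2r ler_expR; apply: lerB; exact: mKB.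
Qed.

Lemma cont_qvar_left r : a < r <= b -> cont_qvar x @[x --> r^'-] --> cont_qvar r.
Proof.
move=> hr; rewrite (funext cont_qvarE).
have -> : B r - jump_fun a dsq usq r = lft B r - (jump_fun a dsq usq r - dsq r).
  by rewrite /dsq -djump_qvar // /djump; ring.
apply: cvgB; first exact: reg_lft hr.
by apply: (jump_fun_left qvar_ext_mono tail_bound_jumps).
Qed.

Lemma cont_qvar_right r : a <= r < b -> cont_qvar x @[x --> r^'+] --> cont_qvar r.
Proof.
move=> hr; rewrite (funext cont_qvarE).
have -> : B r - jump_fun a dsq usq r = rgt B r - (jump_fun a dsq usq r + usq r).
  by rewrite /usq -ujump_qvar // /ujump; ring.
apply: cvgB; first exact: reg_rgt hr.
by apply: (jump_fun_right qvar_ext_mono tail_bound_jumps).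
Qed.

Lemma propagator_left r : a < r <= b -> propagator x r @[x --> r^'-] --> 1 + djump f r.
Proof.
move=> hr; have -> : 1 + djump f r = expR (djump f r) * dfactor f r.
  by rewrite /dfactor mulrCA expRxMexpNx_1 mulr1.
apply: cvgM; last exact: (jump_prod_left mKB tail_bound_factors).
apply: continuous_cvg; first exact: continuous_expR.
have -> : djump f r = f r - lft f r - 2^-1 * cont_qvar r + 2^-1 * cont_qvar r by rewrite /djump; ring.
apply: cvgD; last by apply: cvgM; [exact: cvg_cst|exact: cont_qvar_left].
by apply: cvgB; [apply: cvgB; [exact: cvg_cst|exact: reg_lft hr]|exact: cvg_cst].
Qed.

Lemma propagator_right r : a <= r < b -> propagator r y @[y --> r^'+] --> 1 + ujump f r.
Proof.
move=> hr; have -> : 1 + ujump f r = expR (ujump f r) * ufactor f r.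
  by rewrite /ufactor mulrCA expRxMexpNx_1 mulr1.
apply: cvgM; last exact: (jump_prod_right mKB tail_bound_factors).
apply: continuous_cvg; first exact: continuous_expR.
have -> : ujump f r = rgt f r - f r - 2^-1 * cont_qvar r + 2^-1 * cont_qvar r by rewrite /ujump; ring.
apply: cvgD; last exact: cvg_cst.
apply: cvgB; last by apply: cvgM; [exact: cvg_cst|exact: cont_qvar_right].
by apply: cvgB; [exact: reg_rgt hr|exact: cvg_cst].
Qed.

Lemma propagator_jump_limit : jump_limit a b lam propagator (fun r => 1 + djump f r) (fun r => 1 + ujump f r).
Proof.
split=> r hr; [exact: propagator_left|exact: propagator_right|move=> rn].
have [ar rb] := andP hr.
have h1 : a < r <= b by rewrite ar ltW.
have h2 : a <= r < b by rewrite rb ltW.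
have -> : 1 + ujump f r = (1 + djump f r) * (1 + ujump f r) by rewrite nf // addr0 mul1r.
have c : propagator z.1 r * propagator r z.2 @[z --> filter_prod r^'- r^'+] -->
    (1 + djump f r) * (1 + ujump f r).
  apply: cvgM.
    by apply: (@cvg_comp _ _ _ fst (fun x => propagator x r) _ r^'-); [exact: cvg_fst|exact: propagator_left].
  by apply: (@cvg_comp _ _ _ snd (fun x => propagator r x) _ r^'+); [exact: cvg_snd|exact: propagator_right].
apply: cvg_trans c; apply: near_eq_cvg.
exists ([set x | a < x < r], [set y | r < y < b]).
  by split; [apply/near_leftP; exists a|apply/near_rightP; exists b].
move=> [x y] /= [/andP[/ltW ax /ltW xr] /andP[/ltW ry /ltW yb]].
by rewrite -propagator_mul.
Qed.

End propagator.

(** * Expansion of the exponential over one step *)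

Section expansion_uprod.
Context {R : realType}.
Implicit Types (z r : R).

(** Each factor is 1 - u^2 / 2 to third order, and cubes of small jumps are small multiples
    of squares. *)
Lemma uprod_expand (D : set R) (u : R -> R) z r : fin_bounded D (fun t => u t ^+ 2) z ->
  0 <= r -> r <= 1 -> z <= r ^+ 2 ->
  `|uprod D (fun t => jump_factor (u t)) - 1 + 2^-1 * usum D (fun t => u t ^+ 2)| <=
  (expR 2 ^+ 2 * expR (expR 2) + (1 + 2 * expR 1)) * (r * z).
Proof.
move=> H r0 r1 zr; have z0 := fin_bounded_ge0 H.
have zr1 : z <= r by rewrite (le_trans zr) // expr2 ler_piMr.
have u2 t : t \in D -> u t ^+ 2 <= z.
  move=> tD; have := H [fset t]%fset; rewrite big_mkcond big_seq_fset1 tD.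
  by rewrite ger0_norm // sqr_ge0.
have ur t : t \in D -> `|u t| <= r.
  move=> /u2 h; rewrite -(ler_pXn2r (n := 2)) ?nnegrE // real_normK ?num_real //.
  exact: le_trans zr.
have dom c K : 0 <= K -> (forall t, t \in D -> `|c t| <= K * u t ^+ 2) -> fin_bounded D c (K * z).
  move=> K0 h A; apply: (@le_trans _ _ (\sum_(t <- A | t \in D) K * u t ^+ 2)).
    by apply: ler_sum => t; exact: h.
  rewrite -mulr_sumr ler_wpM2l //; apply: le_trans (H A); apply: ler_sum => t _.
  exact: ler_norm.
have b1 : fin_bounded D (fun t => jump_factor (u t) - 1) (expR 2 * z).
  apply: dom => [|t tD]; first exact: expR_ge0.
  apply: (le_trans (jump_factor_dist1 _)); rewrite mulrC ler_wpM2r ?sqr_ge0 //.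
  by rewrite ler_expR -[leRHS]mulr1 ler_wpM2l // (le_trans (ur _ tD)).
have b2 : fin_bounded D (fun t => jump_factor (u t) - 1 + u t ^+ 2 / 2) ((1 + 2 * expR 1) * r * z).
  apply: dom => [|t tD]; first by rewrite mulr_ge0 // addr_ge0 // mulr_ge0 // expR_ge0.
  apply: (le_trans (jump_factor_dist2 (le_trans (ur _ tD) r1))); rewrite -mulrA.
  rewrite ler_wpM2l ?addr_ge0 ?mulr_ge0 ?expR_ge0 // exprS real_normK ?num_real //.
  by rewrite ler_wpM2r ?sqr_ge0 // ur.
have b3 : fin_bounded D (fun t => (- 2^-1) * u t ^+ 2) (2^-1 * z).
  by apply: dom => // t _; rewrite normrM normrN !ger0_norm ?sqr_ge0.
have e : usum D (fun t => jump_factor (u t) - 1) =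
    usum D (fun t => jump_factor (u t) - 1 + u t ^+ 2 / 2) - 2^-1 * usum D (fun t => u t ^+ 2).
  rewrite -mulNr -(usumZ _ H) -(usumD b2 b3); congr (usum D _).
  by apply/funext => t; field.
have h1 := uprod_dist2 b1; have h2 := usum_le b2; move: h1 h2; rewrite e.
set P := uprod _ _; set s2 := usum _ (fun t => _ + _); set s3 := usum _ _ => h1 h2.
have -> : P - 1 + 2^-1 * s3 = (P - 1 - (s2 - 2^-1 * s3)) + s2 by ring.
rewrite mulrDl; apply: normD_le; last by rewrite mulrA.
apply: (le_trans h1); have -> : (expR 2 * z) ^+ 2 * expR (expR 2 * z) =
  expR 2 ^+ 2 * (expR (expR 2 * z) * z ^+ 2) by ring.
rewrite -[leRHS]mulrA ler_wpM2l ?exprn_ge0 ?expR_ge0 //; apply: ler_pM; rewrite ?expR_ge0 ?sqr_ge0 //.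
  by rewrite ler_expR -[leRHS]mulr1 ler_wpM2l ?expR_ge0 // (le_trans zr1).
by rewrite expr2 ler_wpM2r.
Qed.

End expansion_uprod.

Section propagator_estimates.
Context {R : realType} (a b : R) (lam : nat -> seq R).
Hypotheses (ab : a < b) (lamP : Lambda a b lam).
Implicit Types (s t u v x y z c r : R).

Local Notation jumps_in_cup := (jumps_in_cup a b lam).
Local Notation S phi s t m := (psum phi s (restr lam s t m)).

Variables (f B : R -> R).
Hypotheses (rf : regulated a b f) (nf : jumps_in_cup f) (qB : is_qcov a b lam f f B).

Let rB : regulated a b B. Proof. by case: qB. Qed.
Let pg := propagator a f B.

(** Ito's formula for one step.  However [B] splits into a continuous part and jumps, the
    three factors of the propagator together contribute half of its increment. *)
Lemma propagator_expand : exists2 C, 0 <= C & forall x y r, a <= x -> x <= y -> y <= b ->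
  `|f y - f x| <= r -> r <= 1 -> B y - B x <= r ^+ 2 ->
  `|pg x y - 1 - (f y - f x) - ((f y - f x) ^+ 2 - (B y - B x)) / 2| <=
  C * (r * ((f y - f x) ^+ 2 + (B y - B x))).
Proof.
(* constants for one jump product, for both, and for these with the continuous part *)
pose A : R := expR 2 ^+ 2 * expR (expR 2) + (1 + 2 * expR 1).
have A0 : 0 <= A by rewrite /A addr_ge0 ?mulr_ge0 ?exprn_ge0 ?expR_ge0 // addr_ge0 // mulr_ge0 ?expR_ge0.
pose A2 := A + A + (1 + A) * (1 + A).
have A20 : 0 <= A2 by rewrite /A2 !addr_ge0 // mulr_ge0 // addr_ge0.
pose A3 := expR 1 + A2 + (1 + expR 1) * (1 + A2).
have e0 : 0 <= expR 1 :> R by exact: expR_ge0.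
have A30 : 0 <= A3 by rewrite /A3 !addr_ge0 // mulr_ge0 // addr_ge0.
exists (expR 1 * (2 + A3) + 3 * A3 + 1).
  by rewrite !addr_ge0 // mulr_ge0 // addr_ge0.
move=> x y r ax xy yb Xr r1; set z := B y - B x => zr2.
have r0 : 0 <= r by exact: le_trans Xr.
have z0 : 0 <= z by rewrite subr_ge0; exact: (qvar_mono lamP qB).
have zr : z <= r by rewrite (le_trans zr2) // expr2 ler_piMr.
have hx : a <= x <= b by rewrite ax (le_trans xy).
have hy : a <= y <= b by rewrite yb (le_trans ax).
have tbj := tail_bound_jumps ab lamP qB.
have zE : qvar_ext a b B y - qvar_ext a b B x = z by rewrite !qvar_extE.
have f1 := fin_bounded_oc tbj ax xy yb; have f2 := fin_bounded_co tbj ax xy yb.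
rewrite zE in f1 f2.
have /andP[c1 c2] := cont_qvar_inc ab lamP qB ax xy yb.
have cE : cont_qvar a f B y - cont_qvar a f B x = z - usum `]x, y]%classic (fun t => djump f t ^+ 2) -
    usum `[x, y[%classic (fun t => ujump f t ^+ 2).
  rewrite !cont_qvarE /z; have := jump_fun_inc tbj ax xy yb; lra.
have g1 := uprod_expand f1 r0 r1 zr2; have g2 := uprod_expand f2 r0 r1 zr2.
rewrite -/A in g1 g2.
have v1 := usum_ge0 f1 (fun t => sqr_ge0 _); have v2 := usum_ge0 f2 (fun t => sqr_ge0 _).
have w1 := le_trans (ler_norm _) (usum_le f1); have w2 := le_trans (ler_norm _) (usum_le f2).
move: cE v1 v2 w1 w2 g1 g2.
set V1 := usum _ _; set V2 := usum _ _ => cE v1 v2 w1 w2 g1 g2.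
have P1 : `|2^-1 * V1| <= z by rewrite ger0_norm; lra.
have P2 : `|2^-1 * V2| <= z by rewrite ger0_norm; lra.
have g3 := mul_first_order g1 g2 P1 P2 A0 A0 z0 zr r1.
rewrite -/A2 in g3.
pose q := 2^-1 * (cont_qvar a f B y - cont_qvar a f B x).
have g4 : `|expR (- q) - 1 + q| <= expR 1 * (r * z).
  have q0 : 0 <= q by rewrite mulr_ge0.
  have qz : q <= z by rewrite /q; move: c1 c2; rewrite -/z => c1 c2; lra.
  have := exp_taylor2 (- q); rewrite opprK => h; apply: (le_trans h).
  rewrite mulrC sqrrN; apply: ler_pM; rewrite ?expR_ge0 ?sqr_ge0 //.
    by rewrite ler_expR normrN ger0_norm // (le_trans qz) // (le_trans zr).
  by rewrite expr2; apply: ler_pM => //; exact: le_trans zr.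
have P3 : `|q| <= z by rewrite /q ger0_norm ?mulr_ge0 //; move: c1 c2; rewrite -/z => c1 c2; lra.
have P4 : `|2^-1 * V1 + 2^-1 * V2| <= z by rewrite ger0_norm; lra.
have g5 := mul_first_order g4 g3 P3 P4 e0 A20 z0 zr r1.
rewrite -/A3 in g5.
have qE : q + (2^-1 * V1 + 2^-1 * V2) = z / 2 by rewrite /q cE; field.
rewrite qE in g5.
have := exp_combine g5 Xr z0 zr r1 A30.
suff <- : pg x y = expR (f y - f x) * (expR (- q) *
  (uprod `]x, y]%classic (fun t => jump_factor (djump f t)) * uprod `[x, y[%classic (fun t => jump_factor (ujump f t)))) by [].
rewrite mulrA -expRD /pg /propagator /jump_prod; congr (expR _ * _); rewrite /q; ring.
Qed.

(** This transfers the controls of the driver to the propagator in either variable. *)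
Lemma propagator_dist : exists2 L, 0 <= L & forall x y, a <= x -> x <= y -> y <= b ->
  `|pg x y - 1| <= L * (`|f y - f x| + `|B y - B x|).
Proof.
have [N N0 HN] := regulated_bounded ab rf.
pose T := B b - B a; have T0 : 0 <= T by rewrite subr_ge0 (qvar_mono lamP qB) // ltW.
pose Kd := expR (2 * (1 + (qvar_ext a b B b - qvar_ext a b B a))).
have Kd0 : 0 <= Kd by exact: expR_ge0.
exists (expR (N + N + T) * expR (Kd * T) + Kd * expR (Kd * T)).
  by rewrite addr_ge0 // mulr_ge0 ?expR_ge0.
move=> x y ax xy yb; set z := B y - B x.
have z0 : 0 <= z by rewrite subr_ge0; exact: (qvar_mono lamP qB).
have hx : a <= x <= b by rewrite ax (le_trans xy).
have hy : a <= y <= b by rewrite yb (le_trans ax).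
have zT : z <= T.
  by apply: lerB; apply: (qvar_mono lamP qB) => //; case/andP: hx hy => ? ? /andP[].
have := jump_prod_dist1 (tail_bound_factors ab lamP qB) ax xy yb.
rewrite -/Kd -mulrBr !qvar_extE // -/z; set P := jump_prod _ _ _ _ => hP.
have /andP[c1 c2] := cont_qvar_inc ab lamP qB ax xy yb; rewrite -/z in c2.
pose q := f y - f x - 2^-1 * (cont_qvar a f B y - cont_qvar a f B x).
have Kz : Kd * z <= Kd * T by exact: ler_wpM2l.
have Kz0 : 0 <= Kd * z by exact: mulr_ge0.
have eK : expR (Kd * z) - 1 <= Kd * z * expR (Kd * T).
  apply: (le_trans (ler_norm _)); apply: (le_trans (exp_taylor1 _)).
  by rewrite ger0_norm // ler_wpM2l // ler_expR.
have P1 : `|P| <= expR (Kd * T).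
  have -> : P = (P - 1) + 1 by ring.
  apply: (le_trans (ler_normD _ _)); rewrite normr1 -lerBrDr; apply: (le_trans hP).
  by rewrite lerD2r ler_expR.
have q1 : `|q| <= `|f y - f x| + z.
  apply: normB_le => //; rewrite ger0_norm ?mulr_ge0 //; lra.
have q2 : `|q| <= N + N + T by apply: (le_trans q1); apply: lerD => //; apply: normB_le; exact: HN.
have q3 : `|expR q - 1| <= (`|f y - f x| + z) * expR (N + N + T).
  apply: (le_trans (exp_taylor1 _)); apply: ler_pM => //; rewrite ?expR_ge0 //.
  by rewrite ler_expR.
have -> : pg x y - 1 = (expR q - 1) * P + (P - 1).
  have -> : pg x y = expR q * P; last by ring.
  by rewrite /pg /propagator -/P /q; congr (expR _ * _); ring.
rewrite (ger0_norm z0) [leRHS]mulrDl; apply: normD_le.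
  rewrite normrM; have -> : expR (N + N + T) * expR (Kd * T) * (`|f y - f x| + z) =
    (`|f y - f x| + z) * expR (N + N + T) * expR (Kd * T) by ring.
  exact: ler_pM.
apply: (le_trans hP); apply: (le_trans eK).
have -> : Kd * z * expR (Kd * T) = Kd * expR (Kd * T) * z by ring.
by rewrite ler_wpM2l ?mulr_ge0 ?expR_ge0 // lerDr.
Qed.

Definition propagator_error x y := pg x y - 1 - (f y - f x).

Let w x y := (f y - f x) ^+ 2 + (B y - B x).

Let ev_sq : eventually_le a b lam (fun x y => (f y - f x) ^+ 2) B.
Proof.
apply: eventually_le_cvg => s t as_ st tb; case: qB => _ _ _ _ /(_ s t as_ st tb)[c _ _].
by rewrite (_ : (fun m => _) = (fun m => S (fun x y => (f y - f x) * (f y - f x)) s t m)).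
Qed.

Let ev_w : eventually_le a b lam w (fun x => B x + B x).
Proof. by apply: eventually_leD; [exact: ev_sq|exact: eventually_le_tele]. Qed.

Let w_ge0 x y : a <= x -> x < y -> y <= b -> 0 <= w x y.
Proof.
by move=> ax xy yb; rewrite addr_ge0 ?sqr_ge0 // subr_ge0 (qvar_mono lamP qB) // ltW.
Qed.

Let nB : jumps_in_cup B. Proof. exact: qvar_jumps_in_cup qB. Qed.

Lemma vanishing_sq_qvar : vanishing a b lam (fun x y => (f y - f x) ^+ 2 - (B y - B x)).
Proof.
have j1 := jump_limit_inc rf nf.
apply: (eq_jump_limit (jump_limitB (jump_limitM j1 j1) (jump_limit_inc rB nB))) => r hr.
  by rewrite (djump_qvar qB) // expr2 subrr.
by rewrite (ujump_qvar qB) // expr2 subrr.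
Qed.

(** Sums of squared increments converge to increments of the quadratic variation, and
    their absolute values are bounded by those. *)
Lemma negligible_sq_qvar : negligible a b lam (fun x y => (f y - f x) ^+ 2 - (B y - B x)).
Proof.
split; first exact: vanishing_sq_qvar.
  exists (fun x => B x + B x); apply: (eventually_le_le lamP ev_w) => x y ax xy yb.
  apply: (le_trans (ler_normB _ _)); rewrite /w !ger0_norm ?sqr_ge0 // subr_ge0.
  by apply: (qvar_mono lamP qB) => //; exact: ltW.
move=> s t as_ st tb; case: qB => _ _ _ _ /(_ s t as_ st tb)[c _ _].
rewrite -[0](subrr (B t - B s)).
rewrite (_ : (fun m => _) = (fun m => S (fun x y => (f y - f x) * (f y - f x)) s t m - (B t - B s))).
  by apply: cvgB => //; exact: cvg_cst.
by apply/funext => m; rewrite psumB psum_tele restr_last.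
Qed.

Lemma vanishing_error : vanishing a b lam propagator_error.
Proof.
apply: (eq_jump_limit (jump_limitB (jump_limitB (propagator_jump_limit ab lamP rf nf qB) (jump_limit_cst a b lam 1)) (jump_limit_inc rf nf))) => r _; ring.
Qed.

Lemma small_osc rho : 0 < rho ->
  (forall r, a < r <= b -> exists2 u, u < r & forall x y,
     u < x -> a <= x -> x < y -> y < r -> `|f y - f x| <= rho /\ B y - B x <= rho) /\
  (forall r, a <= r < b -> exists2 u, r < u & forall x y,
     r < x -> x < y -> y < u -> y <= b -> `|f y - f x| <= rho /\ B y - B x <= rho).
Proof.
move=> r0; have e0 : 0 < rho / 2 by exact: divr_gt0.
have key (k : R -> R) l x y : `|k x - l| <= rho / 2 -> `|k y - l| <= rho / 2 -> `|k y - k x| <= rho.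
  move=> h1 h2; have -> : k y - k x = (k y - l) - (k x - l) by ring.
  by apply: (le_trans (normB_le h2 h1)); lra.
split=> r hr.
  have /left_cvgP /(_ _ e0)[u1 u1r H1] := reg_lft rf hr.
  have /left_cvgP /(_ _ e0)[u2 u2r H2] := reg_lft rB hr.
  exists (Num.max u1 u2); first by rewrite gt_max u1r.
  move=> x y; rewrite gt_max => /andP[x1 x2] _ xy yr; split.
    apply: (key f (lft f r)); apply: H1; rewrite ?x1 ?yr ?(lt_trans xy) //.
    by rewrite (lt_trans x1).
  apply: (le_trans (ler_norm _)); apply: (key B (lft B r)); apply: H2; rewrite ?x2 ?yr ?(lt_trans xy) //.
  by rewrite (lt_trans x2).
have /right_cvgP /(_ _ e0)[u1 u1r H1] := reg_rgt rf hr.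
have /right_cvgP /(_ _ e0)[u2 u2r H2] := reg_rgt rB hr.
exists (Num.min u1 u2); first by rewrite lt_min u1r.
move=> x y rx xy; rewrite lt_min => /andP[y1 y2] _; split.
  apply: (key f (rgt f r)); apply: H1; rewrite ?rx ?y1 ?(lt_trans rx) //.
  by rewrite (lt_trans xy).
apply: (le_trans (ler_norm _)); apply: (key B (rgt B r)); apply: H2; rewrite ?rx ?y2 ?(lt_trans rx) //.
by rewrite (lt_trans xy).
Qed.

Lemma loc_small_osc phi c : 0 < c -> 
  (forall x y r, a <= x -> x < y -> y <= b -> 0 <= r -> r <= 1 -> `|f y - f x| <= r ->
      B y - B x <= r ^+ 2 -> `|phi x y| <= c * r * w x y) -> loc_small a b phi w.
Proof.
move=> c0 H e e0.
pose r0 := Num.min 1 (e / c).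
have r00 : 0 < r0 by rewrite lt_min ltr01 divr_gt0.
have r01 : r0 <= 1 by rewrite /r0 ge_min lexx.
have cr0 : c * r0 <= e by rewrite mulrC -ler_pdivlMr // /r0 ge_min lexx orbT.
have r2 : r0 ^+ 2 <= r0 by rewrite expr2 ler_piMr // ltW.
have [L1 L2] := small_osc (exprn_gt0 2 r00).
have fin x y : a <= x -> x < y -> y <= b -> `|f y - f x| <= r0 ^+ 2 /\ B y - B x <= r0 ^+ 2 ->
    `|phi x y| <= e * w x y.
  move=> ax xy yb [h1 h2]; apply: (@le_trans _ _ (c * r0 * w x y)).
    by apply: H => //; rewrite ?(ltW r00) // (le_trans h1).
  by rewrite ler_wpM2r // w_ge0.
split=> r hr.
  have [u ur Hu] := L1 r hr; exists u => // x y ux ax xy yr.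
  apply: fin => //; last exact: Hu.
  by case/andP: hr => _; apply: le_trans; exact: ltW.
have [u ur Hu] := L2 r hr; exists u => // x y rx xy yu yb.
apply: fin => //; last exact: Hu.
by case/andP: hr => ar _; apply: (le_trans ar); exact: ltW.
Qed.

(** The second-order part of the error is half of [negligible_sq_qvar], the rest is of third
    order. *)
Lemma negligible_error : negligible a b lam propagator_error.
Proof.
have [C C0 HC] := propagator_expand.
pose phi x y := propagator_error x y - 2^-1 * ((f y - f x) ^+ 2 - (B y - B x)).
have n1 : negligible a b lam (fun x y => 2^-1 * ((f y - f x) ^+ 2 - (B y - B x))).
  exact: (negligible_weight lamP negligible_sq_qvar (regulated_cst a b (2^-1)) ab).
have vphi : vanishing a b lam phi.
  case: n1 => n1 _ _; apply: (eq_jump_limit (jump_limitB vanishing_error n1)) => r _; by rewrite subrr.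
have n2 : negligible a b lam phi.
  apply: (negligible_small lamP vphi); apply: (small_sum lamP vphi ev_w w_ge0).
  apply: (@loc_small_osc _ (C + 1)); first by rewrite ltr_wpDl.
  move=> x y r ax xy yb r0 r1 h1 h2.
  have -> : phi x y = pg x y - 1 - (f y - f x) - ((f y - f x) ^+ 2 - (B y - B x)) / 2.
    by rewrite /phi /propagator_error [2^-1 * _]mulrC.
  apply: (le_trans (HC _ _ _ ax (ltW xy) yb h1 r1 h2)); rewrite -mulrA.
  by rewrite ler_wpM2r ?lerDl // mulr_ge0 // w_ge0.
have -> : propagator_error = (fun x y => phi x y + 2^-1 * ((f y - f x) ^+ 2 - (B y - B x))).
  by apply/funext => x; apply/funext => y; rewrite /phi subrK.
exact: negligibleD.
Qed.

(** The error is bounded by squares, so that its square is a small multiple of squares. *)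
Lemma error_sq_sum s t : a <= s -> s < t -> t <= b ->
  S (fun x y => propagator_error x y ^+ 2) s t m @[m --> \oo] --> 0.
Proof.
move=> as_ st tb; have [C C0 HC] := propagator_expand.
have v2 : vanishing a b lam (fun x y => propagator_error x y ^+ 2).
  have h := jump_limitM vanishing_error vanishing_error; apply: (eq_jump_limit h) => r _; exact: mul0r.
have := small_sum lamP v2 ev_w w_ge0 _ as_ st tb.
rewrite (_ : (fun m => S (fun x y => `|propagator_error x y ^+ 2|) s t m) = (fun m => S (fun x y => propagator_error x y ^+ 2) s t m)).
  apply; apply: (@loc_small_osc _ ((1 + C) ^+ 2 * 2)).
    by rewrite mulr_gt0 // exprn_gt0 // ltr_pwDl.
  move=> x y r ax xy yb r0 r1 h1 h2.
  have w0 := w_ge0 ax xy yb; have wr : w x y <= 2 * r.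
    have r2 : r ^+ 2 <= r by rewrite expr2 ler_piMr.
    have : (f y - f x) ^+ 2 <= r ^+ 2.
      by rewrite -(real_normK (num_real (f y - f x))) ler_sqr ?nnegrE.
    by rewrite /w; lra.
  have B0 : 0 <= B y - B x by rewrite subr_ge0 (qvar_mono lamP qB) // ltW.
  have h3 : `|propagator_error x y| <= (1 + C) * w x y.
    have -> : propagator_error x y = (propagator_error x y - ((f y - f x) ^+ 2 - (B y - B x)) / 2) +
      ((f y - f x) ^+ 2 - (B y - B x)) / 2 by ring.
    rewrite [leRHS]mulrDl mul1r [leRHS]addrC; apply: normD_le.
      apply: (le_trans (HC _ _ _ ax (ltW xy) yb h1 r1 h2)).
      by rewrite ler_wpM2l // -/(w x y) ler_piMl.
    rewrite ler_norml; have := sqr_ge0 (f y - f x); rewrite /w => s0; apply/andP; split; lra.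
  rewrite normrX; apply: (@le_trans _ _ (((1 + C) * w x y) ^+ 2)).
    by rewrite ler_sqr ?nnegrE // mulr_ge0 // addr_ge0.
  have -> : (1 + C) ^+ 2 * 2 * r * w x y = (1 + C) ^+ 2 * (2 * r * w x y) by ring.
  by rewrite exprMn ler_wpM2l ?exprn_ge0 ?addr_ge0 // expr2 ler_wpM2r.
by apply/funext => m; congr (psum _ _ _); apply/funext => x; apply/funext => y; rewrite ger0_norm ?sqr_ge0.
Qed.

Lemma propagator_sq_ev : exists W, eventually_le a b lam (fun x y => (pg x y - 1) ^+ 2) W.
Proof.
exists (fun x => 2 * (B x + 0)).
have h : eventually_le a b lam (fun x y => propagator_error x y ^+ 2) (fun=> 0).
  by apply: eventually_le_cvg => s t as_ st tb; rewrite subrr; exact: error_sq_sum.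
apply: (eventually_le_le lamP (eventually_leZ (ltW (ltr0n _ 2)) (eventually_leD ev_sq h))) => x y _ _ _.
have -> : pg x y - 1 = propagator_error x y + (f y - f x) by rewrite /propagator_error; ring.
have := sqr_ge0 (propagator_error x y - (f y - f x)); rewrite !sqrrD !sqrrN; lra.
Qed.

End propagator_estimates.

(** * Solutions of the augmented equation *)

Section domination.
Context {R : realType} (a b : R).
Hypothesis ab : a < b.
Implicit Types (k f g h K B F H : R -> R) (s t u v x y c r p : R).

Lemma regulated_dom k K H c : regulated a b K -> regulated a b H -> 0 <= c ->
  (forall x y, a <= x -> x <= y -> y <= b -> `|k y - k x| <= c * (`|K y - K x| + `|H y - H x|)) ->
  regulated a b k.
Proof.
move=> rK rH c0 dom.
have key e x y l1 l2 : 0 < e -> a <= x -> x <= y -> y <= b ->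
    `|K x - l1| <= e / (c + 1) / 4 -> `|K y - l1| <= e / (c + 1) / 4 ->
    `|H x - l2| <= e / (c + 1) / 4 -> `|H y - l2| <= e / (c + 1) / 4 -> `|k y - k x| <= e.
  move=> e0 ax xy yb h1 h2 h3 h4; apply: (le_trans (dom _ _ ax xy yb)).
  have -> : K y - K x = (K y - l1) - (K x - l1) by ring.
  have -> : H y - H x = (H y - l2) - (H x - l2) by ring.
  have := lerD (normB_le h2 h1) (normB_le h4 h3); set q := e / (c + 1) => h5.
  have q0 : 0 < q by rewrite divr_gt0 // ltr_wpDl.
  apply: (@le_trans _ _ (c * q)); first by rewrite ler_wpM2l //; lra.
  by rewrite mulrCA ler_piMr ?(ltW e0) // ler_pdivrMr ?ltr_wpDl // mul1r lerDl.
have q0 e : 0 < e -> 0 < e / (c + 1) / 4 by move=> e0; rewrite !divr_gt0 // ltr_wpDl.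
split=> r hr; have [ar rb] := andP hr.
  apply: left_cauchy => e e0.
  have /left_cvgP /(_ _ (q0 _ e0))[u1 u1r H1] := reg_lft rK hr.
  have /left_cvgP /(_ _ (q0 _ e0))[u2 u2r H2] := reg_lft rH hr.
  exists (Num.max a (Num.max u1 u2)); first by rewrite !gt_max ar u1r.
  move=> x y; rewrite !gt_max => /and3P[ax x1 x2] xy yr.
  have yr' : y < r by [].
  have xr := le_lt_trans xy yr.
  apply: (key _ _ _ (lft K r) (lft H r)) => //; rewrite ?(ltW ax) ?(le_trans (ltW yr)) //.
  - by apply: H1; rewrite x1.
  - by apply: H1; rewrite (lt_le_trans x1).
  - by apply: H2; rewrite x2.
  - by apply: H2; rewrite (lt_le_trans x2).
apply: right_cauchy => e e0.
have /right_cvgP /(_ _ (q0 _ e0))[u1 u1r H1] := reg_rgt rK hr.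
have /right_cvgP /(_ _ (q0 _ e0))[u2 u2r H2] := reg_rgt rH hr.
exists (Num.min b (Num.min u1 u2)); first by rewrite !lt_min rb u1r.
move=> x y rx xy; rewrite !lt_min => /and3P[yb y1 y2].
have ry := lt_le_trans rx xy.
apply: (key _ _ _ (rgt K r) (rgt H r)) => //; rewrite ?(ltW yb) ?(le_trans ar (ltW rx)) //.
- by apply: H1; rewrite rx (le_lt_trans xy).
- by apply: H1; rewrite ry.
- by apply: H2; rewrite rx (le_lt_trans xy).
- by apply: H2; rewrite ry.
Qed.

Lemma dualW_dom om p k K H V W c : 1 <= p -> young_pair om p -> regulated a b K -> regulated a b H ->
  controlled om a b K V -> controlled om a b H W -> 0 <= c ->
  (forall x y, a <= x -> x <= y -> y <= b -> `|k y - k x| <= c * (`|K y - K x| + `|H y - H x|)) ->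
  dualW p a b k.
Proof.
move=> p1 vd rK rH cK cH c0 dom.
have [U cU] := controlled_dom (valid_ge0 vd) c0 cK cH dom.
apply/(dualW_controlled _ p1 ab); exists om, U; split=> //.
exact: regulated_dom rK rH c0 dom.
Qed.

(** Holding a function constant to the left of [s] is how the propagator started at [s] becomes a
    function on the whole interval. *)
Lemma controlled_max om K V s : a <= s <= b -> controlled om a b K V ->
  controlled om a b (fun x => K (Num.max s x)) (fun x => V (Num.max s x)).
Proof.
move=> /andP[as_ sb] [mV cK].
have mm x y : x <= y -> Num.max s x <= Num.max s y.
  by move=> xy; rewrite ge_max !le_max lexx xy orbT.
split=> [x y xy|x y ax xy yb]; first exact/mV/mm.
by apply: cK; [rewrite le_max as_|exact: mm|rewrite ge_max sb].
Qed.

Lemma regulated_max K s : a <= s -> regulated a b K -> regulated a b (fun x => K (Num.max s x)).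
Proof.
move=> as_ rK; split=> r hr; have [ar rb] := andP hr; apply/cvg_ex.
  have [sr|rs] := ltP s r.
    exists (lft K r); apply: (cvg_at_left_eq sr) (reg_lft rK hr) => x /andP[/ltW sx _].
    by rewrite (max_idPr sx).
  exists (K s); apply: (cvg_at_left_eq ar (G := fun=> K s)); last exact: cvg_cst.
  by move=> x /andP[_ xr]; rewrite (max_idPl _) // (le_trans (ltW xr)).
have [rs|sr] := ltP r s.
  exists (K s); apply: (cvg_at_right_eq rs (G := fun=> K s)); last exact: cvg_cst.
  by move=> x /andP[_ /ltW xs]; rewrite (max_idPl xs).
exists (rgt K r); apply: (cvg_at_right_eq rb) (reg_rgt rK hr) => x /andP[rx _].
by rewrite (max_idPr _) // (le_trans sr) // ltW.
Qed.

Lemma dualW_regulated p K : 1 <= p -> dualW p a b K -> regulated a b K.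
Proof. by move=> p1 /(dualW_controlled _ p1 ab)[om [V []]]. Qed.

Lemma summable_fin_bounded (D : set R) (c : R -> R) M : fin_bounded D c M ->
  summable D (fun t => (c t)%:E).
Proof.
move=> H; apply: (@le_lt_trans _ _ M%:E); last exact: ltry.
apply: ub_ereal_sup => _ [X [fX XD] <-].
rewrite fsbig_finite //= (eq_bigr (fun t => (`|c t|)%:E)) // sumEFin lee_fin.
apply: le_trans (H (fset_set X)).
rewrite [leRHS]big_mkcond /= big_seq [leRHS]big_seq; apply: ler_sum => t.
by rewrite in_fset_set // => /set_mem /XD /mem_set ->.
Qed.

End domination.

Section solution.
Context {R : realType} (a b : R) (lam : nat -> seq R).
Hypotheses (ab : a < b) (lamP : Lambda a b lam).
Implicit Types (k g h K F G psi : R -> R) (s t u v x y c r : R).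

Local Notation jumps_in_cup := (jumps_in_cup a b lam).
Local Notation S phi s t m := (psum phi s (restr lam s t m)).

Lemma cvg_psum_eq phi (psi : R -> R -> R) s t (l : R) : s < t ->
  (forall x y, s <= x -> x < y -> y <= t -> psi x y = phi x y) ->
  S phi s t m @[m --> \oo] --> l -> S psi s t m @[m --> \oo] --> l.
Proof.
move=> st e; rewrite (_ : (fun m => S psi s t m) = (fun m => S phi s t m)) //.
by apply/funext => m; apply: eq_psum => [|x y]; rewrite ?restr_last; [exact: (restr_path lamP)|exact: e].
Qed.

Lemma cvg_psumD phi (psi : R -> R -> R) s t (l l' : R) : S phi s t m @[m --> \oo] --> l ->
  S psi s t m @[m --> \oo] --> l' ->
  S (fun x y => phi x y + psi x y) s t m @[m --> \oo] --> l + l'.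
Proof.
move=> c c'; rewrite (_ : (fun m => _) = (fun m => S phi s t m + S psi s t m)); first exact: cvgD.
by apply/funext => m; rewrite psumD.
Qed.

Lemma cvg_psumZ phi s t c (l : R) : S phi s t m @[m --> \oo] --> l ->
  S (fun x y => c * phi x y) s t m @[m --> \oo] --> c * l.
Proof.
move=> h; rewrite (_ : (fun m => _) = (fun m => c * S phi s t m)).
  by apply: cvgM => //; exact: cvg_cst.
by apply/funext => m; rewrite psumZ.
Qed.

Arguments cvg_psumZ {phi s t} c {l} _.

Lemma psum_squeeze phi (psi : R -> R -> R) c s t : s < t -> S phi s t m @[m --> \oo] --> 0 ->
  (forall x y, s <= x -> x < y -> y <= t -> 0 <= psi x y <= c * phi x y) ->
  S psi s t m @[m --> \oo] --> 0.
Proof.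
move=> st h e; have := cvg_psumZ c h; rewrite mulr0 => h0.
apply: (squeeze_cvgr _ (cvg_cst 0) h0); apply: nearW => m; apply/andP; split.
  apply: psum_ge0 => [|x y]; rewrite ?restr_last; first exact: (restr_path lamP).
  by move=> sx xy yt; case/andP: (e x y sx xy yt).
apply: ler_psum => [|x y]; rewrite ?restr_last; first exact: (restr_path lamP).
by move=> sx xy yt; case/andP: (e x y sx xy yt).
Qed.

Lemma sq_weight_sum phi (k : R -> R -> R) M s t : s < t -> S (fun x y => phi x y ^+ 2) s t m @[m --> \oo] --> 0 ->
  (forall x y, s <= x -> x < y -> y <= t -> `|k x y| <= M) ->
  S (fun x y => (k x y * phi x y) ^+ 2) s t m @[m --> \oo] --> 0.
Proof.
move=> st h kM; apply: (psum_squeeze (c := M ^+ 2) st h) => x y sx xy yt.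
rewrite sqr_ge0 exprMn ler_wpM2r ?sqr_ge0 //= -(real_normK (num_real (k x y))).
have h1 := kM _ _ sx xy yt; rewrite ler_sqr ?nnegrE //; exact: le_trans h1.
Qed.

Lemma sq_sub_sum phi (psi : R -> R -> R) s t : s < t -> S (fun x y => phi x y ^+ 2) s t m @[m --> \oo] --> 0 ->
  S (fun x y => psi x y ^+ 2) s t m @[m --> \oo] --> 0 ->
  S (fun x y => (phi x y - psi x y) ^+ 2) s t m @[m --> \oo] --> 0.
Proof.
move=> st h1 h2; have := cvg_psumD h1 h2; rewrite addr0 => h.
apply: (psum_squeeze (c := 2) st h) => x y _ _ _; rewrite sqr_ge0 /=.
have := sqr_ge0 (phi x y + psi x y); rewrite !sqrrD !sqrrN; lra.
Qed.

Lemma RY_integral_regulated K h F : RY_integral a b lam K h F -> regulated a b F.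
Proof. by move=> [_ _ h1 h2]; split=> r hr; apply/cvg_ex; eexists; [exact: h1|exact: h2]. Qed.

Lemma RY_integral_djump K h F r : RY_integral a b lam K h F -> a < r <= b -> djump F r = K r * djump h r.
Proof. by move=> [_ _ h1 _] hr; rewrite {1}/djump (lft_eq (h1 r hr)); ring. Qed.

Lemma RY_integral_ujump K h F r : RY_integral a b lam K h F -> a <= r < b -> ujump F r = rgt K r * ujump h r.
Proof. by move=> [_ _ _ h1] hr; rewrite {1}/ujump (rgt_eq (h1 r hr)); ring. Qed.

Lemma RY_integral_is_RY K h F u v : RY_integral a b lam K h F -> a <= u -> u <= v -> v <= b ->
  is_RY K h u v (F v - F u).
Proof.
move=> [H _ _ _] au; rewrite le_eqVlt => /orP[/eqP<- _|uv vb]; last exact: H.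
by left; rewrite subrr.
Qed.

Lemma jump_affine F c d : regulated a b F ->
  (forall r, a < r <= b -> djump (fun x => c * (F x - d)) r = c * djump F r) /\
  (forall r, a <= r < b -> ujump (fun x => c * (F x - d)) r = c * ujump F r).
Proof.
move=> rF; split=> r hr.
  rewrite /djump; have -> : lft (fun x => c * (F x - d)) r = c * (lft F r - d); last by ring.
  apply: lft_eq; apply: cvgM; first exact: cvg_cst.
  by apply: cvgB; [exact: reg_lft hr|exact: cvg_cst].
rewrite /ujump; have -> : rgt (fun x => c * (F x - d)) r = c * (rgt F r - d); last by ring.
apply: rgt_eq; apply: cvgM; first exact: cvg_cst.
by apply: cvgB; [exact: reg_rgt hr|exact: cvg_cst].
Qed.

Lemma regulated_affine F c d : regulated a b F -> regulated a b (fun x => c * (F x - d)).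
Proof.
by move=> rF; apply: regulatedM; [exact: regulated_cst|apply: regulatedD => //; exact: regulated_cst].
Qed.

Variables (f B : R -> R).
Hypotheses (rf : regulated a b f) (nf : jumps_in_cup f) (qB : is_qcov a b lam f f B).

Let rB : regulated a b B. Proof. by case: qB. Qed.
Let nB : jumps_in_cup B. Proof. exact: qvar_jumps_in_cup qB. Qed.
Let pg := propagator a f B.
Let err := propagator_error a f B.

(** The quadratic variation is monotone, so that every regulated integrand is admissible. *)
Lemma RY_integral_qvar K : regulated a b K -> exists F, RY_integral a b lam K B F.
Proof.
move=> rK; apply: (@RY_integral_exists _ a b lam ab lamP B rB nB None 1 K (fun=> 0) (qvar_ext a b B)) => //.
- exact: controlled_None.
- exact: qvar_controlled qB.
Qed.

(** Reduces the two bracket equations to one statement on sums and one on jumps. *)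
Lemma is_qcov_RY_integral k1 k2 K F c : regulated a b k1 -> regulated a b k2 ->
  RY_integral a b lam K B F ->
  (forall s t, a <= s -> s < t -> t <= b ->
    S (fun x y => (k1 y - k1 x) * (k2 y - k2 x) - c * (K y * (B y - B x))) s t m @[m --> \oo] --> 0) ->
  (forall r, a < r <= b -> djump k1 r * djump k2 r = c * (K r * djump B r)) ->
  (forall r, a <= r < b -> ujump k1 r * ujump k2 r = c * (rgt K r * ujump B r)) ->
  is_qcov a b lam k1 k2 (fun x => c * (F x - F a)).
Proof.
move=> r1 r2 hF sums dj uj; have rF := RY_integral_regulated hF.
have [jd ju] := jump_affine c (F a) rF.
split=> //; first exact: regulated_affine.
  by rewrite subrr mulr0.
move=> s t as_ st tb; split.
- have -> : c * (F t - F a) - c * (F s - F a) = 0 + c * (F t - F s) by ring.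
  case: hF => _ /(_ s t as_ st tb) cF _ _.
  have := cvg_psumD (sums s t as_ st tb) (cvg_psumZ c cF).
  by apply: cvg_psum_eq => // x y _ _ _; rewrite subrK.
- by rewrite jd ?(le_lt_trans as_ st) // (RY_integral_djump hF) ?dj // (le_lt_trans as_ st).
- by rewrite ju ?as_ ?(lt_le_trans st tb) // (RY_integral_ujump hF) ?uj // as_ (lt_le_trans st tb).
Qed.

Variable p : R.
Hypotheses (p1 : 1 <= p) (p2 : p < 2).
Hypothesis fdec : exists gh, decomp_left a b lam p f gh.

(** Raising the exponents of both parts of the driver to their maximum keeps the pair a
    Young pair, as p < 2. *)
Lemma driver_controlled : exists om V U, [/\ young_pair om p, controlled om a b f V & controlled om a b B U].
Proof.
have [[g h] [[[rg rh] [_ dg] Wh _ [C fC]] _]] := fdec.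
have p0 : 0 < p by exact: lt_le_trans p1.
have [om [V1 [vd _ c1]]] := (dualW_controlled _ p1 ab).1 dg.
case: om vd c1 => [q [_ [q0 pq]] c1|vd c1]; last first.
  by exists None, (fun=> 0), (fun=> 0); split=> //; exact: controlled_None.
have [V2 c2] := (W_controlled _ p0 ab).1 Wh.
(* p < 2 gives 1 / p + 1 / p > 1 in case the maximum is p *)
pose r := Num.max q p.
have qr : q <= r by rewrite le_max lexx.
have pr : p <= r by rewrite le_max lexx orbT.
have vr : young_pair (Some r) p.
  split=> //; split; first exact: lt_le_trans pr.
  have [qp|pq'] := leP q p; last by rewrite /r (max_idPl (ltW pq')).
  rewrite /r (max_idPr qp); have : 2^-1 < p^-1 by rewrite ltf_pV2 ?posrE //.
  lra.
have [Mg Mg0 HMg] := regulated_bounded ab rg; have [Mh Mh0 HMh] := regulated_bounded ab rh.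
have [MB MB0 HMB] := regulated_bounded ab rB.
have [Ug cg] := controlled_raise q0 qr HMg c1; have [Uh ch] := controlled_raise p0 pr HMh c2.
have [UB cB] := controlled_raise ltr01 (le_trans p1 pr) HMB (qvar_controlled ab lamP qB).
have [Uf cf] : exists U, controlled (Some r) a b f U.
  apply: (@controlled_dom R (Some r) a b f g h Ug Uh 1 _ ler01 cg ch) => [|x y ax xy yb].
    exact: valid_ge0 vr.
  have hx : a <= x <= b by rewrite ax (le_trans xy).
  have hy : a <= y <= b by rewrite yb (le_trans ax).
  rewrite !fC // mul1r; have -> : C + g y + h y - (C + g x + h x) = (g y - g x) + (h y - h x) by ring.
  exact: ler_normD.
by exists (Some r), Uf, UB.
Qed.

Let G0 x := pg x b.

Lemma propagator_start_dualW : dualW p a b G0.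
Proof.
have [om [V [U [vd cf cB]]]] := driver_controlled.
have [M M1 HM] := propagator_bounded ab lamP rf qB; have [L L0 HL] := propagator_dist ab lamP rf qB.
have M0 : 0 <= M by exact: le_trans M1.
apply: (dualW_dom ab p1 vd rf rB cf cB (mulr_ge0 M0 L0)) => x y ax xy yb.
have -> : G0 y - G0 x = - (G0 y * (pg x y - 1)).
  by rewrite /G0 /pg (propagator_mul ab lamP qB ax xy yb (lexx b)); ring.
rewrite normrN normrM -mulrA; apply: ler_pM => //; last exact: HL.
by apply: HM => //; exact: le_trans xy.
Qed.

Lemma propagator_end_dualW s : a <= s <= b -> dualW p a b (fun x => pg s (Num.max s x)).
Proof.
move=> hs; have [as_ sb] := andP hs.
have [om [V [U [vd cf cB]]]] := driver_controlled.
have [M M1 HM] := propagator_bounded ab lamP rf qB; have [L L0 HL] := propagator_dist ab lamP rf qB.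
have M0 : 0 <= M by exact: le_trans M1.
apply: (dualW_dom ab p1 vd (regulated_max as_ rf) (regulated_max as_ rB)
  (controlled_max hs cf) (controlled_max hs cB) (mulr_ge0 M0 L0)) => x y ax xy yb.
set x' := Num.max s x; set y' := Num.max s y.
have sx : s <= x' by rewrite le_max lexx.
have xy' : x' <= y' by rewrite /x' /y' ge_max !le_max lexx xy orbT.
have yb' : y' <= b by rewrite ge_max sb.
have -> : pg s y' - pg s x' = pg s x' * (pg x' y' - 1).
  by rewrite /pg (propagator_mul ab lamP qB as_ sx xy' yb'); ring.
rewrite normrM -mulrA; apply: ler_pM => //.
  by apply: HM => //; exact: le_trans yb'.
by apply: HL => //; exact: le_trans sx.
Qed.

Let rG0 : regulated a b G0. Proof. exact: (dualW_regulated ab p1 propagator_start_dualW). Qed.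

Lemma djump_propagator r : a < r <= b -> djump G0 r = - (G0 r * djump f r).
Proof.
move=> hr; have [ar rb] := andP hr.
rewrite /djump; have -> : lft G0 r = (1 + djump f r) * G0 r; last by rewrite /djump; ring.
apply: lft_eq.
have c : pg x r * G0 r @[x --> r^'-] --> (1 + djump f r) * G0 r.
  by apply: cvgM; [exact: (propagator_left ab lamP rf qB)|exact: cvg_cst].
apply: (cvg_at_left_eq ar) c => x /andP[/ltW ax /ltW xr].
by rewrite /G0 /pg (propagator_mul ab lamP qB ax xr rb).
Qed.

Lemma ujump_propagator r : a <= r < b -> ujump G0 r = - (rgt G0 r * ujump f r).
Proof.
move=> hr; have [ar rb] := andP hr.
suff e : G0 r = (1 + ujump f r) * rgt G0 r by rewrite {1}/ujump {1}e; ring.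
have c : pg r y * G0 y @[y --> r^'+] --> (1 + ujump f r) * rgt G0 r.
  by apply: cvgM; [exact: (propagator_right ab lamP rf qB)|exact: reg_rgt hr].
apply: (cvg_unique _ _ c) => //.
apply: (cvg_at_right_eq rb (G := fun=> G0 r)); last exact: cvg_cst.
move=> y /andP[/ltW ry /ltW yb].
by rewrite /G0 /pg -(propagator_mul ab lamP qB ar ry yb).
Qed.

(** The equation over one step, up to a negligible error. *)
Lemma propagator_inc x y : a <= x -> x <= y -> y <= b ->
  G0 y - G0 x = - (G0 y * (f y - f x)) - G0 y * err x y.
Proof.
move=> ax xy yb; rewrite /G0 /pg (propagator_mul ab lamP qB ax xy yb (lexx b)) /err /propagator_error; ring.
Qed.

Lemma propagator_err_sq s t : a <= s -> s < t -> t <= b ->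
  S (fun x y => (G0 y * err x y) ^+ 2) s t m @[m --> \oo] --> 0.
Proof.
move=> as_ st tb; have [M M0 HM] := regulated_bounded ab rG0.
apply: (sq_weight_sum (M := M) st) => [|x y sx xy yt].
  exact: (error_sq_sum ab lamP rf nf qB).
by apply: HM; rewrite (le_trans yt) // (le_trans as_) // (le_trans sx) // ltW.
Qed.

Let ev_sqf : eventually_le a b lam (fun x y => (f y - f x) ^+ 2) B.
Proof.
apply: eventually_le_cvg => s t as_ st tb; case: qB => _ _ _ _ /(_ s t as_ st tb)[c _ _].
by apply: cvg_psum_eq c => // x y _ _ _; rewrite expr2.
Qed.

Lemma propagator_cross s t : a <= s -> s < t -> t <= b ->
  S (fun x y => (f y - f x) * (G0 y * err x y)) s t m @[m --> \oo] --> 0.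
Proof.
move=> as_ st tb; apply: (cross_sum lamP ev_sqf as_ st tb); exact: propagator_err_sq.
Qed.

Let neg_K K : regulated a b K ->
  negligible a b lam (fun x y => K y * ((f y - f x) ^+ 2 - (B y - B x))).
Proof. by move=> rK; apply: (negligible_weight lamP (negligible_sq_qvar lamP rf nf qB) rK ab). Qed.

Let sub_in s t x y : a <= s -> t <= b -> s <= x -> x < y -> y <= t ->
  [/\ a <= x, x <= y, y <= b, a <= x <= b & a <= y <= b].
Proof.
move=> as_ tb sx xy yt; have ax := le_trans as_ sx; have yb := le_trans yt tb.
by rewrite ax yb (le_trans ax (ltW xy)) (le_trans (ltW xy) yb) (ltW xy).
Qed.

Lemma propagator_qcov_driver F : RY_integral a b lam G0 B F -> is_qcov a b lam G0 f (fun x => -1 * (F x - F a)).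
Proof.
move=> hF; apply: (is_qcov_RY_integral rG0 rf hF).
- move=> s t as_ st tb; have [_ _ c1] := neg_K rG0.
  have := cvg_psumD (cvg_psumZ (-1) (c1 s t as_ st tb)) (cvg_psumZ (-1) (propagator_cross as_ st tb)).
  rewrite !mulr0 addr0; apply: cvg_psum_eq => // x y sx xy yt.
  have [ax xy' yb _ _] := sub_in as_ tb sx xy yt.
  rewrite (propagator_inc ax xy' yb); ring.
- by move=> r hr; rewrite djump_propagator // (djump_qvar qB hr); ring.
- by move=> r hr; rewrite ujump_propagator // (ujump_qvar qB hr); ring.
Qed.

Lemma propagator_qvar F : RY_integral a b lam (fun x => G0 x ^+ 2) B F ->
  is_qcov a b lam G0 G0 (fun x => 1 * (F x - F a)).
Proof.
move=> hF; have rG2 : regulated a b (fun x => G0 x ^+ 2) by exact: regulatedM.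
apply: (is_qcov_RY_integral rG0 rG0 hF).
- move=> s t as_ st tb; have [_ _ c1] := neg_K rG2.
  have [M M0 HM] := regulated_bounded ab rG0.
  have c2 : S (fun x y => (f y - f x) * (G0 y * (G0 y * err x y))) s t m @[m --> \oo] --> 0.
    apply: (cross_sum lamP ev_sqf as_ st tb).
    apply: (sq_weight_sum (M := M) st) => [|x y sx xy yt]; first exact: propagator_err_sq.
    by apply: HM; have [_ _ _ _] := sub_in as_ tb sx xy yt.
  have := cvg_psumD (cvg_psumD (c1 s t as_ st tb) (cvg_psumZ 2 c2)) (propagator_err_sq as_ st tb).
  rewrite mulr0 !addr0; apply: cvg_psum_eq => // x y sx xy yt.
  have [ax xy' yb _ _] := sub_in as_ tb sx xy yt.
  rewrite (propagator_inc ax xy' yb); ring.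
- by move=> r hr; rewrite djump_propagator // (djump_qvar qB hr); ring.
- move=> r hr; rewrite ujump_propagator // (ujump_qvar qB hr).
  have -> : rgt (fun x => G0 x ^+ 2) r = rgt G0 r ^+ 2.
    by apply: rgt_eq; rewrite expr2; apply: cvgM; exact: reg_rgt hr.
  ring.
Qed.

Let decompP g h : decomp_left a b lam p f (g, h) ->
  [/\ regulated a b g, regulated a b h, W p a b h, jumps_in_cup h &
    (forall x y, a <= x <= b -> a <= y <= b -> f y - f x = (g y - g x) + (h y - h x)) /\
    (forall r, a < r <= b -> djump f r = djump g r + djump h r) /\
    (forall r, a <= r < b -> ujump f r = ujump g r + ujump h r)].
Proof.
move=> [[[rg rh] _ Wh _ [C fC]] jumps] /=; split=> //.
  move=> r hr rn; apply/eqP/negPn/negP => d; apply: rn; apply: jumps; right.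
  by split.
split; [|split] => [x y hx hy|r hr|r hr].
- by rewrite !fC //; ring.
- have [ar rb] := andP hr; have hr' : a <= r <= b by rewrite rb ltW.
  rewrite {1}/djump (lft_eq (l := C + lft g r + lft h r)).
    by rewrite fC // /djump; ring.
  apply: (eq_at_left hr (f := fun x => C + g x + h x)); first by move=> x hx; rewrite fC.
  apply: cvgD; last exact: reg_lft hr.
  by apply: cvgD; [exact: cvg_cst|exact: reg_lft hr].
- have [ar rb] := andP hr; have hr' : a <= r <= b by rewrite ar ltW.
  rewrite {1}/ujump (rgt_eq (l := C + rgt g r + rgt h r)).
    by rewrite fC // /ujump; ring.
  apply: (eq_at_right hr (f := fun x => C + g x + h x)); first by move=> x hx; rewrite fC.
  apply: cvgD; last exact: reg_rgt hr.
  by apply: cvgD; [exact: cvg_cst|exact: reg_rgt hr].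
Qed.

Lemma RY_integral_dual K h : dualW p a b K -> regulated a b h -> jumps_in_cup h -> W p a b h ->
  exists F, RY_integral a b lam K h F.
Proof.
move=> dK rh nh Wh; have p0 : 0 < p by exact: lt_le_trans p1.
have [om [V1 [vd rK c1]]] := (dualW_controlled _ p1 ab).1 dK.
have [V2 c2] := (W_controlled _ p0 ab).1 Wh.
exact: (RY_integral_exists ab lamP rh nh vd rK c1 c2).
Qed.

(** By [propagator_inc], psi dG + psi G dg is -psi G dh up to a negligible term, and the
    right sums of the latter converge to a Young integral. *)
Lemma propagator_RC g h psi : decomp_left a b lam p f (g, h) -> dualW p a b psi ->
  exists2 Psi, is_RC a b lam psi (fun x => psi x * G0 x) G0 g Psi &
    forall y, a <= y <= b -> is_RY (fun x => psi x * G0 x) h y b (- (Psi b - Psi y)).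
Proof.
move=> /decompP[rg rh Wh nh [df [jd ju]]] dpsi.
have dK := dualW_mul p1 ab dpsi propagator_start_dualW.
have rpsi := dualW_regulated ab p1 dpsi; have rK := dualW_regulated ab p1 dK.
have [F hF] := RY_integral_dual dK rh nh Wh.
have rF := RY_integral_regulated hF; have [fd fu] := jump_affine (-1) (F a) rF.
exists (fun x => -1 * (F x - F a)); last first.
  move=> y /andP[ay yb].
  have -> : - (-1 * (F b - F a) - -1 * (F y - F a)) = F b - F y by ring.
  exact: (RY_integral_is_RY hF).
split=> //; first exact: regulated_affine.
  by rewrite subrr mulr0.
move=> s t as_ st tb; split.
- have -> : -1 * (F t - F a) - -1 * (F s - F a) = -1 * 0 + -1 * (F t - F s) by ring.
  case: hF => _ /(_ s t as_ st tb) cF _ _.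
  have [_ _ c1] := negligible_weight lamP (negligible_error ab lamP rf nf qB) rK ab.
  have := cvg_psumD (cvg_psumZ (-1) (c1 s t as_ st tb)) (cvg_psumZ (-1) cF).
  apply: cvg_psum_eq => // x y sx xy yt.
  have [ax xy' yb hx hy] := sub_in as_ tb sx xy yt.
  rewrite (propagator_inc ax xy' yb) (df x y hx hy) -/err; ring.
- have hr : a < t <= b by rewrite (le_lt_trans as_ st).
  by rewrite fd // (RY_integral_djump hF hr) djump_propagator // jd //; ring.
- have hr : a <= s < b by rewrite as_ (lt_le_trans st).
  rewrite fu // (RY_integral_ujump hF hr) ujump_propagator // ju //.
  have -> : rgt (fun x => psi x * G0 x) s = rgt psi s * rgt G0 s.
    by apply: rgt_eq; apply: cvgM; exact: reg_rgt hr.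
  ring.
Qed.

Lemma RY_integral_value K h F (I : R -> R) : RY_integral a b lam K h F ->
  (forall y, a <= y <= b -> is_RY K h a y (I y)) -> forall y, a <= y <= b -> I y = F y - F a.
Proof.
move=> hF H y hy; apply: (is_RY_unique (H y hy)).
by case/andP: hy => ay yb; apply: (RY_integral_is_RY hF).
Qed.

Lemma RY_integral_value_to K h F (I : R -> R) : RY_integral a b lam K h F ->
  (forall y, a <= y <= b -> is_RY K h y b (I y)) -> forall y, a <= y <= b -> I y = F b - F y.
Proof.
move=> hF H y hy; apply: (is_RY_unique (H y hy)).
by case/andP: hy => ay yb; apply: (RY_integral_is_RY hF).
Qed.

Section uniqueness.
Variable G : R -> R.
Hypothesis dG : dualW p a b G.

Let rG : regulated a b G. Proof. exact: (dualW_regulated ab p1 dG). Qed.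
(** The error made by a solution in the explicit backward scheme over one step. *)
Let defect x y := G x - G y * (1 + (f y - f x)).

(** With the Young integral against [h] moved to the sums, [g] and [h] recombine to the
    driver. *)
Lemma defect_sum g h psi Psi : decomp_left a b lam p f (g, h) -> dualW p a b psi ->
  is_RC a b lam psi (fun x => psi x * G x) G g Psi ->
  (forall y, a <= y <= b -> is_RY (fun x => psi x * G x) h y b (- (Psi b - Psi y))) ->
  forall s t, a <= s -> s < t -> t <= b ->
    S (fun x y => psi y * defect x y) s t m @[m --> \oo] --> 0.
Proof.
move=> /decompP[rg rh Wh nh [df _]] dpsi [_ _ _ cPsi] ry s t as_ st tb.
have [F hF] := RY_integral_dual (dualW_mul p1 ab dpsi dG) rh nh Wh.
have val := RY_integral_value_to hF ry.
have hs : a <= s <= b by rewrite as_ (ltW (lt_le_trans st tb)).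
have ht : a <= t <= b by rewrite tb (ltW (le_lt_trans as_ st)).
have [c1 _ _] := cPsi s t as_ st tb; case: hF => _ /(_ s t as_ st tb) c2 _ _.
have -> : 0 = -1 * (Psi t - Psi s) + -1 * (F t - F s) by have := val s hs; have := val t ht; lra.
have := cvg_psumD (cvg_psumZ (-1) c1) (cvg_psumZ (-1) c2); apply: cvg_psum_eq => // x y sx xy yt.
have [_ _ _ hx hy] := sub_in as_ tb sx xy yt.
rewrite /defect (df x y hx hy); ring.
Qed.

Hypothesis qG : is_qcov a b lam G G (qvar a b lam G).
Hypothesis qGf : is_qcov a b lam G f (qcov a b lam G f).
Hypothesis bracket : forall y, a <= y <= b ->
  is_RY (fun x => G x ^+ 2) B a y (qvar a b lam G y) /\ is_RY G B a y (- qcov a b lam G f y).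

(** The square of the defect combines (dG)^2 - G^2 dB, dG df + G dB and (df)^2 - dB.  The
    bracket equations say that the first two have vanishing sums. *)
Lemma defect_sq_sum s t : a <= s -> s < t -> t <= b ->
  S (fun x y => defect x y ^+ 2) s t m @[m --> \oo] --> 0.
Proof.
have [F1 hF1] := RY_integral_qvar rG.
have rG2 : regulated a b (fun x => G x ^+ 2) by exact: regulatedM.
have [F2 hF2] := RY_integral_qvar rG2.
have v1 := RY_integral_value hF1 (fun y hy => (bracket hy).2).
have v2 := RY_integral_value hF2 (fun y hy => (bracket hy).1).
have [_ _ rQ _ HQ] := qG; have [_ _ rQf _ HQf] := qGf.
have in1 s' t' : a <= s' -> s' < t' -> t' <= b -> a <= s' <= b /\ a <= t' <= b.
  by move=> h1 h2 h3; rewrite h1 h3 (ltW (lt_le_trans h2 h3)) (ltW (le_lt_trans h1 h2)).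
have rF1 := RY_integral_regulated hF1; have [d1 u1] := jump_affine (-1) (F1 a) rF1.
have QfE x : a <= x <= b -> -1 * (F1 x - F1 a) = qcov a b lam G f x.
  by move=> hx; have := v1 x hx; lra.
have djf r : a < r <= b -> djump G r * djump f r + G r * djump B r = 0.
  move=> hr; have [ar rb] := andP hr; have [_ <- _] := HQf a r (lexx a) ar rb.
  rewrite -(eq_djump (regulated_affine (-1) (F1 a) rF1) hr QfE) d1 // (RY_integral_djump hF1 hr); ring.
have ujf r : a <= r < b -> ujump G r * ujump f r + rgt G r * ujump B r = 0.
  move=> hr; have [ar rb] := andP hr; have [_ _ <-] := HQf r b ar rb (lexx b).
  rewrite -(eq_ujump (regulated_affine (-1) (F1 a) rF1) hr QfE) u1 // (RY_integral_ujump hF1 hr); ring.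
have nG : jumps_in_cup G.
  move=> r hr rn; have [ar rb] := andP hr; apply/eqP; rewrite -sqrf_eq0 expr2.
  have [_ <- _] := HQ a r (lexx a) ar (ltW rb).
  have hr' : a < r <= b by rewrite ar ltW.
  have [d2 _] := jump_affine 1 (F2 a) (RY_integral_regulated hF2).
  have rA := regulated_affine 1 (F2 a) (RY_integral_regulated hF2).
  rewrite -(eq_djump rA hr' (g := qvar a b lam G)) => [|x hx]; last by rewrite v2 // mul1r.
  by rewrite d2 // (RY_integral_djump hF2 hr') nB // !mulr0.
have vc : vanishing a b lam (fun x y => (G y - G x) * (f y - f x) + G y * (B y - B x)).
  exact: (eq_jump_limit (jump_limitD (jump_limitM (jump_limit_inc rG nG) (jump_limit_inc rf nf))
    (jump_limitM (jump_limit_r lam rG) (jump_limit_inc rB nB))) djf ujf).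
have [M M0 HM] := regulated_bounded ab rG.
have evG : eventually_le a b lam (fun x y => (G y - G x) ^+ 2) (qvar a b lam G).
  apply: eventually_le_cvg => s' t' as_ st tb; have [c _ _] := HQ s' t' as_ st tb.
  by apply: cvg_psum_eq c => // x y _ _ _; rewrite expr2.
have nc : negligible a b lam (fun x y => (G y - G x) * (f y - f x) + G y * (B y - B x)).
  split=> //.
    exists (fun x => (qvar a b lam G x + B x) + M * B x).
    have e1 := eventually_leD (eventually_leD evG ev_sqf) (eventually_leZ (ltW M0) (eventually_le_tele lam B)).
    apply: (eventually_le_le lamP e1) => x y ax xy yb; apply: normD_le.
      rewrite normrM -(real_normK (num_real (G y - G x))) -(real_normK (num_real (f y - f x))).
      have := sqr_ge0 (`|G y - G x| - `|f y - f x|); rewrite sqrrB.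
      have := sqr_ge0 (`|G y - G x|); have := sqr_ge0 (`|f y - f x|); lra.
    have B0 : 0 <= B y - B x by rewrite subr_ge0 (qvar_mono lamP qB) // ltW.
    rewrite normrM (ger0_norm B0) ler_wpM2r // HM //.
    by rewrite yb (le_trans ax) // ltW.
  move=> s' t' as_ st tb; have [c1 _ _] := HQf s' t' as_ st tb.
  case: hF1 => _ /(_ s' t' as_ st tb) c2 _ _; have [hs ht] := in1 s' t' as_ st tb.
  have -> : 0 = (qcov a b lam G f t' - qcov a b lam G f s') + (F1 t' - F1 s').
    by have := v1 s' hs; have := v1 t' ht; lra.
  exact: cvg_psumD.
move=> as_ st tb; have [hs ht] := in1 s t as_ st tb.
have [_ _ n1] := negligible_weight lamP nc rG ab; have [_ _ n2] := neg_K rG2.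
have [c1 _ _] := HQ s t as_ st tb; case: hF2 => _ /(_ s t as_ st tb) c2 _ _.
have -> : 0 = (qvar a b lam G t - qvar a b lam G s) + -1 * (F2 t - F2 s) + 2 * 0 + 0.
  by have := v2 s hs; have := v2 t ht; lra.
have := cvg_psumD (cvg_psumD (cvg_psumD c1 (cvg_psumZ (-1) c2)) (cvg_psumZ 2 (n1 s t as_ st tb)))
  (n2 s t as_ st tb).
apply: cvg_psum_eq => // x y _ _ _; rewrite /defect; ring.
Qed.

Hypothesis sums : forall psi s t, dualW p a b psi -> a <= s -> s < t -> t <= b ->
  S (fun x y => psi y * defect x y) s t m @[m --> \oo] --> 0.

(** For the propagator [N] started at [s], N x * G x - N y * G y is the defect weighted by
    [N], minus the weighted propagator error, minus the product of an increment of [N]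
    and a term with vanishing sums of squares.  Hence N G agrees at [s] and [b]. *)
Lemma solution_propagator s : a <= s <= b -> G s = pg s b * G b.
Proof.
move=> hs; have [as_] := andP hs; rewrite le_eqVlt => /orP[/eqP->|sb].
  by rewrite /pg propagator_refl mul1r.
pose N x := pg s (Num.max s x).
have dN : dualW p a b N by exact: propagator_end_dualW.
have rN := dualW_regulated ab p1 dN.
have [M M0 HM] := regulated_bounded ab rN; have [MG MG0 HMG] := regulated_bounded ab rG.
have rNG : regulated a b (fun x => N x * G x) by exact: regulatedM.
have c1 := sums dN as_ sb (lexx b).
have [_ _ c2] := negligible_weight lamP (negligible_error ab lamP rf nf qB) rNG ab.
have [W evW] := propagator_sq_ev ab lamP rf nf qB.
have e2 : S (fun x y => (G y * err x y) ^+ 2) s b m @[m --> \oo] --> 0.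
  apply: (sq_weight_sum (M := MG) sb) => [|x y sx xy yt].
    exact: (error_sq_sum ab lamP rf nf qB).
  by apply: HMG; have [_ _ _ _] := sub_in as_ (lexx b) sx xy yt.
have c3 : S (fun x y => (pg x y - 1) * (N x * (defect x y - G y * err x y))) s b m
    @[m --> \oo] --> 0.
  apply: (cross_sum lamP evW as_ sb (lexx b)).
  apply: (sq_weight_sum (M := M) sb) => [|x y sx xy yt].
    by apply: sq_sub_sum => //; exact: defect_sq_sum.
  by apply: HM; have [_ _ _ ->] := sub_in as_ (lexx b) sx xy yt.
have := cvg_psumD (cvg_psumD c1 (cvg_psumZ (-1) (c2 s b as_ sb (lexx b)))) (cvg_psumZ (-1) c3).
rewrite !mulr0 !addr0 => c4.
have c5 : S (fun x y => - (N y * G y) - - (N x * G x)) s b m @[m --> \oo] --> 0.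
  apply: cvg_psum_eq c4 => // x y sx xy yt.
  have [ax xy' yb _ _] := sub_in as_ (lexx b) sx xy yt.
  have -> : N x = pg s x by rewrite /N (max_idPr sx).
  have -> : N y = pg s x * pg x y.
    by rewrite /N (max_idPr (le_trans sx xy')) /pg -(propagator_mul ab lamP qB as_ sx xy' yb).
  rewrite /defect /err /propagator_error -/pg; ring.
have c6 : S (fun x y => - (N y * G y) - - (N x * G x)) s b m @[m --> \oo] -->
    - (N b * G b) - - (N s * G s).
  rewrite (_ : (fun m => _) = (fun=> - (N b * G b) - - (N s * G s))); first exact: cvg_cst.
  by apply/funext => m; rewrite (psum_tele (fun x => - (N x * G x))) restr_last.
have e : 0 = - (N b * G b) - - (N s * G s) by apply: (cvg_unique _ c5 c6); exact: norm_hausdorff.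
have Nb : N b = pg s b by rewrite /N (max_idPr (ltW sb)).
have Ns : N s = 1 by rewrite /N maxxx; exact: propagator_refl.
by move: e; rewrite Nb Ns; lra.
Qed.

End uniqueness.

End solution.

(** * Existence and uniqueness *)

Section exponential.
Context {R : realType} (a b : R) (lam : nat -> seq R).
Hypotheses (ab : a < b) (lamP : Lambda a b lam).
Variables (p : R) (f : R -> R).
Hypotheses (p1 : 1 <= p) (p2 : p < 2) (rf : regulated a b f).
Hypothesis fleft : decomp_left a b lam p f !=set0.

Let qn : has_qvar a b lam f /\ jumps_in_cup a b lam f. Proof. exact: (has_qvar_sum ab lamP p1 p2 rf fleft). Qed.
Let nf := qn.2.
Let qB : is_qcov a b lam f f (qvar a b lam f). Proof. by apply: qcovP; case: qn. Qed.

Lemma doleans_propagator : doleans a b lam f = (fun x => propagator a f (qvar a b lam f) x b).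
Proof.
apply/funext => x; rewrite /doleans; case: eqP => [->|_]; first by rewrite propagator_refl.
by rewrite -mulrA.
Qed.

Lemma doleans_well_defined : doleans_defined a b lam f.
Proof.
have tj := tail_bound_jumps ab lamP qB; have tf := tail_bound_factors ab lamP qB.
split; first by case: qn.
  move=> t /andP[at_ tb]; split; eexists.
    exact: (usum_cvgP (fin_bounded_oc tj (lexx a) at_ tb)).
  exact: (usum_cvgP (fin_bounded_co tj (lexx a) at_ tb)).
move=> x /andP[ax /ltW xb]; split.
  exact: (summable_fin_bounded (fin_bounded_oc tf ax xb (lexx b))).
exact: (summable_fin_bounded (fin_bounded_co tf ax xb (lexx b))).
Qed.

Lemma doleans_solution : aug_solution a b lam p f (doleans a b lam f).
Proof.
rewrite doleans_propagator; set G := (fun x => _).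
have dG : dualW p a b G by exact: (propagator_start_dualW ab lamP rf qB p1 p2 fleft).
have rG := dualW_regulated ab p1 dG.
have rG2 : regulated a b (fun x => G x ^+ 2) by exact: regulatedM.
have [F1 h1] := RY_integral_qvar ab lamP nf qB rG; have [F2 h2] := RY_integral_qvar ab lamP nf qB rG2.
have q1 := propagator_qcov_driver ab lamP rf nf qB p1 p2 fleft h1.
have q2 := propagator_qvar ab lamP rf nf qB p1 p2 fleft h2.
have hq : has_qvar a b lam G by eexists; exact: q2.
split=> //.
- by move=> g h psi; exact: (propagator_RC ab lamP rf nf qB p1 p2 fleft).
- by split=> //; [case: qn|eexists; exact: q1].
- move=> y hy; have [ay yb] := andP hy; rewrite [qvar a b lam G y](qcov_eq q2 hy) (qcov_eq q1 hy).
  split; first by rewrite mul1r; exact: (RY_integral_is_RY h2).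
  by rewrite mulN1r opprK; exact: (RY_integral_is_RY h1).
Qed.

Lemma aug_solution_unique G : aug_solution a b lam p f G -> G b = 1 ->
  forall x, a <= x <= b -> G x = doleans a b lam f x.
Proof.
move=> [[dG hG] RC [_ _ hGf] br] Gb x hx; rewrite doleans_propagator.
have [[g h] gh] := fleft.
have := @solution_propagator _ a b lam ab lamP f _ rf nf qB p p1 p2 fleft G dG (qcovP hG) (qcovP hGf) br _ x hx.
rewrite Gb mulr1; apply => psi s t dpsi as_ st tb.
have [Psi rc ry] := RC g h psi gh dpsi.
exact: (defect_sum ab lamP p1 dG gh dpsi rc ry).
Qed.

End exponential.

Theorem theorem51 (R : realType) (a b : R) (ab : a < b) (lam : nat -> seq R)
  (lamP : Lambda a b lam) (p : R) (p1 : 1 <= p) (p2 : p < 2) (f : R -> R)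
  (fdec : decomposable a b lam p f) (fleft : decomp_left a b lam p f !=set0) :
  [/\ doleans_defined a b lam f,
      aug_solution a b lam p f (doleans a b lam f) /\ doleans a b lam f b = 1 &
      forall G : R -> R, aug_solution a b lam p f G -> G b = 1 ->
        forall x : R, a <= x <= b -> G x = doleans a b lam f x].
Proof.
have [rf _] := fdec; split.
- exact: (doleans_well_defined ab lamP p1 p2 rf fleft).
- split; first exact: (doleans_solution ab lamP p1 p2 rf fleft).
  by rewrite /doleans eqxx.
- exact: (aug_solution_unique ab lamP p1 p2 rf fleft).
Qed.
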